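(* Let $\Lambda_{ABC}$ be a 2EPR-GHZ box, and let $\tilde\Lambda_{ABC}=\Lambda_{ABC}\circ(\Lambda_{AC_1}^T\otimes\Lambda_{BC_2}^T)$ be the map obtained by applying the $U_AV_BU_{C_1}^*V_{C_2}^*$-twirling $\Lambda_{AC_1}^T\otimes\Lambda_{BC_2}^T$ to its input. Then $\tilde\Lambda_{ABC}$ is again a 2EPR-GHZ box, its communication value in the direction $C\to AB$ is less than $1$, and it is non-signalling with respect to $C\to A$ and with respect to $C\to B$. In particular, $\tilde\Lambda_{ABC}$ satisfies $\mathrm{CV}\le 0.469782$.
   Context: Three parties: Alice ($A$), Bob ($B$), Charlie ($C$). Notation: $|\Psi^+\rangle_{XY}=\frac1{\sqrt2}(|00\rangle+|11\rangle)$ (EPR pair of two qubits), $|GHZ\rangle_{ABC}=\frac1{\sqrt2}(|000\rangle+|111\rangle)$. A tripartite LOCC operation $\Lambda_{ABC}$ is a quantum channel (completely positive trace-preserving map) implemented by Alice, Bob and Charlie by rounds of local quantum operations and classical communication among them, with no pre-shared entanglement. Alice's and Bob's systems are qubits both at input and at output. An LOCC operation is called a 2EPR-GHZ box if Charlie's input system consists of two qubits $C=C_1C_2$ and the input $|\Psi^+\rangle_{AC_1}|\Psi^+\rangle_{BC_2}$ is mapped to the output $|GHZ\rangle_{ABC}$. No requirement is made on the action of the box on other inputs. $UU^*$-twirling on two qubits $X,Y$: $\Lambda_{XY}^T(\sigma_{XY})=\int dU\,(U_X\otimes U_Y^* )\,\sigma_{XY}\,(U_X\otimes U_Y^* )^\dagger$,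 where $dU$ is the normalized Haar measure on the unitary group $U(2)$ and $U^*$ is the entrywise complex conjugate of $U$ in the computational basis. In $\Lambda_{AC_1}^T\otimes\Lambda_{BC_2}^T$ the two twirlings use independent Haar-distributed unitaries $U$ and $V$. Communication value (CV) of a box, in the direction $C\to AB$: the maximal asymptotic rate (capacity), in classical bits per use of the box, at which the user Charlie can reliably (with error probability vanishing as the number $n$ of uses tends to infinity) send classical messages to the users Alice and Bob by means of $n$ uses of the box. Here Alice and Bob are regarded as a single party that may perform arbitrary joint quantum operations; the users may consume an arbitrary amount of pre-shared entanglement and use local ancillas, and may feed any (message-independent, shared) input state into the box, with Charlie applying message-dependent local operations on his systems; apart from the box there is no communication between Charlie and Alice–Bob. Signalling: a map $\Lambda$ is signalling from $C$ to $A$ if there exist a state $\rho_{ABC}$ and two quantum operations (channels) $\Gamma^0,\Gamma^1$ acting on $C$ alone such that the reduced states on $A$ of $\Lambda(\Gamma^0[\rho])$ and $\Lambda(\Gamma^1[\rho])$ differ; otherwise it is non-signalling with respect to $C\to A$. Similarly for $C\to B$. *)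

(* Defs.v *)
From HB Require Import structures.
From mathcomp Require Import all_boot all_order all_algebra.
From mathcomp Require Import sesquilinear spectral.
From mathcomp Require Import complex mxtens.
From mathcomp Require Import all_classical all_reals all_analysis.

Set Implicit Arguments.
Unset Strict Implicit.
Unset Printing Implicit Defensive.

Import Order.TTheory GRing.Theory Num.Theory.
Import numFieldNormedType.Exports.

Local Open Scope classical_set_scope.
Local Open Scope ring_scope.
Local Open Scope sesquilinear_scope.

Section States.
Variable R : realType.
Local Notation C := R[i].

(* In R[i], 0 <= z forces z to be real, so A is in particular Hermitian. *)
Definition psdmx n (A : 'M[C]_n) : Prop :=
  forall v : 'cV[C]_n, 0 <= (v^t* *m A *m v) 0 0.

Definition density n (rho : 'M[C]_n) : Prop := psdmx rho /\ \tr rho = 1.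

Definition ket n (i : 'I_n) : 'cV[C]_n := delta_mx i 0.

Definition pure n (v : 'cV[C]_n) : 'M[C]_n := v *m v^t*.

(* Systems are always ordered A, B, C, and C = C1 C2; so the product of the
   EPR pairs on A C1 and B C2 is (1/2) \sum_(j, k) |j>_A |k>_B |j>_C1 |k>_C2. *)
Definition two_epr : 'cV[C]_(2 * 2 * (2 * 2)) :=
  ((sqrtC 2)^-1 * (sqrtC 2)^-1) *:
    \sum_(j < 2) \sum_(k < 2) (ket j *t ket k *t (ket j *t ket k)).

Definition ghz : 'cV[C]_(2 * 2 * 2) :=
  (sqrtC 2)^-1 *: \sum_(j < 2) (ket j *t ket j *t ket j).

Definition ptrace_r m n (X : 'M[C]_(m * n)) : 'M[C]_m :=
  \matrix_(i, j) \sum_(k < n) X (mxtens_index (i, k)) (mxtens_index (j, k)).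

Definition ptrace_l m n (X : 'M[C]_(m * n)) : 'M[C]_n :=
  \matrix_(i, j) \sum_(k < m) X (mxtens_index (k, i)) (mxtens_index (k, j)).

End States.

Section Channels.
Variable R : realType.
Local Notation C := R[i].

(* The tensor product of two linear maps on matrices, given by its values on
   the matrix units delta_mx i j *t delta_mx k l. *)
Definition map_tens m n m' n'
    (Phi : 'M[C]_m -> 'M[C]_m') (Psi : 'M[C]_n -> 'M[C]_n')
    (X : 'M[C]_(m * n)) : 'M[C]_(m' * n') :=
  \sum_(i < m) \sum_(j < m) \sum_(k < n) \sum_(l < n)
    X (mxtens_index (i, k)) (mxtens_index (j, l)) *:
      (Phi (delta_mx i j) *t Psi (delta_mx k l)).

Definition completely_positive m n (Phi : 'M[C]_m -> 'M[C]_n) : Prop :=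
  linear Phi /\
  forall (k : nat) (X : 'M[C]_(m * k)), psdmx X ->
    psdmx (map_tens Phi (@id 'M[C]_k) X).

Definition channel m n (Phi : 'M[C]_m -> 'M[C]_n) : Prop :=
  completely_positive Phi /\ forall X, \tr (Phi X) = \tr X.

(* The dimension of the output system may depend on the outcome. *)
Definition instrument k m (n : 'I_k -> nat)
    (E : forall i : 'I_k, 'M[C]_m -> 'M[C]_(n i)) : Prop :=
  (forall i, completely_positive (E i)) /\
  forall X, \sum_(i < k) \tr (E i X) = \tr X.

(* In each round one party applies a local instrument and broadcasts its
   outcome i, on which the whole remaining protocol L i may depend; the outputs
   of the different branches are averaged at the end.  Local ancillas, local
   randomness and discarding of systems are instruments that change the
   dimension. *)
Inductive locc (a' b' c' : nat) : forall a b c : nat,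
    ('M[C]_(a * b * c) -> 'M[C]_(a' * b' * c')) -> Prop :=
| locc_stop : @locc a' b' c' a' b' c' id
| locc_A a b c k (n : 'I_k -> nat)
    (E : forall i, 'M[C]_a -> 'M[C]_(n i))
    (L : forall i, 'M[C]_(n i * b * c) -> 'M[C]_(a' * b' * c')) :
    instrument E -> (forall i, @locc a' b' c' (n i) b c (L i)) ->
    @locc a' b' c' a b c (fun X => \sum_(i < k)
      L i (map_tens (map_tens (E i) (@id 'M[C]_b)) (@id 'M[C]_c) X))
| locc_B a b c k (n : 'I_k -> nat)
    (E : forall i, 'M[C]_b -> 'M[C]_(n i))
    (L : forall i, 'M[C]_(a * n i * c) -> 'M[C]_(a' * b' * c')) :
    instrument E -> (forall i, @locc a' b' c' a (n i) c (L i)) ->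
    @locc a' b' c' a b c (fun X => \sum_(i < k)
      L i (map_tens (map_tens (@id 'M[C]_a) (E i)) (@id 'M[C]_c) X))
| locc_C a b c k (n : 'I_k -> nat)
    (E : forall i, 'M[C]_c -> 'M[C]_(n i))
    (L : forall i, 'M[C]_(a * b * n i) -> 'M[C]_(a' * b' * c')) :
    instrument E -> (forall i, @locc a' b' c' a b (n i) (L i)) ->
    @locc a' b' c' a b c (fun X => \sum_(i < k)
      L i (map_tens (@id 'M[C]_(a * b)) (E i) X)).

End Channels.

Section Boxes.
Variable R : realType.
Local Notation C := R[i].

Definition qbox := 'M[C]_(2 * 2 * (2 * 2)) -> 'M[C]_(2 * 2 * 2).

Definition two_epr_ghz_box (L : qbox) : Prop :=
  @locc R 2 2 2 2 2 (2 * 2) L /\ L (pure (two_epr R)) = pure (ghz R).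

Definition apply_C (G : 'M[C]_(2 * 2) -> 'M[C]_(2 * 2)) :
    'M[C]_(2 * 2 * (2 * 2)) -> 'M[C]_(2 * 2 * (2 * 2)) :=
  map_tens (@id 'M[C]_(2 * 2)) G.

Definition reduced_A (X : 'M[C]_(2 * 2 * 2)) : 'M[C]_2 :=
  ptrace_r (ptrace_r X).

Definition reduced_B (X : 'M[C]_(2 * 2 * 2)) : 'M[C]_2 :=
  ptrace_l (ptrace_r X).

Definition signalling_to (reduced : 'M[C]_(2 * 2 * 2) -> 'M[C]_2) (L : qbox) :
    Prop :=
  exists (rho : 'M[C]_(2 * 2 * (2 * 2))) (G0 G1 : 'M[C]_(2 * 2) -> 'M[C]_(2 * 2)),
    [/\ density rho, channel G0, channel G1 &
        reduced (L (apply_C G0 rho)) <> reduced (L (apply_C G1 rho))].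

Definition signalling_CA : qbox -> Prop := signalling_to reduced_A.
Definition signalling_CB : qbox -> Prop := signalling_to reduced_B.

End Boxes.

Section Twirling.
Variable R : realType.
Local Notation C := R[i].

HB.instance Definition _ := isPointed.Build R[i] 0.

(* The Borel sigma-algebra of 'M[C]_2, seen as R^8, is generated by the real
   and imaginary parts of the entries. *)
Definition entry_sets : set (set 'M[C]_2) :=
  [set A | exists (i j : 'I_2) (B : set R), measurable B /\
    (A = [set U : 'M[C]_2 | B (complex.Re (U i j))] \/
     A = [set U : 'M[C]_2 | B (complex.Im (U i j))])].

Definition borelM2 : measurableType _ := g_sigma_algebraType entry_sets.

Definition U2 : set borelM2 := [set U : 'M[C]_2 | U \is unitarymx].

(* The normalized Haar measure of U(2), as a Borel measure on 'M[C]_2 carried by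
   U(2). *)
Definition is_haar_U2 (mu : probability borelM2 R) : Prop :=
  mu U2 = 1%E /\
  forall (V : 'M[C]_2) (A : set borelM2), V \is unitarymx -> measurable A ->
    mu [set U : borelM2 | A (V *m (U : 'M[C]_2))] = mu A.

Definition mx_integral (mu : probability borelM2 R) m n
    (F : 'M[C]_2 -> 'M[C]_(m, n)) : 'M[C]_(m, n) :=
  \matrix_(i, j)
    Complex (Rintegral mu U2 (fun U => complex.Re (F U i j)))
            (Rintegral mu U2 (fun U => complex.Im (F U i j))).

Definition conj_by n (W X : 'M[C]_n) : 'M[C]_n := W *m X *m W^t*.

Definition twirl_AC1 (mu : probability borelM2 R)
    (X : 'M[C]_(2 * 2 * (2 * 2))) : 'M[C]_(2 * 2 * (2 * 2)) :=
  mx_integral mu (fun U =>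
    conj_by (U *t 1%:M *t (map_mx Num.conj U *t 1%:M)) X).

Definition twirl_BC2 (mu : probability borelM2 R)
    (X : 'M[C]_(2 * 2 * (2 * 2))) : 'M[C]_(2 * 2 * (2 * 2)) :=
  mx_integral mu (fun V =>
    conj_by (1%:M *t V *t (1%:M *t map_mx Num.conj V)) X).

Definition twirl (mu : probability borelM2 R)
    (X : 'M[C]_(2 * 2 * (2 * 2))) : 'M[C]_(2 * 2 * (2 * 2)) :=
  twirl_AC1 mu (twirl_BC2 mu X).

End Twirling.

Section CommunicationValue.
Variable R : realType.
Local Notation C := R[i].

Lemma regroup_eq d x y e : (d * x * (y * e) = d * (x * y) * e)%N.
Proof. by rewrite !mulnA. Qed.

Definition regroup d x y e (X : 'M[C]_(d * x * (y * e))) :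
    'M[C]_(d * (x * y) * e) :=
  castmx (regroup_eq d x y e, regroup_eq d x y e) X.

Definition ungroup d x y e (X : 'M[C]_(d * (x * y) * e)) :
    'M[C]_(d * x * (y * e)) :=
  castmx (esym (regroup_eq d x y e), esym (regroup_eq d x y e)) X.

(* Here the global system is split as (Alice-Bob) (x) Charlie; d and e are the
   dimensions of the memories kept beside the box. *)
Definition use_box (L : qbox R) d e
    (X : 'M[C]_(d * (2 * 2) * (2 * 2 * e))) : 'M[C]_(d * (2 * 2) * (2 * e)) :=
  ungroup (map_tens (map_tens (@id 'M[C]_d) L) (@id 'M[C]_e) (regroup X)).

(* encodes L M n d e sigma : sigma m is a joint state, of an Alice-Bob laboratory
   of dimension d and a Charlie laboratory of dimension e, that can be reached
   with n uses of L when Charlie's message is m : 'I_M.  The initial state is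
   arbitrary (pre-shared entanglement included) and, like the operations F of
   Alice-Bob, does not depend on the message; Charlie's operations G do.  Uses
   may be adaptive, and keeping all inputs in the memories from the start gives
   the parallel uses of L on an arbitrary joint input. *)
Inductive encodes (L : qbox R) (M : nat) : forall n d e : nat,
    ('I_M -> 'M[C]_(d * e)) -> Prop :=
| encodes_start d e (rho : 'M[C]_(d * e)) :
    density rho -> @encodes L M 0 d e (fun=> rho)
| encodes_use n d e d1 e1 (sigma : 'I_M -> 'M[C]_(d * e))
    (F : 'M[C]_d -> 'M[C]_(d1 * (2 * 2)))
    (G : 'I_M -> 'M[C]_e -> 'M[C]_(2 * 2 * e1)) :
    @encodes L M n d e sigma -> channel F -> (forall m, channel (G m)) ->
    @encodes L M n.+1 (d1 * (2 * 2)) (2 * e1)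
      (fun m => use_box L (map_tens F (G m) (sigma m))).

Definition povm k d (D : 'I_k -> 'M[C]_d) : Prop :=
  (forall i, psdmx (D i)) /\ \sum_(i < k) D i = 1%:M.

Definition error_le (L : qbox R) (n M : nat) (eps : R) : Prop :=
  exists (d e : nat) (sigma : 'I_M -> 'M[C]_(d * e)) (D : 'I_M -> 'M[C]_d),
    [/\ encodes L n sigma, povm D &
        forall m, 1 - complex.Re (\tr (D m *m ptrace_r (sigma m))) <= eps].

(* 2 `^ (n * r) <= M says that n uses carry at least r bits per use. *)
Definition achievable_rate (L : qbox R) (r : R) : Prop :=
  forall eps : R, 0 < eps -> exists n0 : nat, forall n : nat, (n0 <= n)%N ->
    exists M : nat, 2 `^ (n%:R * r) <= M%:R /\ error_le L n M eps.

Definition CV (L : qbox R) : \bar R :=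
  ereal_sup [set r%:E | r in achievable_rate L].

End CommunicationValue.

(* Main.v *)
(** The twirled box is completely determined by the fact that L is an LOCC map
    sending the two EPR pairs to a GHZ state, and its communication value is that
    of a classical channel.

    Twirling replaces the input by a mixture of the operators P (x) P, P (x) 1,
    1 (x) P and 1 (x) 1 on A C1 and B C2, where P projects on the EPR state.  The
    Haar twirl agrees with the average over finitely many unitaries, because both
    land in the commutant of the latter and preserve the overlap with P; so the
    twirl can be performed by LOCC.

    The values of L are computed by partial transposition T: if L is LOCC, so is
    T L T, which is therefore positive and trace preserving.  On A, T turns P into
    half the swap, so H = T L (1 (x) P) / 2 majorizes both G and - G, where
    G = T (GHZ), while the trace of H equals the trace norm of G; this forces
    H = |G|.  Transposing A and B together determines L (1 (x) 1) in the same way.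

    Consequently Alice and Bob only receive a bit (equal or different outcomes),
    uniformly mixed within each class, so each of their marginals is maximally
    mixed and nothing is signalled to either of them alone.  As a channel from the
    four outcomes of the twirl to this bit, the box has transition rows (1, 0),
    (1/3, 2/3), twice, and (5/9, 4/9).  Its capacity is log2 (1 + 2 / (3 sqrt 3)).
    For the converse, the joint state is expanded along the trajectories of
    outcomes and bits; replacing the transition probabilities by an output
    distribution q makes Alice and Bob's state independent of the message, and the
    log-likelihood ratio has mean at most the divergence of the rows from q. *)

From HB Require Import structures.
From Stdlib Require Import NArith PArith Pnat Lia.
From mathcomp Require Import all_boot all_order all_algebra.
From mathcomp Require Import sesquilinear spectral.
From mathcomp Require Import complex mxtens.
From mathcomp Require Import all_classical all_reals all_analysis.
From mathcomp Require Import ring lra measurable_realfun.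
Require Import Defs.

Set Implicit Arguments.
Unset Strict Implicit.
Unset Printing Implicit Defensive.

Import Order.TTheory GRing.Theory Num.Theory.
Import numFieldNormedType.Exports.

Local Open Scope classical_set_scope.
Local Open Scope ring_scope.
Local Open Scope sesquilinear_scope.

(** * Maps on tensor products *)

(** Positivity of [L] itself only gives the one-sided bound L (1 (x) P) >= GHZ. Transposition makes
    it two-sided: 1 + s F is positive for both signs of s, so one map bounds H + G and H - G, and
    trace preservation leaves no slack between [tr H] and the trace norm of G. In the joint
    transposition the products (1 + s F) (x) (1 + t F) also carry terms with a single F; these are
    known from the single transpositions, and shifting by them restores a pair G, - G.

    The row (5/9, 4/9) is the mixture 1/3 (1, 0) + 2/3 (1/3, 2/3), so the capacity is that of a
    Z-channel with flip probability 1/3.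

    The obstacle in the converse is that Charlie may act adaptively and keeps a quantum system
    correlated with the hidden outcome and with Alice and Bob's memory, so the uses do not reduce
    directly to a classical code. Decoding, however, sees only Alice and Bob's marginal, to which
    the prepared state contributes through the bit alone. A change of measure on each trajectory,
    followed by a threshold on the log-likelihood ratio, then does the work of Fano's inequality. *)

Notation mi i k := (mxtens_index (i, k)).

Section LinearMaps.
Variables (K : pzRingType) (U V : lmodType K) (f : U -> V).
Hypothesis lf : linear f.

Lemma linD u v : f (u + v) = f u + f v.
Proof. by have := lf 1 u v; rewrite !scale1r. Qed.

Lemma lin0 : f 0 = 0.
Proof. by apply: (addIr (f 0)); rewrite -linD !add0r. Qed.

Lemma linZ a u : f (a *: u) = a *: f u.
Proof. by have := lf a u 0; rewrite lin0 !addr0. Qed.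

Lemma linN u : f (- u) = - f u.
Proof. by rewrite -scaleN1r linZ scaleN1r. Qed.

Lemma linB u v : f (u - v) = f u - f v.
Proof. by rewrite linD linN. Qed.

Lemma lin_sum (I : Type) (r : seq I) (P : pred I) (F : I -> U) :
  f (\sum_(i <- r | P i) F i) = \sum_(i <- r | P i) f (F i).
Proof. exact: (big_morph f linD lin0). Qed.

End LinearMaps.

Lemma mi_eq m n (i j : 'I_m) (k l : 'I_n) :
  (mi i k == mi j l) = (i == j) && (k == l).
Proof.
apply/eqP/andP => [/(congr1 (@mxtens_unindex m n))|[/eqP-> /eqP->]//].
by rewrite !mxtens_indexK => -[-> ->].
Qed.

Lemma sum_mi (V : nmodType) m n (F : 'I_(m * n) -> V) :
  \sum_i F i = \sum_(i < m) \sum_(k < n) F (mi i k).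
Proof.
rewrite pair_big; apply: reindex => /=.
exists (@mxtens_unindex m n) => [[i j]|i] _; first exact: mxtens_indexK.
by rewrite -surjective_pairing mxtens_unindexK.
Qed.

Lemma mxtensP (T : Type) m n m' n' (X Y : 'M[T]_(m * n, m' * n')) :
  (forall i k j l, X (mi i k) (mi j l) = Y (mi i k) (mi j l)) -> X = Y.
Proof.
move=> XY; apply/matrixP => i j.
by case: (mxtens_indexP i) => i1 i2; case: (mxtens_indexP j) => j1 j2.
Qed.

Section TensorMaps.
Variable R : realType.
Local Notation C := R[i].

Lemma map_tensE m n m' n' (Phi : 'M[C]_m -> 'M[C]_m') (Psi : 'M[C]_n -> 'M[C]_n')
    X i k j l :
  map_tens Phi Psi X (mi i k) (mi j l) =
  \sum_i' \sum_j' \sum_k' \sum_l' X (mi i' k') (mi j' l') *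
     (Phi (delta_mx i' j') i j * Psi (delta_mx k' l') k l).
Proof.
rewrite /map_tens summxE; apply: eq_bigr => i' _.
rewrite summxE; apply: eq_bigr => j' _.
rewrite summxE; apply: eq_bigr => k' _.
rewrite summxE; apply: eq_bigr => l' _.
by rewrite mxE tensmxE.
Qed.

Lemma lin_mxE m n m' n' (Phi : 'M[C]_(m, n) -> 'M[C]_(m', n')) : linear Phi ->
  forall X i j, Phi X i j = \sum_i' \sum_j' X i' j' * Phi (delta_mx i' j') i j.
Proof.
move=> lPhi X i j; rewrite {1}(matrix_sum_delta X) (lin_sum lPhi) summxE.
apply: eq_bigr => i' _; rewrite (lin_sum lPhi) summxE.
by apply: eq_bigr => j' _; rewrite (linZ lPhi) mxE.
Qed.

Lemma map_tens_lin m n m' n' (Phi : 'M[C]_m -> 'M[C]_m')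
  (Psi : 'M[C]_n -> 'M[C]_n') : linear (map_tens Phi Psi).
Proof.
move=> a X Y; rewrite /map_tens scaler_sumr -big_split; apply: eq_bigr => i _ /=.
rewrite scaler_sumr -big_split; apply: eq_bigr => j _ /=.
rewrite scaler_sumr -big_split; apply: eq_bigr => k _ /=.
rewrite scaler_sumr -big_split; apply: eq_bigr => l _ /=.
by rewrite !mxE scalerDl scalerA.
Qed.

(** With the second indices [k] and [l] fixed, only one pair of matrix units of the second factor
    contributes. This slice formula and its mirror image [map_tens_idlE] stand in for the definition
    of [map_tens] in most of what follows. *)
Lemma map_tens_idrE m n m' (Phi : 'M[C]_m -> 'M[C]_m') X i (k : 'I_n) j l :
  linear Phi ->
  map_tens Phi id X (mi i k) (mi j l) =
  Phi (\matrix_(i', j') X (mi i' k) (mi j' l)) i j.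
Proof.
move=> lPhi; rewrite map_tensE (lin_mxE lPhi).
apply: eq_bigr => i' _; apply: eq_bigr => j' _.
rewrite (bigD1 k) //= (bigD1 l) //= !mxE !eqxx mulr1 !big1 ?addr0 // => k' nk.
  by rewrite big1 // => l' _; rewrite mxE eq_sym (negbTE nk) !mulr0.
by rewrite mxE eqxx eq_sym (negbTE nk) !mulr0.
Qed.

Lemma map_tens_idlE m n n' (Psi : 'M[C]_n -> 'M[C]_n') X (i : 'I_m) k j l :
  linear Psi ->
  map_tens id Psi X (mi i k) (mi j l) =
  Psi (\matrix_(k', l') X (mi i k') (mi j l')) k l.
Proof.
move=> lPsi; rewrite map_tensE (lin_mxE lPsi).
rewrite (bigD1 i) //= (bigD1 j) //= [X in _ + _ + X]big1 => [|i' ni]; last first.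
  apply: big1 => j' _; apply: big1 => k' _; apply: big1 => l' _.
  by rewrite mxE eq_sym (negbTE ni) mul0r mulr0.
rewrite [X in _ + X + _]big1 => [|j' nj]; last first.
  apply: big1 => k' _; apply: big1 => l' _.
  by rewrite mxE [j == _]eq_sym (negbTE nj) andbF mul0r mulr0.
rewrite !addr0; apply: eq_bigr => k' _; apply: eq_bigr => l' _.
by rewrite !mxE !eqxx mul1r.
Qed.

Lemma map_tens_comp m n m' n' (Phi : 'M[C]_m -> 'M[C]_m')
    (Psi : 'M[C]_n -> 'M[C]_n') X : linear Phi -> linear Psi ->
  map_tens Phi Psi X = map_tens id Psi (map_tens Phi id X).
Proof.
move=> lPhi lPsi; apply: mxtensP => i k j l.
rewrite map_tens_idlE // map_tensE (lin_mxE lPsi) pair_big /=.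
under [RHS]eq_bigr do under eq_bigr do
  rewrite mxE map_tens_idrE // (lin_mxE lPhi) pair_big mulr_suml.
rewrite [RHS]pair_big [RHS]exchange_big /=; apply: eq_bigr => -[i' j'] _ /=.
rewrite pair_big; apply: eq_bigr => -[k' l'] _ /=.
by rewrite mxE mulrA.
Qed.

Lemma ptrace_r_lin m n : linear (@ptrace_r R m n).
Proof.
move=> a X Y; apply/matrixP => i j; rewrite !mxE mulr_sumr -big_split.
by apply: eq_bigr => k _; rewrite !mxE.
Qed.

Lemma ptrace_l_lin m n : linear (@ptrace_l R m n).
Proof.
move=> a X Y; apply/matrixP => i j; rewrite !mxE mulr_sumr -big_split.
by apply: eq_bigr => k _; rewrite !mxE.
Qed.

Lemma tr_ptrace_r m n (X : 'M[C]_(m * n)) : \tr (ptrace_r X) = \tr X.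
Proof. by rewrite /mxtrace sum_mi; apply: eq_bigr => i _; rewrite mxE. Qed.

(* Trace preservation of Psi makes the second factor invisible to the first. *)
Lemma ptrace_r_map_tens m n m' n' (Phi : 'M[C]_m -> 'M[C]_m')
    (Psi : 'M[C]_n -> 'M[C]_n') X : linear Phi -> linear Psi ->
  (forall Y, \tr (Psi Y) = \tr Y) ->
  ptrace_r (map_tens Phi Psi X) = Phi (ptrace_r X).
Proof.
move=> lPhi lPsi trPsi; rewrite map_tens_comp //; apply/matrixP => i j.
rewrite mxE.
under eq_bigr do rewrite map_tens_idlE //.
rewrite -[LHS]/(\tr _) trPsi /mxtrace.
under eq_bigr do rewrite mxE map_tens_idrE //.
rewrite -summxE -(lin_sum lPhi); congr (Phi _ i j).
by apply/matrixP => i' j'; rewrite summxE mxE; apply: eq_bigr => k _; rewrite mxE.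
Qed.

End TensorMaps.

(** * Positive matrices *)

Lemma quadD (C : numClosedFieldType) n (X : 'M[C]_n) (u v : 'cV[C]_n) (t : C) :
  ((u + t *: v)^t* *m X *m (u + t *: v)) 0 0 =
  (u^t* *m X *m u) 0 0 + t * (u^t* *m X *m v) 0 0
  + Num.conj t * (v^t* *m X *m u) 0 0
  + Num.conj t * t * (v^t* *m X *m v) 0 0.
Proof.
have -> : (u + t *: v)^t* = u^t* + Num.conj t *: v^t*.
  by apply/matrixP => i j; rewrite !mxE rmorphD rmorphM.
have addE (A B : 'M[C]_1) : (A + B) 0 0 = A 0 0 + B 0 0 by rewrite mxE.
have sclE c (A : 'M[C]_1) : (c *: A) 0 0 = c * A 0 0 by rewrite mxE.
rewrite !mulmxDl !mulmxDr !addE -?scalemxAl -?scalemxAr -?scalemxAl.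
by rewrite !sclE !addrA mulrA.
Qed.

(** The form is real at u + v and at u + 'i v; these two conditions fix the real and the imaginary
    part. *)
Lemma psd_herm (C : numClosedFieldType) n (X : 'M[C]_n) :
  (forall v : 'cV[C]_n, 0 <= (v^t* *m X *m v) 0 0) -> forall u v : 'cV[C]_n,
  (v^t* *m X *m u) 0 0 = Num.conj ((u^t* *m X *m v) 0 0).
Proof.
move=> pX u v; set a := (u^t* *m X *m v) 0 0; set b := (v^t* *m X *m u) 0 0.
have r t : t * a + Num.conj t * b \is Num.real.
  have := ger0_real (pX (u + t *: v)); rewrite quadD.
  rewrite rpredDr; last first.
    by apply: ger0_real; rewrite mulr_ge0 // mulrC mul_conjC_ge0.
  by rewrite -addrA rpredDl // ger0_real.
have /CrealP := r 1; rewrite conjC1 !mul1r rmorphD => e1.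
have /CrealP := r 'i; rewrite rmorphD !rmorphM /= conjCK conjCi.
rewrite !mulNr addrC -!mulrBr => /(mulfI (neq0Ci _)) e2.
have e3 : Num.conj b *+ 2 = a *+ 2.
  transitivity ((Num.conj a + Num.conj b) + (Num.conj b - Num.conj a)).
    by ring.
  by rewrite e1 e2; ring.
have /eqP := e3; rewrite eqrMn2r // => /eqP <-; by rewrite conjCK.
Qed.

(** If a coordinate of X v were nonzero, moving [v] slightly along the corresponding basis vector
    would make the form negative. *)
Lemma psd_ker (C : numClosedFieldType) n (X : 'M[C]_n) (v : 'cV[C]_n) :
  (forall v : 'cV[C]_n, 0 <= (v^t* *m X *m v) 0 0) -> (v^t* *m X *m v) 0 0 = 0 -> X *m v = 0.
Proof.
move=> pX v0; apply/colP => i; rewrite [RHS]mxE.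
have -> : (X *m v) i 0 = ((delta_mx i 0 : 'cV_n)^t* *m X *m v) 0 0.
  by rewrite trmx_delta map_delta_mx -mulmxA -rowE [RHS]mxE.
set u := delta_mx i 0; rewrite (psd_herm pX v u).
set a := (v^t* *m X *m u) 0 0; pose c := (u^t* *m X *m u) 0 0.
have c0 : 0 <= c by apply: pX.
apply/eqP; rewrite conjC_eq0; apply/negPn/negP => a0.
have aa : 0 < a * Num.conj a by rewrite mul_conjC_gt0.
(* With this [s] the form at the shifted vector is s |a|^2 (s c - 2), where s c <= 1. *)
pose s := (c + 1)^-1; have s0 : 0 < s by rewrite invr_gt0 ltr_wpDl.
have := pX (v + (- (s * Num.conj a)) *: u).
rewrite quadD v0 add0r (psd_herm pX v u) -/a -/c rmorphN rmorphM /= conjCK.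
have -> : Num.conj s = s by apply/CrealP; rewrite ger0_real // ltW.
have -> : - (s * Num.conj a) * a + - (s * a) * Num.conj a +
    - (s * a) * - (s * Num.conj a) * c = (s * (a * Num.conj a)) * (s * c - 2).
  by ring.
have saa : 0 < s * (a * Num.conj a) by exact: mulr_gt0.
rewrite (pmulr_rge0 _ saa) subr_ge0 => le2.
have := le_trans le2 (_ : s * c <= 1); rewrite lern1 => /(_ _)/notF; apply.
by rewrite /s mulrC ler_pdivrMr ?ltr_wpDl // mul1r lerDl ler01.
Qed.

Lemma quad_delta (C : numClosedFieldType) n (X : 'M[C]_n) i j :
  ((delta_mx i 0 : 'cV_n)^t* *m X *m (delta_mx j 0 : 'cV_n)) 0 0 = X i j.
Proof. by rewrite trmx_delta map_delta_mx -rowE -colE !mxE. Qed.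

Section Positive.
Variable R : realType.
Local Notation C := R[i].
Implicit Types (m n k : nat).

Lemma ctmx_mul m n k (A : 'M[C]_(m, n)) (B : 'M[C]_(n, k)) :
  (A *m B)^t* = B^t* *m A^t*.
Proof. by rewrite trmx_mul map_mxM. Qed.

Lemma ctmxK m n (A : 'M[C]_(m, n)) : A^t*^t* = A.
Proof. by apply/matrixP => i j; rewrite !mxE conjCK. Qed.

Lemma psd_conj m n (W : 'M[C]_(m, n)) X : psdmx X -> psdmx (W *m X *m W^t*).
Proof.
by move=> pX v; have := pX (W^t* *m v); rewrite ctmx_mul ctmxK !mulmxA.
Qed.

(** This is congruence by a 0-1 matrix. Every reordering of tensor factors below is an [mxsub] along
    an index map, so its positivity comes from here. *)
Lemma psd_mxsub m n (f : 'I_m -> 'I_n) (X : 'M[C]_n) :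
  psdmx X -> psdmx (mxsub f f X).
Proof.
move=> /(psd_conj (rowsub f 1%:M)); congr psdmx.
apply/matrixP => i j; rewrite !mxE (bigD1 (f j)) //= big1 ?addr0 => [|k nk].
  rewrite !mxE eqxx conjC1 mulr1 (bigD1 (f i)) //= big1 ?addr0 => [|k nk].
    by rewrite !mxE eqxx mul1r.
  by rewrite !mxE eq_sym (negbTE nk) mul0r.
by rewrite !mxE eq_sym (negbTE nk) conjC0 mulr0.
Qed.

Lemma psd0 n : psdmx (0 : 'M[C]_n).
Proof. by move=> v; rewrite mulmx0 mul0mx mxE. Qed.

Lemma psdD n (X Y : 'M[C]_n) : psdmx X -> psdmx Y -> psdmx (X + Y).
Proof. by move=> pX pY v; rewrite mulmxDr mulmxDl mxE addr_ge0. Qed.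

Lemma psdZ n (a : C) (X : 'M[C]_n) : 0 <= a -> psdmx X -> psdmx (a *: X).
Proof. by move=> a0 pX v; rewrite -scalemxAr -scalemxAl mxE mulr_ge0. Qed.

Lemma psd_sum n (I : Type) (r : seq I) (P : pred I) (F : I -> 'M[C]_n) :
  (forall i, P i -> psdmx (F i)) -> psdmx (\sum_(i <- r | P i) F i).
Proof. by move=> pF; elim/big_rec: _ => [|i X Pi]; [exact: psd0|exact/psdD/pF]. Qed.

Lemma psd1 n : psdmx (1%:M : 'M[C]_n).
Proof.
move=> v; rewrite mulmx1 mxE sumr_ge0 // => i _; rewrite !mxE mulrC.
exact: mul_conjC_ge0.
Qed.

Lemma psd_gram m n (W : 'M[C]_(m, n)) : psdmx (W *m W^t*).
Proof. by have := psd_conj W (@psd1 n); rewrite mulmx1. Qed.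

Lemma psd_tr n (X : 'M[C]_n) : psdmx X -> psdmx X^T.
Proof.
move=> pX v; have := pX (map_mx Num.conj v).
have -> : (map_mx Num.conj v)^t* *m X *m map_mx Num.conj v =
          (v^t* *m X^T *m v)^T.
  rewrite !trmx_mul trmxK mulmxA; congr (_ *m _ *m _);
  by apply/matrixP => i j; rewrite !mxE ?conjCK.
by rewrite mxE.
Qed.

Lemma psd_diag n (X : 'M[C]_n) i : psdmx X -> 0 <= X i i.
Proof. by move=> pX; rewrite -(quad_delta X i i). Qed.

Lemma psd_tr_ge0 n (X : 'M[C]_n) : psdmx X -> 0 <= \tr X.
Proof. by move=> pX; apply: sumr_ge0 => i _; apply: psd_diag. Qed.

End Positive.

(** * LOCC maps are positive and trace preserving *)

Section LoccMaps.
Variable R : realType.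
Local Notation C := R[i].

(** Tensor factors are reordered by index maps rather than by casts: such maps compute on [mi], and
    [mxsub] along them preserves positivity. *)
Definition assocl a b c (x : 'I_(a * (b * c))) : 'I_(a * b * c) :=
  let u := mxtens_unindex x in let v := mxtens_unindex u.2 in
  mi (mi u.1 v.1) v.2.

Definition assocr a b c (x : 'I_(a * b * c)) : 'I_(a * (b * c)) :=
  let u := mxtens_unindex x in let v := mxtens_unindex u.1 in
  mi v.1 (mi v.2 u.2).

Definition swapi a b (x : 'I_(a * b)) : 'I_(b * a) :=
  let u := mxtens_unindex x in mi u.2 u.1.

Definition exch a b c (x : 'I_(a * b * c)) : 'I_(b * a * c) :=
  let u := mxtens_unindex x in mi (swapi u.1) u.2.

Lemma assoclE a b c i j k : @assocl a b c (mi i (mi j k)) = mi (mi i j) k.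
Proof. by rewrite /assocl !mxtens_indexK. Qed.

Lemma assocrE a b c i j k : @assocr a b c (mi (mi i j) k) = mi i (mi j k).
Proof. by rewrite /assocr !mxtens_indexK. Qed.

Lemma swapiE a b i j : @swapi a b (mi i j) = mi j i.
Proof. by rewrite /swapi !mxtens_indexK. Qed.

Lemma exchE a b c i j k : @exch a b c (mi (mi i j) k) = mi (mi j i) k.
Proof. by rewrite /exch !mxtens_indexK swapiE. Qed.

Definition idxE := (assoclE, assocrE, swapiE, exchE).

(** Complete positivity is stated for maps on the first factor only. This lemma and the next two
    move a map acting elsewhere into that position. *)
Lemma map_tens_idl_swap a m n (E : 'M[C]_m -> 'M[C]_n) : linear E ->
  forall X : 'M[C]_(a * m), map_tens id E X =
  mxsub (@swapi a n) (@swapi a n)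
    (map_tens E id (mxsub (@swapi m a) (@swapi m a) X)).
Proof.
move=> lE X; apply: mxtensP => i k j l; rewrite map_tens_idlE // mxE !idxE.
rewrite map_tens_idrE //; congr (E _ _ _).
by apply/matrixP => i' j'; rewrite !mxE !idxE.
Qed.

Lemma map_tens_idr_assoc a n b c (E : 'M[C]_a -> 'M[C]_n) : linear E ->
  forall X : 'M[C]_(a * b * c), map_tens (map_tens E id) id X =
  mxsub (@assocr n b c) (@assocr n b c)
    (map_tens E id (mxsub (@assocl a b c) (@assocl a b c) X)).
Proof.
move=> lE X; apply: mxtensP => i k j l.
case: (mxtens_indexP i) => i1 i2; case: (mxtens_indexP j) => j1 j2.
rewrite map_tens_idrE; last exact: map_tens_lin.
rewrite [RHS]mxE !idxE !map_tens_idrE //; congr (E _ _ _).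
by apply/matrixP => i' j'; rewrite !mxE !idxE.
Qed.

Lemma map_tens_idm_exch a b n c (E : 'M[C]_b -> 'M[C]_n) : linear E ->
  forall X : 'M[C]_(a * b * c), map_tens (map_tens id E) id X =
  mxsub (@exch a n c) (@exch a n c)
    (map_tens (map_tens E id) id (mxsub (@exch b a c) (@exch b a c) X)).
Proof.
move=> lE X; apply: mxtensP => i k j l.
case: (mxtens_indexP i) => i1 i2; case: (mxtens_indexP j) => j1 j2.
rewrite [RHS]mxE !exchE.
rewrite [RHS]map_tens_idrE; last exact: map_tens_lin.
rewrite [RHS]map_tens_idrE // [LHS]map_tens_idrE; last exact: map_tens_lin.
rewrite [LHS]map_tens_idlE //; congr (E _ _ _).
by apply/matrixP => i' j'; rewrite !mxE !idxE.
Qed.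

Lemma psd_idl a m n (E : 'M[C]_m -> 'M[C]_n) (X : 'M[C]_(a * m)) :
  completely_positive E -> psdmx X -> psdmx (map_tens id E X).
Proof.
case=> lE pE pX; rewrite map_tens_idl_swap //.
by apply: psd_mxsub; apply: pE; apply: psd_mxsub.
Qed.

Lemma psd_A a n b c (E : 'M[C]_a -> 'M[C]_n) (X : 'M[C]_(a * b * c)) :
  completely_positive E -> psdmx X -> psdmx (map_tens (map_tens E id) id X).
Proof.
case=> lE pE pX; rewrite map_tens_idr_assoc //.
by apply: psd_mxsub; apply: pE; apply: psd_mxsub.
Qed.

Lemma psd_B a b n c (E : 'M[C]_b -> 'M[C]_n) (X : 'M[C]_(a * b * c)) :
  completely_positive E -> psdmx X -> psdmx (map_tens (map_tens id E) id X).
Proof.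
move=> cE pX; rewrite map_tens_idm_exch; last by case: cE.
by apply: psd_mxsub; apply: psd_A => //; apply: psd_mxsub.
Qed.

Lemma ptrace_r_idr a b n (E : 'M[C]_a -> 'M[C]_n) (X : 'M[C]_(a * b)) :
  linear E -> ptrace_r (map_tens E id X) = E (ptrace_r X).
Proof. by move=> lE; apply: ptrace_r_map_tens. Qed.

Lemma ptrace_l_idl a m n (E : 'M[C]_m -> 'M[C]_n) (X : 'M[C]_(a * m)) :
  linear E -> ptrace_l (map_tens id E X) = E (ptrace_l X).
Proof.
move=> lE; apply/matrixP => i j; rewrite mxE.
under eq_bigr do rewrite map_tens_idlE //.
rewrite -summxE -(lin_sum lE); congr (E _ i j).
by apply/matrixP => i' j'; rewrite summxE mxE; apply: eq_bigr => k _; rewrite mxE.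
Qed.

Lemma tr_ptrace_l m n (X : 'M[C]_(m * n)) : \tr (ptrace_l X) = \tr X.
Proof.
rewrite /mxtrace sum_mi exchange_big; apply: eq_bigr => i _ /=; by rewrite mxE.
Qed.

(** For a single outcome [E] need not preserve the trace. Reducing to the acting party's own state
    leaves a quantity whose sum over outcomes is governed by [instrument]. *)
Lemma tr_A a n b c (E : 'M[C]_a -> 'M[C]_n) (X : 'M[C]_(a * b * c)) : linear E ->
  \tr (map_tens (map_tens E id) id X) = \tr (E (ptrace_r (ptrace_r X))).
Proof.
move=> lE; rewrite -tr_ptrace_r ptrace_r_idr; last exact: map_tens_lin.
by rewrite -tr_ptrace_r ptrace_r_idr.
Qed.

Lemma tr_B a b n c (E : 'M[C]_b -> 'M[C]_n) (X : 'M[C]_(a * b * c)) : linear E ->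
  \tr (map_tens (map_tens id E) id X) = \tr (E (ptrace_l (ptrace_r X))).
Proof.
move=> lE; rewrite -tr_ptrace_r ptrace_r_idr; last exact: map_tens_lin.
by rewrite -tr_ptrace_l ptrace_l_idl.
Qed.

Lemma tr_C a m n (E : 'M[C]_m -> 'M[C]_n) (X : 'M[C]_(a * m)) : linear E ->
  \tr (map_tens id E X) = \tr (E (ptrace_l X)).
Proof. by move=> lE; rewrite -tr_ptrace_l ptrace_l_idl. Qed.

Section Trees.
Variables a' b' c' : nat.

Lemma locc_lin a b c (L : 'M[C]_(a * b * c) -> 'M[C]_(a' * b' * c')) :
  locc L -> linear L.
Proof.
elim=> {a b c L} [|a b c k n E L _ _ IH|a b c k n E L _ _ IH|a b c k n E L _ _ IH];
  first by [];
move=> t X Y; rewrite scaler_sumr -big_split; apply: eq_bigr => i _ /=;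
by rewrite map_tens_lin IH.
Qed.

Lemma locc_psd a b c (L : 'M[C]_(a * b * c) -> 'M[C]_(a' * b' * c')) :
  locc L -> forall X, psdmx X -> psdmx (L X).
Proof.
elim=> {a b c L} [|a b c k n E L [cE _] _ IH|a b c k n E L [cE _] _ IH
  |a b c k n E L [cE _] _ IH] // X pX; apply: psd_sum => i _; apply: IH.
- exact: psd_A.
- exact: psd_B.
- exact: psd_idl.
Qed.

Lemma locc_tr a b c (L : 'M[C]_(a * b * c) -> 'M[C]_(a' * b' * c')) :
  locc L -> forall X, \tr (L X) = \tr X.
Proof.
elim=> {a b c L} [|a b c k n E L [cE tE] _ IH|a b c k n E L [cE tE] _ IH
  |a b c k n E L [cE tE] _ IH] // X; rewrite raddf_sum /=.
- transitivity (\sum_(i < k) \tr (E i (ptrace_r (ptrace_r X)))).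
    by apply: eq_bigr => i _; rewrite IH tr_A //; case: (cE i).
  by rewrite tE !tr_ptrace_r.
- transitivity (\sum_(i < k) \tr (E i (ptrace_l (ptrace_r X)))).
    by apply: eq_bigr => i _; rewrite IH tr_B //; case: (cE i).
  by rewrite tE tr_ptrace_l tr_ptrace_r.
- transitivity (\sum_(i < k) \tr (E i (ptrace_l X))).
    by apply: eq_bigr => i _; rewrite IH tr_C //; case: (cE i).
  by rewrite tE tr_ptrace_l.
Qed.

End Trees.

End LoccMaps.

(** * Partial transposition *)

Section PartialTransposes.
Variable R : realType.
Local Notation C := R[i].

Definition pta a b c (X : 'M[C]_(a * b * c)) : 'M[C]_(a * b * c) :=
  \matrix_(x, y)
    let u := mxtens_unindex x in let v := mxtens_unindex y in
    let u1 := mxtens_unindex u.1 in let v1 := mxtens_unindex v.1 in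
    X (mi (mi v1.1 u1.2) u.2) (mi (mi u1.1 v1.2) v.2).

Definition ptb a b c (X : 'M[C]_(a * b * c)) : 'M[C]_(a * b * c) :=
  \matrix_(x, y)
    let u := mxtens_unindex x in let v := mxtens_unindex y in
    let u1 := mxtens_unindex u.1 in let v1 := mxtens_unindex v.1 in
    X (mi (mi u1.1 v1.2) u.2) (mi (mi v1.1 u1.2) v.2).

Lemma ptaE a b c (X : 'M[C]_(a * b * c)) i j k i' j' k' :
  pta X (mi (mi i j) k) (mi (mi i' j') k') =
  X (mi (mi i' j) k) (mi (mi i j') k').
Proof. by rewrite mxE; cbv zeta; rewrite !mxtens_indexK /= ?mxtens_indexK. Qed.

Lemma ptbE a b c (X : 'M[C]_(a * b * c)) i j k i' j' k' :
  ptb X (mi (mi i j) k) (mi (mi i' j') k') =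
  X (mi (mi i j') k) (mi (mi i' j) k').
Proof. by rewrite mxE; cbv zeta; rewrite !mxtens_indexK /= ?mxtens_indexK. Qed.

Lemma mxtens3P (T : Type) a b c (X Y : 'M[T]_(a * b * c)) :
  (forall i j k i' j' k', X (mi (mi i j) k) (mi (mi i' j') k') =
    Y (mi (mi i j) k) (mi (mi i' j') k')) -> X = Y.
Proof.
move=> XY; apply: mxtensP => x k y l.
by case: (mxtens_indexP x) => i j; case: (mxtens_indexP y) => i' j'.
Qed.

Lemma pta_lin a b c : linear (@pta a b c).
Proof. by move=> t X Y; apply: mxtens3P => *; rewrite !(ptaE, mxE). Qed.

Lemma ptb_lin a b c : linear (@ptb a b c).
Proof. by move=> t X Y; apply: mxtens3P => *; rewrite !(ptbE, mxE). Qed.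

Lemma ptaK a b c : involutive (@pta a b c).
Proof. by move=> X; apply: mxtens3P => *; rewrite !ptaE. Qed.

Lemma ptbK a b c : involutive (@ptb a b c).
Proof. by move=> X; apply: mxtens3P => *; rewrite !ptbE. Qed.

Definition trE m n (E : 'M[C]_m -> 'M[C]_n) X := (E X^T)^T.

Lemma trE_lin m n (E : 'M[C]_m -> 'M[C]_n) : linear E -> linear (trE E).
Proof. by move=> lE t X Y; rewrite /trE !linearP /= lE linearP. Qed.

(** Tensored with the identity, [trE E] is [E] tensored with the identity between two full
    transpositions, and full transposition preserves positivity. *)
Lemma trE_cp m n (E : 'M[C]_m -> 'M[C]_n) :
  completely_positive E -> completely_positive (trE E).
Proof.
case=> lE pE; split=> [|k X pX]; first exact: trE_lin.
have -> : map_tens (trE E) id X = (map_tens E (@id 'M[C]_k) X^T)^T.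
  apply: mxtensP => i u j v; rewrite map_tens_idrE; last exact: trE_lin.
  rewrite [RHS]mxE map_tens_idrE // mxE; congr (E _ _ _).
  by apply/matrixP => i' j'; rewrite !mxE.
by apply/psd_tr/pE/psd_tr.
Qed.

Lemma trE_instrument k m (n : 'I_k -> nat)
    (E : forall i : 'I_k, 'M[C]_m -> 'M[C]_(n i)) :
  instrument E -> instrument (fun i => trE (E i)).
Proof.
case=> cE tE; split=> [i|X]; first exact/trE_cp/cE.
by rewrite -mxtrace_tr -tE; apply: eq_bigr => i _; rewrite mxtrace_tr.
Qed.

Lemma map3AE a n b c (E : 'M[C]_a -> 'M[C]_n) (X : 'M[C]_(a * b * c)) i j k i' j' k' :
  linear E ->
  map_tens (map_tens E id) id X (mi (mi i j) k) (mi (mi i' j') k') =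
  E (\matrix_(x, y) X (mi (mi x j) k) (mi (mi y j') k')) i i'.
Proof.
move=> lE; rewrite map_tens_idrE; last exact: map_tens_lin.
rewrite map_tens_idrE //; congr (E _ _ _).
by apply/matrixP => x y; rewrite !mxE.
Qed.

Lemma map3BE a n b c (E : 'M[C]_b -> 'M[C]_n) (X : 'M[C]_(a * b * c)) i j k i' j' k' :
  linear E ->
  map_tens (map_tens id E) id X (mi (mi i j) k) (mi (mi i' j') k') =
  E (\matrix_(x, y) X (mi (mi i x) k) (mi (mi i' y) k')) j j'.
Proof.
move=> lE; rewrite map_tens_idrE; last exact: map_tens_lin.
rewrite map_tens_idlE //; congr (E _ _ _).
by apply/matrixP => x y; rewrite !mxE.
Qed.

(** Transposition on A commutes with the rounds of B and C and turns Alice's [E] into [trE E], so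
    the same tree with Alice's instruments transposed implements the map. *)
Lemma locc_pta a' b' c' a b c (L : 'M[C]_(a * b * c) -> 'M[C]_(a' * b' * c')) :
  locc L -> locc (fun X => pta (L (pta X))).
Proof.
elim=> {a b c L} [|a b c k n E L iE _ IH|a b c k n E L iE _ IH
  |a b c k n E L iE _ IH].
- rewrite [X in locc X](_ : _ = id); first exact: locc_stop.
  by apply/funext => X; rewrite ptaK.
- rewrite [X in locc X](_ : _ = fun X => \sum_(i < k) pta (L i (pta
    (map_tens (map_tens (trE (E i)) (@id 'M[C]_b)) (@id 'M[C]_c) X)))); last first.
    apply/funext => X; rewrite (lin_sum (@pta_lin _ _ _)).
    apply: eq_bigr => i _; congr (pta (L i _)); apply: mxtens3P => *.
    have [cE _] := iE; have [lE _] := cE i.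
    rewrite ptaE !map3AE //; last exact: trE_lin.
    rewrite [RHS]mxE; congr (E i _ _ _).
    by apply/matrixP => x y; rewrite [LHS]mxE ptaE !mxE.
  by apply: (locc_A (L := fun i X => pta (L i (pta X)))); [exact: trE_instrument|].
- rewrite [X in locc X](_ : _ = fun X => \sum_(i < k) pta (L i (pta
    (map_tens (map_tens (@id 'M[C]_a) (E i)) (@id 'M[C]_c) X)))); last first.
    apply/funext => X; rewrite (lin_sum (@pta_lin _ _ _)).
    apply: eq_bigr => i _; congr (pta (L i _)); apply: mxtens3P => *.
    have [cE _] := iE; have [lE _] := cE i.
    rewrite ptaE !map3BE //; congr (E i _ _ _).
    by apply/matrixP => x y; rewrite [LHS]mxE ptaE !mxE.
  exact: (locc_B (L := fun i X => pta (L i (pta X)))).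
- rewrite [X in locc X](_ : _ = fun X => \sum_(i < k) pta (L i (pta
    (map_tens (@id 'M[C]_(a * b)) (E i) X)))); last first.
    apply/funext => X; rewrite (lin_sum (@pta_lin _ _ _)).
    apply: eq_bigr => i _; congr (pta (L i _)); apply: mxtens3P => *.
    have [cE _] := iE; have [lE _] := cE i.
    rewrite ptaE !map_tens_idlE //; congr (E i _ _ _).
    by apply/matrixP => x y; rewrite [LHS]mxE ptaE !mxE.
  exact: (locc_C (L := fun i X => pta (L i (pta X)))).
Qed.

Lemma locc_ptb a' b' c' a b c (L : 'M[C]_(a * b * c) -> 'M[C]_(a' * b' * c')) :
  locc L -> locc (fun X => ptb (L (ptb X))).
Proof.
elim=> {a b c L} [|a b c k n E L iE _ IH|a b c k n E L iE _ IH
  |a b c k n E L iE _ IH].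
- rewrite [X in locc X](_ : _ = id); first exact: locc_stop.
  by apply/funext => X; rewrite ptbK.
- rewrite [X in locc X](_ : _ = fun X => \sum_(i < k) ptb (L i (ptb
    (map_tens (map_tens (E i) (@id 'M[C]_b)) (@id 'M[C]_c) X)))); last first.
    apply/funext => X; rewrite (lin_sum (@ptb_lin _ _ _)).
    apply: eq_bigr => i _; congr (ptb (L i _)); apply: mxtens3P => *.
    have [cE _] := iE; have [lE _] := cE i.
    rewrite ptbE !map3AE //; congr (E i _ _ _).
    by apply/matrixP => x y; rewrite [LHS]mxE ptbE !mxE.
  exact: (locc_A (L := fun i X => ptb (L i (ptb X)))).
- rewrite [X in locc X](_ : _ = fun X => \sum_(i < k) ptb (L i (ptb
    (map_tens (map_tens (@id 'M[C]_a) (trE (E i))) (@id 'M[C]_c) X)))); last first.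
    apply/funext => X; rewrite (lin_sum (@ptb_lin _ _ _)).
    apply: eq_bigr => i _; congr (ptb (L i _)); apply: mxtens3P => *.
    have [cE _] := iE; have [lE _] := cE i.
    rewrite ptbE !map3BE //; last exact: trE_lin.
    rewrite [RHS]mxE; congr (E i _ _ _).
    by apply/matrixP => x y; rewrite [LHS]mxE ptbE !mxE.
  by apply: (locc_B (L := fun i X => ptb (L i (ptb X)))); [exact: trE_instrument|].
- rewrite [X in locc X](_ : _ = fun X => \sum_(i < k) ptb (L i (ptb
    (map_tens (@id 'M[C]_(a * b)) (E i) X)))); last first.
    apply/funext => X; rewrite (lin_sum (@ptb_lin _ _ _)).
    apply: eq_bigr => i _; congr (ptb (L i _)); apply: mxtens3P => *.
    have [cE _] := iE; have [lE _] := cE i.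
    rewrite ptbE !map_tens_idlE //; congr (E i _ _ _).
    by apply/matrixP => x y; rewrite [LHS]mxE ptbE !mxE.
  exact: (locc_C (L := fun i X => ptb (L i (ptb X)))).
Qed.

End PartialTransposes.

(** * Tight majorants *)

(* G is a signed permutation matrix up to scale, so \sum_i `|s i| is its trace
   norm: H is minimal among the majorants of G and - G, hence is `|G|. *)
Lemma tight_majorant (C : numClosedFieldType) n (pi : 'I_n -> 'I_n)
    (s : 'I_n -> C) (H G : 'M[C]_n) :
  involutive pi -> (forall i, s i \is Num.real) -> (forall i, s (pi i) = s i) ->
  (forall i j, G i j = (j == pi i)%:R * s i) ->
  (forall v : 'cV_n, 0 <= (v^t* *m (H - G) *m v) 0 0) ->
  (forall v : 'cV_n, 0 <= (v^t* *m (H + G) *m v) 0 0) ->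
  \tr H = \sum_i `|s i| ->
  H = diag_mx (\row_i `|s i|).
Proof.
move=> piK sr spi GE pm pp trH.
pose e (i : 'I_n) : C := if 0 <= s i then 1 else -1.
have er i : Num.conj (e i) = e i.
  by rewrite /e; case: ifP => _; rewrite ?rmorphN /= conjC1.
have e2 i : e i * e i = 1 by rewrite /e; case: ifP; rewrite ?mulrNN mulr1.
have es i : e i * s i = `|s i|.
  rewrite /e; case: ifPn => [/ger0_norm->|]; first by rewrite mul1r.
  by rewrite -real_ltNge // => /ltr0_norm->; rewrite mulN1r.
pose d i : 'cV[C]_n := delta_mx i 0.
(* G maps [w i] to [|s i|] times itself and [w' i] to [- |s i|] times itself, so these vectors test
   H - G and H + G where G costs most. *)
pose w i := d i + e i *: d (pi i).
pose w' i := d i + - e i *: d (pi i).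
pose q i := ((w i)^t* *m (H - G) *m w i) 0 0.
pose q' i := ((w' i)^t* *m (H + G) *m w' i) 0 0.
have quadE (M : 'M[C]_n) a i : Num.conj a = a -> a * a = 1 ->
    ((d i + a *: d (pi i))^t* *m M *m (d i + a *: d (pi i))) 0 0 =
    M i i + a * M i (pi i) + a * M (pi i) i + M (pi i) (pi i).
  by move=> ar a2; rewrite quadD !quad_delta ar a2 mul1r.
have qE i : q i + q' i = 2 * (H i i + H (pi i) (pi i)) - 4 * `|s i|.
  have Gij : G i (pi i) = s i by rewrite GE eqxx mul1r.
  have Gji : G (pi i) i = s i by rewrite GE piK eqxx mul1r spi.
  have er' : Num.conj (- e i) = - e i by rewrite rmorphN /= er.
  have e2' : - e i * - e i = 1 by rewrite mulrNN.
  rewrite /q /q' (quadE _ _ _ (er i) (e2 i)) (quadE _ _ _ er' e2') -es.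
  by rewrite !mxE Gij Gji; ring.
(* The total of these nonnegative values is 4 tr H - 4 sum |s i| = 0. Hence each of them vanishes,
   and [psd_ker] applies. *)
have sq : \sum_i (q i + q' i) = 0.
  under eq_bigr do rewrite qE.
  rewrite sumrB -!mulr_sumr -trH big_split /=.
  have -> : \sum_i H (pi i) (pi i) = \tr H.
    by rewrite /mxtrace [RHS](reindex_inj (inv_inj piK)).
  by rewrite -/(\tr H); ring.
have q0 i : q i = 0 /\ q' i = 0.
  have /psumr_eq0P : forall i, true -> 0 <= q i + q' i.
    by move=> j _; rewrite addr_ge0 //; [exact: pm|exact: pp].
  move=> /(_ sq i isT) /eqP; rewrite paddr_eq0; [|exact: pm|exact: pp].
  by case/andP => /eqP-> /eqP->.
apply/matrixP => k i; have [qi qi'] := q0 i.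
have := congr1 (fun u : 'cV_n => u k 0) (psd_ker pm qi).
have := congr1 (fun u : 'cV_n => u k 0) (psd_ker pp qi').
have colE (M : 'M[C]_n) (a : C) : (M *m (d i + a *: d (pi i))) k 0 =
    M k i + a * M k (pi i).
  by rewrite mulmxDr -scalemxAr /d -!colE !mxE.
have z : (0 : 'cV[C]_n) k 0 = 0 by rewrite mxE.
rewrite /w /w' !colE z => h1 h2.
(* Adding the two kernel equations cancels [G k i] and [H k (pi i)]. *)
have Hki : H k i = e i * G k (pi i).
  have two : (2 : C) != 0 by rewrite pnatr_eq0.
  apply: (mulfI two); apply/eqP; rewrite -subr_eq0; apply/eqP.
  transitivity (0 + 0 : C); last by rewrite addr0.
  by rewrite -[X in _ = X + _]h1 -[X in _ = _ + X]h2 !mxE; ring.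
rewrite Hki GE (inj_eq (inv_inj piK)) !mxE eq_sym.
by have [->|_] := eqVneq k i; rewrite ?mul1r ?es ?mulr1n // mul0r mulr0.
Qed.

(** * Two-qubit operators on A C1 and B C2 *)

Section Explicit.
Variable R : realType.
Local Notation C := R[i].
Local Notation q := 'I_2.

Definition M3 (f : q -> q -> q -> q -> q -> q -> C) : 'M[C]_(2 * 2 * 2) :=
  \matrix_(x, y)
    let u := mxtens_unindex x in let v := mxtens_unindex y in
    let u1 := mxtens_unindex u.1 in let v1 := mxtens_unindex v.1 in
    f u1.1 u1.2 u.2 v1.1 v1.2 v.2.

Lemma M3E f a b c a' b' c' :
  M3 f (mi (mi a b) c) (mi (mi a' b') c') = f a b c a' b' c'.
Proof. by rewrite mxE; cbv zeta; rewrite !mxtens_indexK /= ?mxtens_indexK. Qed.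

(** Exchanges the two middle qubits: the order A B C1 C2 becomes A C1 B C2, in which the EPR
    partners are adjacent. *)
Definition ro_index (x : 'I_(2 * 2 * (2 * 2))) : 'I_(2 * 2 * (2 * 2)) :=
  let u := mxtens_unindex x in
  let u1 := mxtens_unindex u.1 in let u2 := mxtens_unindex u.2 in
  mi (mi u1.1 u2.1) (mi u1.2 u2.2).

Lemma ro_indexE a b c d :
  ro_index (mi (mi a b) (mi c d)) = mi (mi a c) (mi b d).
Proof. by rewrite /ro_index !mxtens_indexK /= ?mxtens_indexK. Qed.

Lemma ro_indexK : involutive ro_index.
Proof.
move=> x; case: (mxtens_indexP x) => u v.
by case: (mxtens_indexP u) => a b; case: (mxtens_indexP v) => c d; rewrite !ro_indexE.
Qed.

(* A acts on A C1 and B on B C2. *)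
Definition ro (A B : 'M[C]_(2 * 2)) : 'M[C]_(2 * 2 * (2 * 2)) :=
  mxsub ro_index ro_index (A *t B).

Lemma roE A B a b c d a' b' c' d' :
  ro A B (mi (mi a b) (mi c d)) (mi (mi a' b') (mi c' d')) =
  A (mi a c) (mi a' c') * B (mi b d) (mi b' d').
Proof. by rewrite mxE !ro_indexE tensmxE. Qed.

Lemma mxtens4P (X Y : 'M[C]_(2 * 2 * (2 * 2))) :
  (forall a b c d a' b' c' d',
    X (mi (mi a b) (mi c d)) (mi (mi a' b') (mi c' d')) =
    Y (mi (mi a b) (mi c d)) (mi (mi a' b') (mi c' d'))) -> X = Y.
Proof.
move=> XY; apply: mxtensP => x u y v.
case: (mxtens_indexP x) => ? ?; case: (mxtens_indexP y) => ? ?.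
by case: (mxtens_indexP u) => ? ?; case: (mxtens_indexP v) => ? ?.
Qed.

Lemma mxsub_bij_mul m n (f : 'I_m -> 'I_n) (X Y : 'M[C]_n) : bijective f ->
  mxsub f f (X *m Y) = mxsub f f X *m mxsub f f Y.
Proof.
move=> bf; apply/matrixP => i j; rewrite !mxE (reindex f) /=; last first.
  exact: onW_bij.
by apply: eq_bigr => k _; rewrite !mxE.
Qed.

Lemma ro_mul A B A' B' : ro A B *m ro A' B' = ro (A *m A') (B *m B').
Proof.
rewrite /ro -tensmx_mul mxsub_bij_mul //.
by exists ro_index; exact: ro_indexK.
Qed.

Lemma ro1 : ro 1%:M 1%:M = 1%:M.
Proof.
by apply: mxtens4P => *; rewrite roE !mxE !mi_eq -natrM mulnb andbACA.
Qed.

Lemma roDl A A' B : ro (A + A') B = ro A B + ro A' B.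
Proof. by apply: mxtens4P => *; rewrite [RHS]mxE !roE mxE mulrDl. Qed.

Lemma roDr A B B' : ro A (B + B') = ro A B + ro A B'.
Proof. by apply: mxtens4P => *; rewrite [RHS]mxE !roE mxE mulrDr. Qed.

Lemma roZl t A B : ro (t *: A) B = t *: ro A B.
Proof. by apply: mxtens4P => *; rewrite [RHS]mxE !roE mxE mulrA. Qed.

Lemma roZr t A B : ro A (t *: B) = t *: ro A B.
Proof. by apply: mxtens4P => *; rewrite [RHS]mxE !roE mxE mulrCA. Qed.

Lemma roNl A B : ro (- A) B = - ro A B.
Proof. by rewrite -[- A]scaleN1r roZl scaleN1r. Qed.

Lemma roNr A B : ro A (- B) = - ro A B.
Proof. by rewrite -[- B]scaleN1r roZr scaleN1r. Qed.

Lemma ro_ct A B : (ro A B)^t* = ro (A^t*) (B^t*).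
Proof.
by apply: mxtens4P => *; rewrite mxE mxE !roE rmorphM /= !mxE.
Qed.

Lemma psd_ro m n (V : 'M[C]_(2 * 2, m)) (W : 'M[C]_(2 * 2, n)) :
  psdmx (ro (V *m V^t*) (W *m W^t*)).
Proof.
apply: psd_mxsub; rewrite -tensmx_mul.
have -> : V^t* *t W^t* = (V *t W)^t* by rewrite trmx_tens map_mxT.
exact: psd_gram.
Qed.

Definition epr : 'cV[C]_(2 * 2) := \col_x
  let u := mxtens_unindex x in (u.1 == u.2)%:R.

Lemma eprE a b k : epr (mi a b) k = (a == b)%:R.
Proof. by rewrite mxE !mxtens_indexK. Qed.

Definition P : 'M[C]_(2 * 2) := 2^-1 *: (epr *m epr^t*).

Lemma PE a b a' b' : P (mi a b) (mi a' b') = 2^-1 * ((a == b)%:R * (a' == b')%:R).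
Proof. by rewrite mxE mxE big_ord1 !mxE !mxtens_indexK conjC_nat. Qed.

Definition F : 'M[C]_(2 * 2) := mxsub id (@swapi 2 2) 1%:M.

Lemma FE a b a' b' : F (mi a b) (mi a' b') = (a == b')%:R * (b == a')%:R.
Proof. by rewrite !mxE swapiE mi_eq -natrM mulnb. Qed.

Lemma F_ct : F^t* = F.
Proof.
apply: mxtensP => a b a' b'; rewrite mxE mxE !FE rmorphM /= !conjC_nat mulrC.
by rewrite [b' == a]eq_sym [a' == b]eq_sym.
Qed.

Lemma FF : F *m F = 1%:M.
Proof.
apply: mxtensP => a b a' b'; rewrite mxE sum_mi (bigD1 b) //= (bigD1 a) //=.
rewrite [X in _ + X + _]big1 => [|p ap]; last first.
  by rewrite FE [a == p]eq_sym (negbTE ap) !mul0r.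
rewrite [X in _ + X]big1 => [|p bp]; last first.
  by rewrite big1 // => r _; rewrite FE [b == p]eq_sym (negbTE bp) mulr0 mul0r.
by rewrite !addr0 !FE !eqxx !mul1r mxE mi_eq -natrM mulnb andbC.
Qed.

(** For s = 1 and s = -1 the operator 1 + s F is twice a projection; written as half a Gram matrix
    it fits [psd_ro]. *)
Lemma gramF s : s * s = 1 -> Num.conj s = s ->
  (1%:M + s *: F) *m (1%:M + s *: F)^t* = 2 *: (1%:M + s *: F).
Proof.
move=> s2 sr; have -> : (1%:M + s *: F)^t* = 1%:M + s *: F.
  by rewrite linearD linearZ /= map_mxD map_mxZ F_ct trmx1 map_mx1 /= sr.
rewrite mulmxDl mul1mx -scalemxAl mulmxDr mulmx1 -scalemxAr FF scalerDr scalerA.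
by rewrite s2 scale1r [s *: F + _]addrC -mulr2n scaler_nat.
Qed.

End Explicit.

(** * Partial transposes of product operators, three-qubit matrices and the two states *)

Section BoxValues.
Variable R : realType.
Local Notation C := R[i].
Local Notation q := 'I_2.
Local Notation P := (P R).
Local Notation F := (F R).
Local Notation I4 := (1%:M : 'M[C]_(2 * 2)).

Lemma pta_roP (B : 'M[C]_(2 * 2)) : pta (ro P B) = 2^-1 *: ro F B.
Proof.
apply: mxtens4P => a b c d a' b' c' d'.
rewrite ptaE [RHS]mxE !roE PE FE [c == a']eq_sym; ring.
Qed.

Lemma pta_ro1 (B : 'M[C]_(2 * 2)) : pta (ro 1%:M B) = ro 1%:M B.
Proof.
apply: mxtens4P => a b c d a' b' c' d'.
by rewrite ptaE !roE !mxE !mi_eq [a' == a]eq_sym.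
Qed.

Lemma ptb_roP (A : 'M[C]_(2 * 2)) : ptb (ro A P) = 2^-1 *: ro A F.
Proof.
apply: mxtens4P => a b c d a' b' c' d'.
rewrite ptbE [RHS]mxE !roE PE FE [d == b']eq_sym; ring.
Qed.

Lemma ptb_ro1 (A : 'M[C]_(2 * 2)) : ptb (ro A 1%:M) = ro A 1%:M.
Proof.
apply: mxtens4P => a b c d a' b' c' d'.
by rewrite ptbE !roE !mxE !mi_eq [b' == b]eq_sym.
Qed.

Lemma tr_ro (A B : 'M[C]_(2 * 2)) : \tr (ro A B) = \tr A * \tr B.
Proof.
have trE2 (A' : 'M[C]_(2 * 2)) : \tr A' = \sum_a \sum_c A' (mi a c) (mi a c).
  by rewrite /mxtrace sum_mi.
transitivity (\sum_a \sum_b \sum_c \sum_d A (mi a c) (mi a c) * B (mi b d) (mi b d)).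
  rewrite /mxtrace sum_mi sum_mi; apply: eq_bigr => a _; apply: eq_bigr => b _.
  by rewrite sum_mi; apply: eq_bigr => c _; apply: eq_bigr => d _; rewrite roE.
rewrite !trE2 mulr_suml; apply: eq_bigr => a _; rewrite exchange_big mulr_suml.
apply: eq_bigr => c _; rewrite mulr_sumr; apply: eq_bigr => b _.
by rewrite mulr_sumr.
Qed.

Lemma sum_delta (V : pzRingType) n (a : 'I_n) (f : 'I_n -> V) :
  \sum_i (a == i)%:R * f i = f a.
Proof.
rewrite (bigD1 a) //= eqxx mul1r big1 ?addr0 // => i ai.
by rewrite eq_sym (negbTE ai) mul0r.
Qed.

Lemma sum_delta1 (V : pzRingType) n (a : 'I_n) : \sum_i (a == i)%:R = 1 :> V.
Proof. by rewrite -[RHS](sum_delta a (fun=> 1)); apply: eq_bigr => i _; rewrite mulr1. Qed.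

Lemma tr_P : \tr P = 1.
Proof.
rewrite /mxtrace sum_mi; under eq_bigr => a _ do
  (under eq_bigr do rewrite PE -natrM mulnb andbb; rewrite -mulr_sumr sum_delta1 mulr1).
rewrite big_ord_recl big_ord1. by rewrite [RHS]splitr !mul1r.
Qed.

(** Functions on the three-qubit basis are given on three separate bits, so that after [ind3] claims
    become finite case analyses. *)
Definition f3 T (f : q -> q -> q -> T) (x : 'I_(2 * 2 * 2)) : T :=
  let u := mxtens_unindex x in let u1 := mxtens_unindex u.1 in f u1.1 u1.2 u.2.

Lemma f3E T (f : q -> q -> q -> T) a b c : f3 f (mi (mi a b) c) = f a b c.
Proof. by rewrite /f3 !mxtens_indexK /= ?mxtens_indexK. Qed.

Lemma ind3 (Q : 'I_(2 * 2 * 2) -> Prop) :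
  (forall a b c, Q (mi (mi a b) c)) -> forall x, Q x.
Proof.
move=> Qabc x; case: (mxtens_indexP x) => u c.
by case: (mxtens_indexP u) => a b.
Qed.

Definition D3 (d : q -> q -> q -> C) : 'M[C]_(2 * 2 * 2) := diag_mx (\row_i f3 d i).

Lemma D3E d a b c a' b' c' : D3 d (mi (mi a b) c) (mi (mi a' b') c') =
  d a b c *+ [&& a == a', b == b' & c == c'].
Proof. by rewrite !mxE !mi_eq f3E andbA. Qed.

Lemma pta_D3 d : pta (D3 d) = D3 d.
Proof.
apply: mxtens3P => a b c a' b' c'; rewrite ptaE !D3E [a' == a]eq_sym.
by have [->|] := eqVneq a a'.
Qed.

Lemma ptb_D3 d : ptb (D3 d) = D3 d.
Proof.
apply: mxtens3P => a b c a' b' c'; rewrite ptbE !D3E [b' == b]eq_sym.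
by have [->|] := eqVneq b b'; rewrite ?andbF.
Qed.

Definition ghzmx : 'M[C]_(2 * 2 * 2) := M3 (fun a b c a' b' c' =>
  2^-1 * [&& a == b, b == c, a' == b' & b' == c']%:R).

Lemma sqrt2V2 : ((sqrtC 2)^-1 * Num.conj (sqrtC 2)^-1 : C) = 2^-1.
Proof.
have r : Num.conj ((sqrtC 2 : C)^-1) = (sqrtC 2)^-1.
  by apply/CrealP/ger0_real; rewrite invr_ge0 sqrtC_ge0 ler0n.
by rewrite r -invfM -expr2 sqrtCK.
Qed.

Lemma ketE n (i j : 'I_n) k : ket R i j k = (j == i)%:R.
Proof. by rewrite mxE [k]ord1 eqxx andbT. Qed.

Lemma pure_ghz : pure (ghz R) = ghzmx.
Proof.
have gE a b c k : ghz R (mi (mi a b) c) k = (sqrtC 2)^-1 * ((a == b) && (b == c))%:R.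
  have -> : k = mi (mi ord0 ord0) ord0 :> 'I_(1 * 1 * 1) by rewrite [k]ord1 [RHS]ord1.
  rewrite mxE summxE; congr (_ * _).
  rewrite (eq_bigr (fun j => (a == j)%:R * ((b == j)%:R * (c == j)%:R))); last first.
    by move=> j _; rewrite !tensmxE !ketE mulrA.
  by rewrite sum_delta -natrM mulnb [b == a]eq_sym [c == a]eq_sym; have [->|] := eqVneq a b.
apply: mxtens3P => a b c a' b' c'; rewrite M3E mxE big_ord1 gE mxE mxE.
rewrite gE rmorphM /= conjC_nat mulrACA sqrt2V2 -natrM mulnb; congr (_ * _%:R).
by rewrite -!andbA.
Qed.

Lemma pure_two_epr : pure (two_epr R) = ro P P.
Proof.
have gE a b c d k : two_epr R (mi (mi a b) (mi c d)) k =
    (sqrtC 2)^-1 * (sqrtC 2)^-1 * ((a == c)%:R * (b == d)%:R).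
  have -> : k = mi (mi ord0 ord0) (mi ord0 ord0) :> 'I_(1 * 1 * (1 * 1)).
    by rewrite [k]ord1 [RHS]ord1.
  rewrite mxE summxE; congr (_ * _).
  rewrite (eq_bigr (fun j => (a == j)%:R * ((c == j)%:R * (b == d)%:R))).
    by rewrite sum_delta [c == a]eq_sym.
  move=> j _; rewrite summxE.
  rewrite (eq_bigr (fun k => (b == k)%:R * ((a == j)%:R * ((c == j)%:R * (d == k)%:R)))).
    by rewrite sum_delta [d == b]eq_sym.
  by move=> i _; rewrite !tensmxE !ketE; ring.
apply: mxtens4P => a b c d a' b' c' d'; rewrite roE mxE big_ord1 gE mxE mxE.
rewrite gE !PE !rmorphM /= !conjC_nat -!sqrt2V2.
by ring.
Qed.

End BoxValues.

(** * The values of a box on the twirled inputs *)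

Section BoxDetermined.
Variable R : realType.
Local Notation C := R[i].
Local Notation q := 'I_2.
Local Notation P := (P R).
Local Notation F := (F R).
Local Notation one := (1%:M : 'M[C]_(2 * 2)).

Lemma V2_ge0 : 0 <= 2^-1 :> C. Proof. by rewrite invr_ge0 ler0n. Qed.

Lemma two_neq0 : (2 : C) != 0. Proof. by rewrite pnatr_eq0. Qed.

Lemma sgn_gram (s : C) : s * s = 1 -> Num.conj s = s ->
  one + s *: F = 2^-1 *: ((one + s *: F) *m (one + s *: F)^t*).
Proof. by move=> s2 sr; rewrite gramF // scalerA mulVf ?two_neq0 // scale1r. Qed.

Lemma psd_FF (s t : C) : s * s = 1 -> Num.conj s = s -> t * t = 1 ->
  Num.conj t = t -> psdmx (ro (one + s *: F) (one + t *: F)).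
Proof.
move=> s2 sr t2 tr; rewrite (sgn_gram s2 sr) (sgn_gram t2 tr) roZl roZr.
by do 2 apply: psdZ V2_ge0 _; exact: psd_ro.
Qed.

Lemma psd_FP (s : C) : s * s = 1 -> Num.conj s = s ->
  psdmx (ro (one + s *: F) P).
Proof.
move=> s2 sr; rewrite (sgn_gram s2 sr) /P roZl roZr.
by do 2 apply: psdZ V2_ge0 _; exact: psd_ro.
Qed.

Lemma psd_PF (s : C) : s * s = 1 -> Num.conj s = s ->
  psdmx (ro P (one + s *: F)).
Proof.
move=> s2 sr; rewrite (sgn_gram s2 sr) /P roZl roZr.
by do 2 apply: psdZ V2_ge0 _; exact: psd_ro.
Qed.

Lemma N1N1 : (-1) * (-1) = 1 :> C. Proof. by rewrite mulrNN mulr1. Qed.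
Lemma conjN1 : Num.conj (-1) = -1 :> C. Proof. by rewrite rmorphN /= conjC1. Qed.

Lemma sum3 (f : q -> q -> q -> C) :
  \sum_x f3 f x = \sum_a \sum_b \sum_c f a b c.
Proof.
rewrite sum_mi sum_mi; apply: eq_bigr => a _; apply: eq_bigr => b _.
by apply: eq_bigr => c _; rewrite f3E.
Qed.

Lemma tight3 (pi : q -> q -> q -> 'I_(2 * 2 * 2)) (s : q -> q -> q -> C)
    (H G : 'M[C]_(2 * 2 * 2)) :
  involutive (f3 pi) -> (forall a b c, s a b c \is Num.real) ->
  (forall a b c, f3 s (pi a b c) = s a b c) ->
  (forall a b c a' b' c', G (mi (mi a b) c) (mi (mi a' b') c') =
     (mi (mi a' b') c' == pi a b c)%:R * s a b c) ->
  psdmx (H - G) -> psdmx (H + G) ->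
  \tr H = \sum_a \sum_b \sum_c `|s a b c| ->
  H = D3 (fun a b c => `|s a b c|).
Proof.
move=> piK sr spi GE pm pp trH.
have -> : H = diag_mx (\row_i `|f3 s i|).
  refine (@tight_majorant R[i] _ (f3 pi) (f3 s) H G piK _ _ _ pm pp _).
  - by elim/ind3 => a b c; rewrite f3E.
  - by elim/ind3 => a b c; rewrite f3E spi f3E.
  - by elim/ind3 => a b c; elim/ind3 => a' b' c'; rewrite !f3E GE.
  rewrite trH -sum3; apply: eq_bigr => x _.
  by move: x; elim/ind3 => a b c; rewrite !f3E.
by rewrite /D3; congr diag_mx; apply/rowP; elim/ind3 => a b c; rewrite !mxE !f3E.
Qed.

Lemma D3Z t d : t *: D3 d = D3 (fun a b c => t * d a b c) :> 'M[C]_(2 * 2 * 2).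
Proof.
by apply: mxtens3P => a b c a' b' c'; rewrite mxE !D3E mulrnAr.
Qed.

Lemma sum2_const (t : C) : \sum_(a : q) t = 2 * t.
Proof. by rewrite sumr_const card_ord -[LHS]mulr_natl. Qed.

Lemma half_real (b : bool) : 2^-1 * b%:R \is @Num.real C.
Proof. by apply: ger0_real; rewrite mulr_ge0 ?V2_ge0 ?ler0n. Qed.

Lemma half_norm (b : bool) : `|2^-1 * b%:R| = 2^-1 * b%:R :> C.
Proof. by apply: ger0_norm; rewrite mulr_ge0 ?V2_ge0 ?ler0n. Qed.

Lemma tr_one : \tr one = 4.
Proof. by rewrite mxtrace1. Qed.

Variable L : qbox R.
Hypothesis locL : locc L.
Hypothesis LPP : L (ro P P) = ghzmx R.

Let linL : linear L := locc_lin locL.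

Lemma box_BC2 : L (ro one P) = D3 (fun a b c => (b == c)%:R).
Proof.
pose K X := pta (L (pta X)); have locK : locc K := locc_pta locL.
(* Since T (P (x) P) = F (x) P / 2, this matrix is T L T applied to half of (1 + s F) (x) P. *)
have KF s : s * s = 1 -> Num.conj s = s ->
    psdmx (K (2^-1 *: ro one P) + s *: pta (ghzmx R)).
  move=> s2 sr; rewrite -LPP -[ro P P](@ptaK R 2 2 (2 * 2)) pta_roP.
  rewrite -/(K _) -(linZ (locc_lin locK)) -(linD (locc_lin locK)).
  apply: (locc_psd locK); rewrite scalerA mulrC -scalerA -scalerDr -roZl -roDl.
  by apply: psdZ V2_ge0 _; exact: psd_FP.
(* The transpose of GHZ on A has entries 1/2 exactly at row (a, b, b), column (b, a, a). Its rows
   with b != c vanish, and [pi] fixes them. *)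
pose pi (a b c : q) := if b == c then mi (mi b a) a else mi (mi a b) c.
pose s (a b c : q) : C := 2^-1 * (b == c)%:R.
have H : K (2^-1 *: ro one P) = D3 (fun a b c => `|s a b c|).
  apply: (@tight3 pi s _ (pta (ghzmx R))).
  - elim/ind3 => a b c; rewrite f3E /pi; have [->|bc] := eqVneq b c.
      by rewrite f3E eqxx.
    by rewrite f3E (negbTE bc).
  - by move=> a b c; exact: half_real.
  - move=> a b c; rewrite /pi; have [->|bc] := eqVneq b c.
      by rewrite f3E /s !eqxx.
    by rewrite f3E.
  - move=> a b c a' b' c'; rewrite ptaE M3E /pi /s mulrCA -natrM mulnb.
    congr (_ * (nat_of_bool _)%:R); rewrite (fun_if (eq_op _)) !mi_eq.
    by case: a b c a' b' c' => -[|[|//]] ? [[|[|//]] ?] [[|[|//]] ?] [[|[|//]] ?]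
      [[|[|//]] ?] [[|[|//]] ?].
  - by have := KF (-1) N1N1 conjN1; rewrite scaleN1r.
  - by have := KF 1 (mulr1 _) (conjC1 _); rewrite scale1r.
  (* Both sides are 2: half of tr 1 * tr P = 4, and four entries 1/2. *)
  rewrite (locc_tr locK) linearZ /= tr_ro tr_P tr_one mulr1.
  under eq_bigr do under eq_bigr do
    (under eq_bigr do rewrite half_norm; rewrite -mulr_sumr sum_delta1).
  by rewrite !sum2_const; field.
have /(congr1 (fun X => 2 *: pta X)) := H.
rewrite /K ptaK (linZ (@pta_lin _ _ _ _)) (linZ linL) pta_ro1 scalerA.
rewrite mulfV ?two_neq0 // scale1r => ->; rewrite pta_D3 D3Z.
congr D3; apply/funext => a; apply/funext => b; apply/funext => c.
by rewrite half_norm mulrA mulfV ?two_neq0 // mul1r.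
Qed.

Lemma box_AC1 : L (ro P one) = D3 (fun a b c => (a == c)%:R).
Proof.
pose K X := ptb (L (ptb X)); have locK : locc K := locc_ptb locL.
have KF s : s * s = 1 -> Num.conj s = s ->
    psdmx (K (2^-1 *: ro P one) + s *: ptb (ghzmx R)).
  move=> s2 sr; rewrite -LPP -[ro P P](@ptbK R 2 2 (2 * 2)) ptb_roP.
  rewrite -/(K _) -(linZ (locc_lin locK)) -(linD (locc_lin locK)).
  apply: (locc_psd locK); rewrite scalerA mulrC -scalerA -scalerDr -roZr -roDr.
  by apply: psdZ V2_ge0 _; exact: psd_PF.
pose pi (a b c : q) := if a == c then mi (mi b a) b else mi (mi a b) c.
pose s (a b c : q) : C := 2^-1 * (a == c)%:R.
have H : K (2^-1 *: ro P one) = D3 (fun a b c => `|s a b c|).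
  apply: (@tight3 pi s _ (ptb (ghzmx R))).
  - elim/ind3 => a b c; rewrite f3E /pi; have [->|bc] := eqVneq a c.
      by rewrite f3E eqxx.
    by rewrite f3E (negbTE bc).
  - by move=> a b c; exact: half_real.
  - move=> a b c; rewrite /pi; have [->|bc] := eqVneq a c.
      by rewrite f3E /s !eqxx.
    by rewrite f3E.
  - move=> a b c a' b' c'; rewrite ptbE M3E /pi /s mulrCA -natrM mulnb.
    congr (_ * (nat_of_bool _)%:R); rewrite (fun_if (eq_op _)) !mi_eq.
    by case: a b c a' b' c' => -[|[|//]] ? [[|[|//]] ?] [[|[|//]] ?] [[|[|//]] ?]
      [[|[|//]] ?] [[|[|//]] ?].
  - by have := KF (-1) N1N1 conjN1; rewrite scaleN1r.
  - by have := KF 1 (mulr1 _) (conjC1 _); rewrite scale1r.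
  rewrite (locc_tr locK) linearZ /= tr_ro tr_P tr_one mul1r.
  rewrite exchange_big /=; under eq_bigr do under eq_bigr do
    (under eq_bigr do rewrite half_norm; rewrite -mulr_sumr sum_delta1).
  by rewrite !sum2_const; field.
have /(congr1 (fun X => 2 *: ptb X)) := H.
rewrite /K ptbK (linZ (@ptb_lin _ _ _ _)) (linZ linL) ptb_ro1 scalerA.
rewrite mulfV ?two_neq0 // scale1r => ->; rewrite ptb_D3 D3Z.
congr D3; apply/funext => a; apply/funext => b; apply/funext => c.
by rewrite half_norm mulrA mulfV ?two_neq0 // mul1r.
Qed.

End BoxDetermined.

(** * The value of a box on the identity, by joint transposition of A and B *)

Section BoxIdentity.
Variable R : realType.
Local Notation C := R[i].
Local Notation q := 'I_2.
Local Notation P := (P R).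
Local Notation F := (F R).
Local Notation one := (1%:M : 'M[C]_(2 * 2)).

Lemma pta_roF (B : 'M[C]_(2 * 2)) : pta (ro F B) = 2 *: ro P B.
Proof.
have := congr1 (@pta R 2 2 (2 * 2)) (pta_roP B).
rewrite ptaK (linZ (@pta_lin _ _ _ _)) => ->.
by rewrite scalerA mulfV ?two_neq0 // scale1r.
Qed.

Lemma ptb_roF (A : 'M[C]_(2 * 2)) : ptb (ro A F) = 2 *: ro A P.
Proof.
have := congr1 (@ptb R 2 2 (2 * 2)) (ptb_roP A).
rewrite ptbK (linZ (@ptb_lin _ _ _ _)) => ->.
by rewrite scalerA mulfV ?two_neq0 // scale1r.
Qed.

Lemma D3D d d' : D3 d + D3 d' = D3 (fun a b c => d a b c + d' a b c)
  :> 'M[C]_(2 * 2 * 2).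
Proof.
by apply: mxtens3P => a b c a' b' c'; rewrite [LHS]mxE !D3E mulrnDl.
Qed.

Lemma sum2 (f : q -> C) : \sum_i f i = f ord0 + f ord_max.
Proof. by rewrite big_ord_recl big_ord1; congr (_ + f _); apply/val_inj. Qed.

Lemma tr_D3 (d : q -> q -> q -> C) : \tr (D3 d) = \sum_a \sum_b \sum_c d a b c.
Proof. by rewrite mxtrace_diag -sum3; apply: eq_bigr => i _; rewrite mxE. Qed.

Lemma subm_cancel n (k a b g : 'M[C]_n) : k - a - b - (g - a - b) = k - g.
Proof. by apply/matrixP => i j; rewrite !mxE; ring. Qed.

Lemma addm_cancel n (k a b g : 'M[C]_n) :
  k - a - b + (g - a - b) = k - 2 *: b + (- (2 *: a) + g).
Proof. by apply/matrixP => i j; rewrite !mxE; ring. Qed.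

Lemma subm_average n (o f e h : 'M[C]_n) :
  o - h = 2^-1 *: (o - f + (e - h) + (o + f + (- e - h))).
Proof. by apply/matrixP => i j; rewrite !mxE; field. Qed.

Lemma subm_lin_mxE n (X Y Z : 'M[C]_n) t i j :
  (t *: X - Y - Z) i j = t * X i j - Y i j - Z i j.
Proof. by rewrite !mxE. Qed.

Variable L : qbox R.
Hypothesis locL : locc L.
Hypothesis LPP : L (ro P P) = ghzmx R.

(** The factors 1 + s F and 1 + t F with opposite signs give K 1 >= K (F (x) F); with both signs
    negative they give K 1 + K (F (x) F) >= 2 dA + 2 dB. Subtracting dA + dB on both sides turns
    these into U >= G and U >= - G. *)
Lemma box_id : L 1%:M = D3 (fun _ _ _ => 2).
Proof.
have linL := locc_lin locL.
pose dA := D3 (fun a b c : q => (a == c)%:R : C).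
pose dB := D3 (fun a b c : q => (b == c)%:R : C).
pose K X := pta (ptb (L (ptb (pta X)))).
have locK : locc K by exact: locc_pta (locc_ptb locL).
have linK := locc_lin locK.
have KF1 : K (ro F one) = 2 *: dA.
  rewrite /K pta_roF (linZ (@ptb_lin _ _ _ _)) ptb_ro1 (linZ linL) (box_AC1 locL LPP).
  by rewrite (linZ (@ptb_lin _ _ _ _)) (linZ (@pta_lin _ _ _ _)) ptb_D3 pta_D3.
have K1F : K (ro one F) = 2 *: dB.
  rewrite /K pta_ro1 ptb_roF (linZ linL) (box_BC2 locL LPP).
  by rewrite (linZ (@ptb_lin _ _ _ _)) (linZ (@pta_lin _ _ _ _)) ptb_D3 pta_D3.
have KFF : K (ro F F) = 4 *: pta (ptb (ghzmx R)).
  rewrite /K pta_roF (linZ (@ptb_lin _ _ _ _)) ptb_roF !(linZ linL) LPP.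
  rewrite !(linZ (@ptb_lin _ _ _ _)) !(linZ (@pta_lin _ _ _ _)) scalerA.
  by rewrite -natrM.
pose U := K 1%:M - dA - dB; pose G := 4 *: pta (ptb (ghzmx R)) - dA - dB.
have UG : psdmx (U - G).
  have -> : U - G = K (2^-1 *: (ro (one + 1 *: F) (one + -1 *: F) +
                                ro (one + -1 *: F) (one + 1 *: F))).
    have -> : U - G = K 1%:M - K (ro F F).
      by rewrite KFF /U /G subm_cancel.
    rewrite -(linB linK); congr K.
    rewrite scale1r scaleN1r !roDl !roDr !roNl !roNr ro1.
    exact: subm_average.
  apply/(locc_psd locK)/psdZ/psdD; first exact: V2_ge0.
    by apply: psd_FF; rewrite ?mulr1 ?conjC1 ?N1N1 ?conjN1.
  by apply: psd_FF; rewrite ?mulr1 ?conjC1 ?N1N1 ?conjN1.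
have UG' : psdmx (U + G).
  have -> : U + G = K (ro (one + -1 *: F) (one + -1 *: F)).
    rewrite scaleN1r !roDl !roDr !roNl !roNr ro1 opprK !(linD linK) !(linN linK).
    rewrite KFF KF1 K1F /U /G.
    exact: addm_cancel.
  by apply/(locc_psd locK)/psd_FF; rewrite ?N1N1 ?conjN1.
(* Row (a, a, c) of 4 T (GHZ) has its entry 2 in column (c, c, a). For a = b = c it is cancelled by
   dA + dB; for a != b exactly one of a = c and b = c holds, which leaves -1 on the diagonal. *)
pose pi (a b c : q) := if a == b then mi (mi c c) a else mi (mi a b) c.
pose s (a b c : q) : C := if a == b then 2 * (a != c)%:R else -1.
have snorm a b c : `|s a b c| = if a == b then 2 * (a != c)%:R else 1.
  by rewrite /s; case: ifP => _; rewrite ?normrN1 // ger0_norm // mulr_ge0 ?ler0n.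
have HU : U = D3 (fun a b c => `|s a b c|).
  refine (@tight3 R pi s _ G _ _ _ _ UG UG' _).
  - elim/ind3 => a b c; rewrite f3E /pi; have [->|bc] := eqVneq a b.
      by rewrite f3E eqxx.
    by rewrite f3E (negbTE bc).
  - by move=> a b c; rewrite /s; case: ifP => _;
      [apply: ger0_real; rewrite mulr_ge0 ?ler0n|rewrite rpredN real1].
  - move=> a b c; rewrite /pi /s; have [->|bc] := eqVneq a b.
      by rewrite f3E eqxx eq_sym.
    by rewrite f3E (negbTE bc).
  - move=> a b c a' b' c'.
    rewrite /G subm_lin_mxE ptaE ptbE M3E !D3E /pi /s.
    rewrite (fun_if (eq_op _)) !mi_eq.
    by case: a b c a' b' c' => -[|[|//]] ? [[|[|//]] ?] [[|[|//]] ?] [[|[|//]] ?]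
      [[|[|//]] ?] [[|[|//]] ?]; rewrite /=; field.
  (* The trace is 16 - 4 - 4 = 8, and so is the sum of |s|: two entries 2 and four entries 1. *)
  rewrite /U !linearB /= (locc_tr locK) mxtrace1 !tr_D3.
  under [RHS]eq_bigr do under eq_bigr do under eq_bigr do rewrite snorm.
  by rewrite !sum2 /=; ring.
have K1 : K 1%:M = D3 (fun _ _ _ => 2).
  have -> : K 1%:M = U + dB + dA by rewrite /U !subrK.
  rewrite HU !D3D; congr D3; apply/funext => a; apply/funext => b; apply/funext => c.
  rewrite snorm; case: a b c => -[|[|//]] ? [[|[|//]] ?] [[|[|//]] ?];
    rewrite /=; ring.
have := congr1 (fun X => ptb (pta X)) K1.
rewrite /K ptaK ptbK -ro1 pta_ro1 ptb_ro1 => ->.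
by rewrite pta_D3 ptb_D3.
Qed.

End BoxIdentity.

(** * A finite twirl *)

Section FiniteTwirl.
Variable R : realType.
Local Notation C := R[i].
Local Notation q := 'I_2.
Local Notation P := (P R).
Local Notation one := (1%:M : 'M[C]_(2 * 2)).

Lemma conj_by_lin n (W : 'M[C]_n) : linear (conj_by W).
Proof. by move=> a X Y; rewrite /conj_by mulmxDr mulmxDl -scalemxAr -scalemxAl. Qed.

Lemma conj_byE n (W X : 'M[C]_n) i j : conj_by W X i j =
  \sum_x \sum_y W i x * X x y * Num.conj (W j y).
Proof.
rewrite mxE exchange_big; apply: eq_bigr => y _ /=; rewrite mxE mulr_suml.
by apply: eq_bigr => x _; rewrite !mxE.
Qed.

Lemma oneE n (i j : 'I_n) : (1%:M : 'M[C]_n) i j = (i == j)%:R.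
Proof. by rewrite mxE. Qed.

Lemma conj_by_id n (X : 'M[C]_n) : conj_by 1%:M X = X.
Proof. by rewrite /conj_by mul1mx trmx1 map_mx1 mulmx1. Qed.

Lemma conj_byM n (V W X : 'M[C]_n) : conj_by V (conj_by W X) = conj_by (V *m W) X.
Proof. by rewrite /conj_by ctmx_mul !mulmxA. Qed.

Lemma map_tens_conj_l m n (V : 'M[C]_m) (X : 'M[C]_(m * n)) :
  map_tens (conj_by V) id X = conj_by (V *t 1%:M) X.
Proof.
apply: mxtensP => i k j l; rewrite map_tens_idrE; last exact: conj_by_lin.
rewrite !conj_byE sum_mi; apply: eq_bigr => x _.
rewrite (bigD1 k) //= [X in _ = _ + X]big1 => [|y yk]; last first.
  by rewrite big1 // => z _; rewrite tensmxE mxE eq_sym (negbTE yk) mulr0 !mul0r.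
rewrite addr0 sum_mi; apply: eq_bigr => y _.
rewrite (bigD1 l) //= [X in _ = _ + X]big1 => [|z zl]; last first.
  by rewrite [X in Num.conj X]tensmxE oneE eq_sym (negbTE zl) mulr0 conjC0 mulr0.
by rewrite addr0 !tensmxE !mxE !eqxx !mulr1.
Qed.

Lemma map_tens_conj_r m n (W : 'M[C]_n) (X : 'M[C]_(m * n)) :
  map_tens id (conj_by W) X = conj_by (1%:M *t W) X.
Proof.
apply: mxtensP => i k j l; rewrite map_tens_idlE; last exact: conj_by_lin.
rewrite !conj_byE sum_mi (bigD1 i) //= [X in _ = _ + X]big1 => [|x xi]; last first.
  rewrite big1 // => y _; rewrite big1 // => z _.
  by rewrite tensmxE oneE eq_sym (negbTE xi) !mul0r.
rewrite addr0; apply: eq_bigr => x _.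
rewrite sum_mi (bigD1 j) //= [X in _ = _ + X]big1 => [|y yj]; last first.
  rewrite big1 // => z _.
  by rewrite [X in Num.conj X]tensmxE oneE eq_sym (negbTE yj) mul0r conjC0 mulr0.
by rewrite addr0; apply: eq_bigr => y _; rewrite !tensmxE !mxE !eqxx !mul1r.
Qed.

Definition ro_mx (X : 'M[C]_(2 * 2 * (2 * 2))) := mxsub ro_index ro_index X.

Lemma ro_mxK : involutive ro_mx.
Proof. by move=> X; apply/matrixP => i j; rewrite !mxE !ro_indexK. Qed.

Lemma ro_mx_lin : linear ro_mx.
Proof. by move=> a X Y; apply/matrixP => i j; rewrite !mxE. Qed.

Definition liftA (f : 'M[C]_(2 * 2) -> 'M[C]_(2 * 2)) X :=
  ro_mx (map_tens f id (ro_mx X)).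
Definition liftB (f : 'M[C]_(2 * 2) -> 'M[C]_(2 * 2)) X :=
  ro_mx (map_tens id f (ro_mx X)).

Lemma ro_mx_mul X Y : ro_mx (X *m Y) = ro_mx X *m ro_mx Y.
Proof. by apply: mxsub_bij_mul; exists ro_index; exact: ro_indexK. Qed.

Lemma ro_mx_conj W X : ro_mx (conj_by W X) = conj_by (ro_mx W) (ro_mx X).
Proof.
rewrite /conj_by !ro_mx_mul; congr (_ *m _ *m _).
by apply/matrixP => i j; rewrite !mxE.
Qed.

Lemma liftA_conj V X : liftA (conj_by V) X = conj_by (ro V 1%:M) X.
Proof. by rewrite /liftA map_tens_conj_l ro_mx_conj ro_mxK. Qed.

Lemma liftB_conj V X : liftB (conj_by V) X = conj_by (ro 1%:M V) X.
Proof. by rewrite /liftB map_tens_conj_r ro_mx_conj ro_mxK. Qed.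

Definition uub (U : 'M[C]_2) : 'M[C]_(2 * 2) := U *t map_mx Num.conj U.

Lemma WAE (U : 'M[C]_2) :
  U *t 1%:M *t (map_mx Num.conj U *t 1%:M) = ro (uub U) 1%:M.
Proof.
apply: mxtens4P => a b c d a' b' c' d'; rewrite roE !tensmxE !mxE mi_eq.
by rewrite -mulnb natrM mulrACA.
Qed.

Lemma WBE (U : 'M[C]_2) :
  1%:M *t U *t (1%:M *t map_mx Num.conj U) = ro 1%:M (uub U).
Proof.
apply: mxtens4P => a b c d a' b' c' d'; rewrite roE !tensmxE !mxE mi_eq.
by rewrite -mulnb natrM mulrACA.
Qed.

Definition avg (us : seq 'M[C]_2) (y : 'M[C]_(2 * 2)) :=
  (size us)%:R^-1 *: \sum_(U <- us) conj_by (uub U) y.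

Lemma avg_lin us : linear (avg us).
Proof.
move=> a X Y; rewrite /avg scalerA mulrC -scalerA -scalerDr; congr (_ *: _).
by rewrite scaler_sumr -big_split; apply: eq_bigr => U _ /=; rewrite conj_by_lin.
Qed.

(** Closed form of the twirl of one pair: the weights on P and on 1 - P are kept and spread evenly,
    3 being the rank of 1 - P. *)
Definition kf (y : 'M[C]_(2 * 2)) : 'M[C]_(2 * 2) :=
  \tr (P *m y) *: P + (3^-1 * \tr ((one - P) *m y)) *: (one - P).

(** The entry at (a, c) of the left side is that of U times its adjoint. *)
Lemma uub_epr (U : 'M[C]_2) : U \is unitarymx -> uub U *m epr R = epr R.
Proof.
move=> /unitarymxP UU; apply/matrixP => i j; rewrite mxE sum_mi.
case: (mxtens_indexP i) => a c; rewrite eprE.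
under eq_bigr do (under eq_bigr do rewrite eprE mulrC; rewrite sum_delta tensmxE mxE).
by have /matrixP/(_ a c) := UU; rewrite !mxE => <-; apply: eq_bigr => k _; rewrite !mxE.
Qed.

Lemma uub_unitary (U : 'M[C]_2) : U \is unitarymx -> uub U \is unitarymx.
Proof.
move=> /unitarymxP UU; apply/unitarymxP; rewrite trmx_tens map_mxT tensmx_mul UU.
rewrite (_ : _ *m _ = map_mx Num.conj (U *m U^t*)); last first.
  rewrite map_mxM; congr (_ *m _); by apply/matrixP => i j; rewrite !mxE.
rewrite UU map_mx1; apply: mxtensP => i k j l.
by rewrite tensmxE !mxE mi_eq -natrM mulnb.
Qed.

Lemma conj_P (U : 'M[C]_2) : U \is unitarymx -> conj_by (uub U) P = P.
Proof.
move=> uU; rewrite /P (linZ (@conj_by_lin _ _)); congr (_ *: _).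
by rewrite /conj_by mulmxA -mulmxA -ctmx_mul uub_epr.
Qed.

Lemma conj_1 n (W : 'M[C]_n) : W \is unitarymx -> conj_by W 1%:M = 1%:M.
Proof. by move=> /unitarymxP WW; rewrite /conj_by mulmx1. Qed.

Definition Sx (z : C) : 'M[C]_2 := diag_mx (\row_i (if i == ord0 then 1 else z)).
Definition Xx : 'M[C]_2 := \matrix_(i, j) (i != j)%:R.
(** A matrix of trace and determinant 1, so its square is Fx - 1 and its cube -1. Conjugation by it
    has order three and cycles the Pauli axes Z, X, Y. *)
Definition Fx : 'M[C]_2 := \matrix_(i, j)
  (2^-1 * (if j == ord0 then 1 - 'i else if i == ord0 then - 1 - 'i else 1 + 'i)).

Lemma sum22 (V : nmodType) (f : 'I_(2 * 2) -> V) : \sum_x f x =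
  f (mi ord0 ord0) + f (mi ord0 ord_max) + (f (mi ord_max ord0) + f (mi ord_max ord_max)).
Proof.
have s2 (g : q -> V) : \sum_i g i = g ord0 + g ord_max.
  by rewrite big_ord_recl big_ord1; congr (_ + g _); apply/val_inj.
by rewrite sum_mi s2 !s2.
Qed.

Lemma Sx_unitary z : z * Num.conj z = 1 -> Sx z \is unitarymx.
Proof.
move=> z1; apply/unitarymxP/matrixP => i j; rewrite mxE sum2 !mxE.
by case: i j => -[|[|//]] ? [[|[|//]] ?];
  rewrite /= ?(mulr0n, mulr1n) ?conjC0 ?conjC1 ?(mulr0, mul0r, mulr1, addr0, add0r).
Qed.

Lemma Xx_unitary : Xx \is unitarymx.
Proof.
apply/unitarymxP/matrixP => i j; rewrite mxE sum2 !mxE !conjC_nat.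
by case: i j => -[|[|//]] ? [[|[|//]] ?]; rewrite /=; ring.
Qed.

Lemma conjFx i j : Num.conj (Fx i j) = 2^-1 *
  (if j == ord0 then 1 + 'i else if i == ord0 then - 1 + 'i else 1 - 'i).
Proof.
rewrite mxE rmorphM /= fmorphV /= conjC_nat; congr (_ * _).
by case: ifP => _; [|case: ifP => _];
  rewrite !(rmorphD, rmorphB, rmorphN, rmorph1) /= conjCi ?opprK.
Qed.

End FiniteTwirl.

(** * The three finite averages: diagonal phases, bit flip, rotation of the Pauli axes *)

Section FiniteTwirlFormula.
Variable R : realType.
Local Notation C := R[i].
Local Notation q := 'I_2.
Local Notation P := (P R).
Local Notation one := (1%:M : 'M[C]_(2 * 2)).
Local Notation Fx := (Fx R).
Local Notation Xx := (Xx R).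

Lemma Fx_unitary : Fx \is unitarymx.
Proof.
have e i j : (Fx *m Fx^t*) i j = Fx i ord0 * Num.conj (Fx j ord0) +
    Fx i ord_max * Num.conj (Fx j ord_max) by rewrite mxE sum2 !mxE.
have i2 : 'i * 'i = -1 :> C by rewrite -expr2 sqrCi.
apply/unitarymxP/matrixP => i j; rewrite e !conjFx !mxE.
by case: i j => -[|[|//]] ? [[|[|//]] ?]; rewrite /=; field: i2.
Qed.

Lemma conj_mono n (W X : 'M[C]_n) (w : 'I_n -> C) (si : 'I_n -> 'I_n) i j :
  (forall x y, W x y = w x *+ (y == si x)) ->
  conj_by W X i j = w i * X (si i) (si j) * Num.conj (w j).
Proof.
move=> WE; rewrite conj_byE (bigD1 (si i)) //= [X in _ + X]big1 => [|x xi]; last first.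
  by rewrite big1 // => y _; rewrite WE (negbTE xi) mulr0n !mul0r.
rewrite addr0 (bigD1 (si j)) //= [X in _ + X]big1 => [|y yj]; last first.
  by rewrite [X in Num.conj X]WE (negbTE yj) mulr0n conjC0 mulr0.
by rewrite addr0 !WE !eqxx !mulr1n.
Qed.

Definition dz (z : C) (i : q) := if i == ord0 then 1 else z.

Lemma conj_Sx z y a c a' c' : conj_by (uub (Sx z)) y (mi a c) (mi a' c') =
  dz z a * Num.conj (dz z c) * y (mi a c) (mi a' c') *
  (Num.conj (dz z a') * dz z c').
Proof.
rewrite (@conj_mono _ _ _ (fun x => dz z (mxtens_unindex x).1 *
  Num.conj (dz z (mxtens_unindex x).2)) id).
  by rewrite !mxtens_indexK /= rmorphM /= conjCK.
move=> x t; case: (mxtens_indexP x) => i j; case: (mxtens_indexP t) => k l.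
rewrite tensmxE !mxtens_indexK /= mi_eq !mxE [k == i]eq_sym [l == j]eq_sym.
rewrite /dz; case: i j k l => -[|[|//]] ? [[|[|//]] ?] [[|[|//]] ?] [[|[|//]] ?].
all: rewrite /= ?(mulr1n, mulr0n, conjC0, conjC1, mulr0, mul0r, mul1r).
all: by [].
Qed.

Lemma conj_Xx y a c a' c' : conj_by (uub Xx) y (mi a c) (mi a' c') =
  y (mi (rev_ord a) (rev_ord c)) (mi (rev_ord a') (rev_ord c')).
Proof.
rewrite (@conj_mono _ _ _ (fun=> 1) (fun x => mi (rev_ord (mxtens_unindex x).1)
  (rev_ord (mxtens_unindex x).2))).
  by rewrite !mxtens_indexK /= conjC1 mul1r mulr1.
move=> x t; case: (mxtens_indexP x) => i j; case: (mxtens_indexP t) => k l.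
rewrite tensmxE !mxtens_indexK /= mi_eq !mxE conjC_nat -natrM mulnb.
by case: i j k l => -[|[|//]] ? [[|[|//]] ?] [[|[|//]] ?] [[|[|//]] ?].
Qed.

Lemma addmxE m n (A B : 'M[C]_(m, n)) i j : (A + B) i j = A i j + B i j.
Proof. by rewrite mxE. Qed.

Lemma scalemxE m n t (A : 'M[C]_(m, n)) i j : (t *: A) i j = t * A i j.
Proof. by rewrite mxE. Qed.

Lemma avg_cons2 U V y i j : avg [:: U; V] y i j =
  2^-1 * (conj_by (uub U) y i j + conj_by (uub V) y i j) :> C.
Proof. by rewrite /avg big_cons big_seq1 scalemxE addmxE. Qed.

Lemma avg_cons4 U V W Z y i j : avg [:: U; V; W; Z] y i j =
  4^-1 * (conj_by (uub U) y i j + (conj_by (uub V) y i j +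
    (conj_by (uub W) y i j + conj_by (uub Z) y i j))) :> C.
Proof. by rewrite /avg 3!big_cons big_seq1 scalemxE 3!addmxE. Qed.

Lemma avg_cons3 U V W y : avg [:: U; V; W] y =
  3^-1 *: (conj_by (uub U) y + (conj_by (uub V) y + conj_by (uub W) y)) :> 'M[C]_(2 * 2).
Proof. by rewrite /avg 2!big_cons big_seq1. Qed.

Lemma avg_Sx z1 z2 z3 z4 (y : 'M[C]_(2 * 2)) a c a' c' (D := fun z : C =>
    dz z a * Num.conj (dz z c) * y (mi a c) (mi a' c') *
    (Num.conj (dz z a') * dz z c')) :
  avg [:: Sx z1; Sx z2; Sx z3; Sx z4] y (mi a c) (mi a' c') =
  4^-1 * (D z1 + (D z2 + (D z3 + D z4))).
Proof. by rewrite avg_cons4; congr (_ * (_ + (_ + (_ + _)))); exact: conj_Sx. Qed.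

Definition k1 := avg [:: Sx 1; Sx 'i; Sx (-1); Sx (- 'i : C)].
Definition k2 := avg [:: Sx 1; Xx].
Definition k3 := avg [:: Sx 1; Fx; Fx - 1%:M].

(** The entry picks up z to the power a - c - a' + c', which lies between -2 and 2, and the fourth
    roots of unity average every nonzero such power to 0. *)
Lemma k1E (y : 'M[C]_(2 * 2)) a c a' c' : k1 y (mi a c) (mi a' c') =
  ((a == c) && (a' == c') || (a == a') && (c == c'))%:R * y (mi a c) (mi a' c').
Proof.
rewrite avg_Sx.
have i2 : 'i * 'i = -1 :> C by rewrite -expr2 sqrCi.
have cN (z : C) : Num.conj (- z) = - Num.conj z by rewrite rmorphN.
rewrite /dz; case: a c a' c' => -[|[|//]] ? [[|[|//]] ?] [[|[|//]] ?] [[|[|//]] ?];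
by rewrite /= ?(cN, conjC1, conjCi); set z := y _ _; field: i2.
Qed.

(** In Pauli notation, (1 + Z (x) Z) / 2. *)
Definition Ex : 'M[C]_(2 * 2) := diag_mx (\row_x
  let u := mxtens_unindex x in (u.1 == u.2)%:R).

Lemma ExE a c a' c' : Ex (mi a c) (mi a' c') =
  [&& a == c, a == a' & c == c']%:R.
Proof.
rewrite !mxE mxtens_indexK /= mi_eq.
by case: (a == c); case: (_ && _).
Qed.

Lemma Sx1 : Sx 1 = 1%:M :> 'M[C]_2.
Proof.
apply/matrixP => i j; rewrite !mxE; by case: ifP.
Qed.

(** After phases and bit flip only the span of P, 1 and Ex is left. The third average fixes P and 1,
    so it remains to compute it on Ex. *)
Lemma k2k1E (y : 'M[C]_(2 * 2)) :
  let p := 2^-1 * (y (mi ord0 ord0) (mi ord0 ord0) + y (mi ord_max ord_max) (mi ord_max ord_max)) in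
  let s := 2^-1 * (y (mi ord0 ord0) (mi ord_max ord_max) + y (mi ord_max ord_max) (mi ord0 ord0)) in
  let r := 2^-1 * (y (mi ord0 ord_max) (mi ord0 ord_max) + y (mi ord_max ord0) (mi ord_max ord0)) in
  k2 (k1 y) = (2 * s) *: P + r *: one + (p - s - r) *: Ex.
Proof.
move=> p s r; apply: mxtensP => a c a' c'.
rewrite /k2 avg_cons2 Sx1 /uub map_mx1.
have -> : 1%:M *t 1%:M = one by apply: mxtensP => *; rewrite tensmxE !mxE mi_eq -natrM mulnb.
rewrite conj_by_id -/(uub _) conj_Xx !k1E.
have -> : ((2 * s) *: P + r *: one + (p - s - r) *: Ex) (mi a c) (mi a' c') =
  (2 * s) * P (mi a c) (mi a' c') + r * one (mi a c) (mi a' c') +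
  (p - s - r) * Ex (mi a c) (mi a' c') by rewrite !mxE.
rewrite PE ExE oneE mi_eq /p /s /r.
have r0 h : rev_ord (Ordinal (h : (0 < 2)%N)) = ord_max by apply/val_inj.
have r1 h : rev_ord (Ordinal (h : (1 < 2)%N)) = ord0 by apply/val_inj.
have o0 h : Ordinal (h : (0 < 2)%N) = ord0 by apply/val_inj.
have o1 h : Ordinal (h : (1 < 2)%N) = ord_max by apply/val_inj.
by case: a c a' c' => -[|[|//]] ? [[|[|//]] ?] [[|[|//]] ?] [[|[|//]] ?];
rewrite ?(r0, r1) ?(o0, o1) /=; field.
Qed.

End FiniteTwirlFormula.

Section FiniteTwirlFormula2.
Variable R : realType.
Local Notation C := R[i].
Local Notation q := 'I_2.
Local Notation P := (P R).
Local Notation one := (1%:M : 'M[C]_(2 * 2)).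
Local Notation Fx := (Fx R).
Local Notation Ex := (Ex R).

(** The four functions tabulate [Fx - 1%:M], [Fx] and their conjugates as expressions in 'i free of
    conjugation, which [field] can settle from 'i * 'i = -1. *)
Definition f2 (i j : q) : C := 2^-1 *
  (if i == ord0 then - 1 - 'i else if j == ord0 then 1 - 'i else - 1 + 'i).
Definition f2c (i j : q) : C := 2^-1 *
  (if i == ord0 then - 1 + 'i else if j == ord0 then 1 + 'i else - 1 - 'i).
Definition f1 (i j : q) : C := 2^-1 *
  (if j == ord0 then 1 - 'i else if i == ord0 then - 1 - 'i else 1 + 'i).
Definition f1c (i j : q) : C := 2^-1 *
  (if j == ord0 then 1 + 'i else if i == ord0 then - 1 + 'i else 1 - 'i).

Lemma F1E i j : Fx i j = f1 i j. Proof. by rewrite mxE. Qed.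
Lemma F1cE i j : Num.conj (Fx i j) = f1c i j. Proof. exact: conjFx. Qed.

Lemma F2E i j : (Fx - 1%:M) i j = f2 i j.
Proof.
rewrite !mxE /f2; by case: i j => -[|[|//]] ? [[|[|//]] ?]; rewrite /=; field.
Qed.

Lemma F2cE i j : Num.conj ((Fx - 1%:M) i j) = f2c i j.
Proof.
have -> : (Fx - 1%:M) i j = Fx i j - (i == j)%:R by rewrite addmxE !mxE.
rewrite rmorphB /= F1cE conjC_nat /f1c /f2c.
by case: i j => -[|[|//]] ? [[|[|//]] ?]; rewrite /=; field.
Qed.

Lemma F2_unitary : Fx - 1%:M \is unitarymx.
Proof.
have i2 : 'i * 'i = -1 :> C by rewrite -expr2 sqrCi.
have e i j : ((Fx - 1%:M) *m (Fx - 1%:M)^t*) i j =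
    f2 i ord0 * f2c j ord0 + f2 i ord_max * f2c j ord_max.
  by rewrite mxE sum2 -!F2cE -!F2E; congr (_ * _ + _ * _); rewrite 2!mxE.
apply/unitarymxP/matrixP => i j; rewrite e /f2 /f2c oneE.
by case: i j => -[|[|//]] ? [[|[|//]] ?]; rewrite /=; field: i2.
Qed.

Lemma conj_diag n (W : 'M[C]_n) d i j :
  conj_by W (diag_mx d) i j = \sum_x W i x * d 0 x * Num.conj (W j x).
Proof.
rewrite conj_byE; apply: eq_bigr => x _; rewrite (bigD1 x) //= big1 ?addr0.
  by rewrite mxE eqxx mulr1n.
by move=> y yx; rewrite mxE eq_sym (negbTE yx) mulr0n mulr0 mul0r.
Qed.

Lemma conj_Ex (U : 'M[C]_2) a c a' c' : conj_by (uub U) Ex (mi a c) (mi a' c') =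
  U a ord0 * Num.conj (U c ord0) * (Num.conj (U a' ord0) * U c' ord0) +
  U a ord_max * Num.conj (U c ord_max) * (Num.conj (U a' ord_max) * U c' ord_max).
Proof.
have uE i j k l : uub U (mi i j) (mi k l) = U i k * Num.conj (U j l).
  by rewrite tensmxE [X in _ * X = _]mxE.
have dE i j : (\row_x let u := mxtens_unindex x in (u.1 == u.2)%:R) 0
   (mi i j) = (i == j)%:R :> C by rewrite mxE mxtens_indexK.
rewrite /Ex conj_diag sum22 !dE !uE !rmorphM /= !conjCK.
by rewrite !mulr1 !mulr0 !mul0r addr0 add0r.
Qed.

(** Cycling the axes averages Z (x) Z into a third of the sum of the three products sigma (x) conj
    sigma, and that sum is 4 P - 1. *)
Lemma k3Ex : k3 Ex = 3^-1 *: (one + 2 *: P).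
Proof.
have i2 : 'i * 'i = -1 :> C by rewrite -expr2 sqrCi.
rewrite /k3 avg_cons3 Sx1 /uub map_mx1.
have -> : 1%:M *t 1%:M = one by apply: mxtensP => *; rewrite tensmxE !mxE mi_eq -natrM mulnb.
rewrite conj_by_id -!/(uub _); congr (_ *: _); apply: mxtensP => a c a' c'.
rewrite !addmxE scalemxE ExE PE oneE mi_eq !conj_Ex !F1cE !F1E !F2cE !F2E.
rewrite /f1 /f1c /f2 /f2c.
by case: a c a' c' => -[|[|//]] ? [[|[|//]] ?] [[|[|//]] ?] [[|[|//]] ?];
  rewrite /=; field: i2.
Qed.

Lemma avg3_inv (U V W : 'M[C]_2) y : conj_by (uub U) y = y -> conj_by (uub V) y = y ->
  conj_by (uub W) y = y -> avg [:: U; V; W] y = y.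
Proof.
move=> eU eV eW; rewrite avg_cons3 eU eV eW.
by apply/matrixP => i j; rewrite scalemxE !addmxE; field.
Qed.

Lemma Sx1_unitary : Sx (1 : C) \is unitarymx.
Proof. by apply: Sx_unitary; rewrite conjC1 mulr1. Qed.

Lemma k3P : k3 P = P.
Proof.
by apply: avg3_inv; apply: conj_P; [exact: Sx1_unitary|exact: Fx_unitary|exact: F2_unitary].
Qed.

Lemma k31 : k3 one = one.
Proof.
by apply: avg3_inv; apply/conj_1/uub_unitary;
  [exact: Sx1_unitary|exact: Fx_unitary|exact: F2_unitary].
Qed.

Lemma tr_Py (y : 'M[C]_(2 * 2)) : \tr (P *m y) = 2^-1 *
  (y (mi ord0 ord0) (mi ord0 ord0) + y (mi ord_max ord_max) (mi ord_max ord_max)) +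
  2^-1 * (y (mi ord0 ord0) (mi ord_max ord_max) + y (mi ord_max ord_max) (mi ord0 ord0)).
Proof.
rewrite /mxtrace sum22 !mxE !sum22 !PE /=; ring.
Qed.

Lemma twirl_coefficients n (Pm On : 'M[C]_n) (y00 y01 y10 y11 z w : C)
    (p := 2^-1 * (y00 + y11)) (s := 2^-1 * (z + w)) (r := 2^-1 * (y01 + y10)) :
  2 * s *: Pm + r *: On + (p - s - r) *: (3^-1 *: (On + 2 *: Pm)) =
  (p + s) *: Pm + 3^-1 * (y00 + y01 + (y10 + y11) - (p + s)) *: (On - Pm).
Proof. by apply/matrixP => i j; rewrite !mxE /p /s /r; field. Qed.

Lemma kfE (y : 'M[C]_(2 * 2)) : k3 (k2 (k1 y)) = kf y.
Proof.
have lk3 : linear (@k3 R) by exact: avg_lin.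
rewrite k2k1E 2!(linD lk3) (linZ lk3 _ P) k3P (linZ lk3 _ one) k31.
rewrite (linZ lk3 _ Ex) k3Ex.
have trB : \tr (y - P *m y) = \tr y - \tr (P *m y) by rewrite linearB.
rewrite /kf mulmxBl mul1mx trB tr_Py.
set y00 := y (mi ord0 ord0) (mi ord0 ord0); set y11 := y (mi ord_max ord_max) (mi ord_max ord_max).
have -> : \tr y = y00 + y (mi ord0 ord_max) (mi ord0 ord_max) +
  (y (mi ord_max ord0) (mi ord_max ord0) + y11) by rewrite /mxtrace sum22.
exact: twirl_coefficients.
Qed.

End FiniteTwirlFormula2.

(** * The twirl is LOCC *)

Section TwirlLocc.
Variable R : realType.
Local Notation C := R[i].
Local Notation q := 'I_2.
Local Notation P := (P R).
Local Notation one := (1%:M : 'M[C]_(2 * 2)).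

Lemma tr_conj n (W X : 'M[C]_n) : W \is unitarymx -> \tr (conj_by W X) = \tr X.
Proof.
by move=> /unitarymxP WW; rewrite /conj_by mxtrace_mulC mulmxA (mulmx1C WW) mul1mx.
Qed.

Lemma scaled_conj_lin n (a : C) (W : 'M[C]_n) : linear (fun X => a *: conj_by W X).
Proof. by move=> b X Y; rewrite conj_by_lin scalerDr !scalerA mulrC. Qed.

Lemma map_tens_scaled_l m n (a : C) (W : 'M[C]_m) (X : 'M[C]_(m * n)) :
  map_tens (fun X => a *: conj_by W X) id X = a *: conj_by (W *t 1%:M) X.
Proof.
rewrite -map_tens_conj_l; apply: mxtensP => i k j l.
rewrite map_tens_idrE; last exact: scaled_conj_lin.
by rewrite !scalemxE map_tens_idrE //; exact: conj_by_lin.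
Qed.

Lemma map_tens_scaled_r m n (a : C) (W : 'M[C]_n) (X : 'M[C]_(m * n)) :
  map_tens id (fun X => a *: conj_by W X) X = a *: conj_by (1%:M *t W) X.
Proof.
rewrite -map_tens_conj_r; apply: mxtensP => i k j l.
rewrite map_tens_idlE; last exact: scaled_conj_lin.
by rewrite !scalemxE map_tens_idlE //; exact: conj_by_lin.
Qed.

Lemma scaled_conj_cp n (a : C) (W : 'M[C]_n) : 0 <= a ->
  completely_positive (fun X => a *: conj_by W X).
Proof.
move=> a0; split; first exact: scaled_conj_lin.
by move=> k X pX; rewrite map_tens_scaled_l; apply/psdZ/psd_conj.
Qed.

Lemma random_unitary_instrument N n (U : 'I_N -> 'M[C]_n) : (0 < N)%N ->
  (forall i, U i \is unitarymx) ->
  instrument (fun i X => N%:R^-1 *: conj_by (U i) X).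
Proof.
move=> N0 uU; split=> [i|X]; first by apply: scaled_conj_cp; rewrite invr_ge0 ler0n.
under eq_bigr do rewrite linearZ /= tr_conj //.
rewrite sumr_const card_ord -[LHS]mulr_natl mulrA mulfV ?mul1r //.
by rewrite pnatr_eq0 -lt0n.
Qed.

Lemma map_tens_avg_l us (X : 'M[C]_(2 * 2 * (2 * 2))) : map_tens (avg us) id X =
  (size us)%:R^-1 *: \sum_(U <- us) map_tens (conj_by (uub U)) id X.
Proof.
apply: mxtensP => i k j l; rewrite map_tens_idrE; last exact: avg_lin.
rewrite /avg !scalemxE !summxE; congr (_ * _); apply: eq_bigr => U _.
by rewrite map_tens_idrE //; exact: conj_by_lin.
Qed.

Lemma map_tens_avg_r us (X : 'M[C]_(2 * 2 * (2 * 2))) : map_tens id (avg us) X =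
  (size us)%:R^-1 *: \sum_(U <- us) map_tens id (conj_by (uub U)) X.
Proof.
apply: mxtensP => i k j l; rewrite map_tens_idlE; last exact: avg_lin.
rewrite /avg !scalemxE !summxE; congr (_ * _); apply: eq_bigr => U _.
by rewrite map_tens_idlE //; exact: conj_by_lin.
Qed.

Lemma liftA_avg us X : liftA (avg us) X =
  (size us)%:R^-1 *: \sum_(i < size us) conj_by (ro (uub (nth 0 us i)) one) X.
Proof.
rewrite /liftA map_tens_avg_l (linZ (@ro_mx_lin _)) (lin_sum (@ro_mx_lin _)).
congr (_ *: _); rewrite (big_nth 0) big_mkord; apply: eq_bigr => i _.
exact: liftA_conj.
Qed.

Lemma liftB_avg us X : liftB (avg us) X =
  (size us)%:R^-1 *: \sum_(i < size us) conj_by (ro one (uub (nth 0 us i))) X.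
Proof.
rewrite /liftB map_tens_avg_r (linZ (@ro_mx_lin _)) (lin_sum (@ro_mx_lin _)).
congr (_ *: _); rewrite (big_nth 0) big_mkord; apply: eq_bigr => i _.
exact: liftB_conj.
Qed.

Lemma unitary_conj (U : 'M[C]_2) : U \is unitarymx -> map_mx Num.conj U \is unitarymx.
Proof. by rewrite conjC_unitary. Qed.

Lemma unitary1 n : (1%:M : 'M[C]_n) \is unitarymx.
Proof. by apply/unitarymxP; rewrite trmx1 map_mx1 mulmx1. Qed.

Lemma unitary_tens m n (U : 'M[C]_m) (V : 'M[C]_n) : U \is unitarymx ->
  V \is unitarymx -> U *t V \is unitarymx.
Proof.
move=> /unitarymxP UU /unitarymxP VV; apply/unitarymxP.
rewrite trmx_tens map_mxT tensmx_mul UU VV.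
by apply: mxtensP => i k j l; rewrite tensmxE !oneE mi_eq -natrM mulnb.
Qed.

Lemma locc_unitary_C (L : qbox R) (W : 'M[C]_(2 * 2)) : W \is unitarymx ->
  locc L -> @locc R 2 2 2 2 2 (2 * 2) (fun X => L (conj_by (1%:M *t W) X)).
Proof.
move=> uW locL; pose E (i : 'I_1) (X : 'M[C]_(2 * 2)) := 1%:R^-1 *: conj_by W X.
have iE : instrument E.
  by apply: (@random_unitary_instrument 1 _ (fun=> W)).
have := locc_C (L := fun=> L) iE (fun=> locL).
congr locc; apply/funext => X; rewrite big_ord1.
by rewrite map_tens_scaled_r invr1 scale1r.
Qed.

(** Alice draws i uniformly, applies the i-th unitary and announces i; Charlie then applies the
    conjugate unitary to C1. *)
Lemma locc_avgA (L : qbox R) us : (0 < size us)%N ->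
  (forall i, (i < size us)%N -> nth 0 us i \is unitarymx) ->
  locc L -> @locc R 2 2 2 2 2 (2 * 2) (fun X => L (liftA (avg us) X)).
Proof.
move=> us0 uus locL; have uU (i : 'I_(size us)) : nth 0 us i \is unitarymx by exact: uus.
have locU (i : 'I_(size us)) := locc_unitary_C
  (unitary_tens (unitary_conj (uU i)) (unitary1 2)) locL.
have := locc_A (random_unitary_instrument us0 uU) locU.
congr locc; apply/funext => X; rewrite liftA_avg (linZ (locc_lin locL)).
rewrite (lin_sum (locc_lin locL)) scaler_sumr; apply: eq_bigr => i _.
rewrite -(linZ (locc_lin locL)); congr (L _).
have -> : map_tens (fun Y => (size us)%:R^-1 *: conj_by (nth 0 us i) Y) (@id 'M[C]_2) =
   fun Y => (size us)%:R^-1 *: conj_by (nth 0 us i *t 1%:M) Y.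
  by apply/funext => Y; rewrite map_tens_scaled_l.
rewrite map_tens_scaled_l (linZ (@conj_by_lin _ _ _)) conj_byM tensmx_mul mul1mx mulmx1.
by rewrite WAE.
Qed.

Lemma locc_avgB (L : qbox R) us : (0 < size us)%N ->
  (forall i, (i < size us)%N -> nth 0 us i \is unitarymx) ->
  locc L -> @locc R 2 2 2 2 2 (2 * 2) (fun X => L (liftB (avg us) X)).
Proof.
move=> us0 uus locL; have uU (i : 'I_(size us)) : nth 0 us i \is unitarymx by exact: uus.
have locU (i : 'I_(size us)) := locc_unitary_C
  (unitary_tens (unitary1 2) (unitary_conj (uU i))) locL.
have := locc_B (random_unitary_instrument us0 uU) locU.
congr locc; apply/funext => X; rewrite liftB_avg (linZ (locc_lin locL)).
rewrite (lin_sum (locc_lin locL)) scaler_sumr; apply: eq_bigr => i _.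
rewrite -(linZ (locc_lin locL)); congr (L _).
have -> : map_tens (@id 'M[C]_2) (fun Y => (size us)%:R^-1 *: conj_by (nth 0 us i) Y) =
   fun Y => (size us)%:R^-1 *: conj_by (1%:M *t nth 0 us i) Y.
  by apply/funext => Y; rewrite map_tens_scaled_r.
rewrite map_tens_scaled_l (linZ (@conj_by_lin _ _ _)) conj_byM tensmx_mul mul1mx mulmx1.
by rewrite WBE.
Qed.

Lemma kf_lin : linear (@kf R).
Proof. by move=> a X Y; rewrite -!kfE /k1 /k2 /k3 !avg_lin. Qed.

Lemma liftA_comp f g X : linear f -> linear g ->
  liftA f (liftA g X) = liftA (fun y => f (g y)) X :> 'M[C]_(2 * 2 * (2 * 2)).
Proof.
move=> lf lg; rewrite /liftA ro_mxK; congr ro_mx; apply: mxtensP => i k j l.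
rewrite !map_tens_idrE //; last by move=> a Y Z; rewrite lg lf.
congr (f _ i j); apply/matrixP => x y; rewrite mxE map_tens_idrE //.
Qed.

Lemma liftB_comp f g X : linear f -> linear g ->
  liftB f (liftB g X) = liftB (fun y => f (g y)) X :> 'M[C]_(2 * 2 * (2 * 2)).
Proof.
move=> lf lg; rewrite /liftB ro_mxK; congr ro_mx; apply: mxtensP => i k j l.
rewrite !map_tens_idlE //; last by move=> a Y Z; rewrite lg lf.
congr (f _ k l); apply/matrixP => x y; rewrite mxE map_tens_idlE //.
Qed.

Lemma kf_comp : @kf R = fun y => k3 (k2 (k1 y)).
Proof. by apply/funext => y; rewrite kfE. Qed.

Lemma k1_lin : linear (@k1 R). Proof. exact: avg_lin. Qed.
Lemma k2_lin : linear (@k2 R). Proof. exact: avg_lin. Qed.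
Lemma k3_lin : linear (@k3 R). Proof. exact: avg_lin. Qed.

Lemma k21_lin : linear (fun y => k2 (@k1 R y)).
Proof. by move=> a X Y; rewrite k1_lin k2_lin. Qed.

Lemma liftA_kf X : liftA (@kf R) X = liftA (@k3 R) (liftA (@k2 R) (liftA (@k1 R) X)).
Proof.
by rewrite kf_comp (liftA_comp X k2_lin k1_lin) (liftA_comp X k3_lin k21_lin).
Qed.

Lemma liftB_kf X : liftB (@kf R) X = liftB (@k3 R) (liftB (@k2 R) (liftB (@k1 R) X)).
Proof.
by rewrite kf_comp (liftB_comp X k2_lin k1_lin) (liftB_comp X k3_lin k21_lin).
Qed.

Definition k1l : seq 'M[C]_2 := [:: Sx 1; Sx 'i; Sx (-1); Sx (- 'i)].
Definition k2l : seq 'M[C]_2 := [:: Sx 1; Xx R].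
Definition k3l : seq 'M[C]_2 := [:: Sx 1; Fx R; Fx R - 1%:M].

Lemma k1l_unitary i : (i < size k1l)%N -> nth 0 k1l i \is unitarymx.
Proof.
have i2 : 'i * 'i = -1 :> C by rewrite -expr2 sqrCi.
by case: i => [|[|[|[|//]]]] _; apply: Sx_unitary;
  rewrite ?rmorphN /= ?conjC1 ?conjCi; ring: i2.
Qed.

Lemma k2l_unitary i : (i < size k2l)%N -> nth 0 k2l i \is unitarymx.
Proof. by case: i => [|[|//]] _; [exact: Sx1_unitary|exact: Xx_unitary]. Qed.

Lemma k3l_unitary i : (i < size k3l)%N -> nth 0 k3l i \is unitarymx.
Proof.
by case: i => [|[|[|//]]] _; [exact: Sx1_unitary|exact: Fx_unitary|exact: F2_unitary].
Qed.

Lemma locc_kf (L : qbox R) : locc L ->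
  @locc R 2 2 2 2 2 (2 * 2) (fun X => L (liftA (@kf R) (liftB (@kf R) X))).
Proof.
move=> locL.
(* An average placed in front of a protocol acts before it, so the factors of [kf] are added from
   last to first. *)
have l1 := @locc_avgA _ k3l isT k3l_unitary locL.
have l2 := @locc_avgA _ k2l isT k2l_unitary l1.
have l3 := @locc_avgA _ k1l isT k1l_unitary l2.
have l4 := @locc_avgB _ k3l isT k3l_unitary l3.
have l5 := @locc_avgB _ k2l isT k2l_unitary l4.
have := @locc_avgB _ k1l isT k1l_unitary l5.
by congr locc; apply/funext => X; rewrite liftA_kf liftB_kf.
Qed.

End TwirlLocc.

(** * Integration over U(2) *)

Section ComplexIntegral.
Variable R : realType.
Local Notation C := R[i].
Local Notation B2 := (borelM2 R).
Local Notation Re := (@complex.Re R).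
Local Notation Im := (@complex.Im R).

Lemma ReD (x y : C) : Re (x + y) = Re x + Re y. Proof. by case: x; case: y. Qed.
Lemma ImD (x y : C) : Im (x + y) = Im x + Im y. Proof. by case: x; case: y. Qed.
Lemma ReM (x y : C) : Re (x * y) = Re x * Re y - Im x * Im y.
Proof. by case: x; case: y. Qed.
Lemma ImM (x y : C) : Im (x * y) = Re x * Im y + Im x * Re y.
Proof. by case: x; case: y. Qed.
Lemma ReJ (x : C) : Re (Num.conj x) = Re x. Proof. by case: x. Qed.
Lemma ImJ (x : C) : Im (Num.conj x) = - Im x. Proof. by case: x. Qed.
Lemma complex_ext (x y : C) : Re x = Re y -> Im x = Im y -> x = y.
Proof. by case: x => a b; case: y => c d /= -> ->. Qed.

Definition cmeas (f : B2 -> C) :=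
  measurable_fun [set: B2] (fun U => Re (f U)) /\
  measurable_fun [set: B2] (fun U => Im (f U)).

Lemma cmeas_cst c : cmeas (fun=> c).
Proof. by split; exact: measurable_cst. Qed.

Lemma cmeasD f g : cmeas f -> cmeas g -> cmeas (fun U => f U + g U).
Proof.
move=> [f1 f2] [g1 g2]; split.
  by under eq_fun do rewrite ReD; exact: measurable_funD.
by under eq_fun do rewrite ImD; exact: measurable_funD.
Qed.

Lemma cmeasM f g : cmeas f -> cmeas g -> cmeas (fun U => f U * g U).
Proof.
move=> [f1 f2] [g1 g2]; split.
  by under eq_fun do rewrite ReM; apply: measurable_funB; exact: measurable_funM.
by under eq_fun do rewrite ImM; apply: measurable_funD; exact: measurable_funM.
Qed.

Lemma cmeasJ f : cmeas f -> cmeas (fun U => Num.conj (f U)).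
Proof.
move=> [f1 f2]; split; first by under eq_fun do rewrite ReJ.
by under eq_fun do rewrite ImJ; exact: measurable_funN.
Qed.

Lemma cmeas_sum (I : Type) (r : seq I) (F : I -> B2 -> C) :
  (forall i, cmeas (F i)) -> cmeas (fun U => \sum_(i <- r) F i U).
Proof.
move=> mF; elim: r => [|i r IH].
  by under eq_fun do rewrite big_nil; exact: cmeas_cst.
by under eq_fun do rewrite big_cons; exact: cmeasD.
Qed.

Lemma cmeas_entry (i j : 'I_2) : cmeas (fun U : B2 => (U : 'M[C]_2) i j).
Proof.
split=> mD Y mY; rewrite setTI; apply: sub_sigma_algebra.
  by exists i, j, Y; split=> //; left.
by exists i, j, Y; split=> //; right.
Qed.

Lemma cmeas_mul_entry (V : 'M[C]_2) i j :
  cmeas (fun U : B2 => (V *m (U : 'M[C]_2)) i j).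
Proof.
under eq_fun do rewrite mxE.
by apply: cmeas_sum => k; apply: cmeasM; [exact: cmeas_cst|exact: cmeas_entry].
Qed.

Lemma mul_measurable (V : 'M[C]_2) :
  measurable_fun [set: B2] (fun U : B2 => V *m (U : 'M[C]_2) : B2).
Proof.
apply: (@measurability _ _ B2 B2 setT (fun U : B2 => V *m (U : 'M[C]_2) : B2)
  (@entry_sets R) erefl).
move=> _ [_ [i [j [Y [mY [->|->]]]]] <-].
  by have [m _] := cmeas_mul_entry V i j; exact: m.
by have [_ m] := cmeas_mul_entry V i j; exact: m.
Qed.

Lemma cmeas_eq f c : cmeas f -> measurable [set U | f U = c].
Proof.
move=> [f1 f2].
rewrite (_ : [set U | f U = c] = ([set: B2] `&` (fun U => Re (f U)) @^-1` [set Re c]) `&`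
    ([set: B2] `&` (fun U => Im (f U)) @^-1` [set Im c])).
  by apply: measurableI; [apply: f1|apply: f2].
rewrite !setTI; apply/seteqP; split=> U /=; first by move->.
by case=> h1 h2; exact: complex_ext.
Qed.

Lemma U2_measurable : measurable (@U2 R).
Proof.
pose f i j (U : B2) := ((U : 'M[C]_2) *m (U : 'M[C]_2)^t*) i j.
have mf i j : cmeas (f i j).
  rewrite /f; under eq_fun do rewrite mxE.
  apply: cmeas_sum => k; apply: cmeasM; first exact: cmeas_entry.
  by under eq_fun do rewrite !mxE; apply: cmeasJ; exact: cmeas_entry.
pose S i j := [set U | f i j U = (1%:M : 'M[C]_2) i j].
have mS i j : measurable (S i j) by exact: cmeas_eq.
rewrite (_ : @U2 R = S ord0 ord0 `&` S ord0 ord_max `&` (S ord_max ord0 `&` S ord_max ord_max)).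
  by apply: measurableI; apply: measurableI.
apply/seteqP; split=> U.
  move=> /unitarymxP UU; rewrite /S /f /=.
  by rewrite UU.
move=> [[h1 h2] [h3 h4]]; apply/unitarymxP/matrixP => i j.
have o0 h : Ordinal (h : (0 < 2)%N) = ord0 by apply/val_inj.
have o1 h : Ordinal (h : (1 < 2)%N) = ord_max by apply/val_inj.
by case: i j => -[|[|//]] ? [[|[|//]] ?]; rewrite ?(o0, o1).
Qed.

(** Bounded on U(2) only: entries are unbounded on the ambient space that carries the measure. *)
Definition cbnd (f : B2 -> C) := exists M : R, forall U : B2, @U2 R U ->
  `|Re (f U)| <= M /\ `|Im (f U)| <= M.

Definition cgood f := cmeas f /\ cbnd f.

Lemma cgood_cst c : cgood (fun=> c).
Proof.
split; first exact: cmeas_cst.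
exists (`|Re c| + `|Im c|) => U _.
by split; rewrite ?lerDl ?lerDr.
Qed.

Lemma cgoodD f g : cgood f -> cgood g -> cgood (fun U => f U + g U).
Proof.
move=> [mf [M hM]] [mg [N hN]]; split; first exact: cmeasD.
exists (M + N) => U u; have [h1 h2] := hM U u; have [h3 h4] := hN U u.
by rewrite ReD ImD; split; apply: (le_trans (ler_normD _ _)); exact: lerD.
Qed.

Lemma cgoodM f g : cgood f -> cgood g -> cgood (fun U => f U * g U).
Proof.
move=> [mf [M hM]] [mg [N hN]]; split; first exact: cmeasM.
exists (M * N + M * N) => U u; have [h1 h2] := hM U u; have [h3 h4] := hN U u.
rewrite ReM ImM; split; [apply: (le_trans (ler_normB _ _))|apply: (le_trans (ler_normD _ _))];
by apply: lerD; rewrite normrM; apply: ler_pM.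
Qed.

Lemma cgoodJ f : cgood f -> cgood (fun U => Num.conj (f U)).
Proof.
move=> [mf [M hM]]; split; first exact: cmeasJ.
by exists M => U u; rewrite ReJ ImJ normrN; exact: hM.
Qed.

Lemma cgood_sum (I : Type) (r : seq I) (F : I -> B2 -> C) :
  (forall i, cgood (F i)) -> cgood (fun U => \sum_(i <- r) F i U).
Proof.
move=> mF; elim: r => [|i r IH].
  by under eq_fun do rewrite big_nil; exact: cgood_cst.
by under eq_fun do rewrite big_cons; exact: cgoodD.
Qed.

(** The rows of a unitary matrix are unit vectors, so 1 bounds all entries. *)
Lemma cgood_entry (i j : 'I_2) : cgood (fun U : B2 => (U : 'M[C]_2) i j).
Proof.
split; first exact: cmeas_entry.
exists 1 => U /unitarymxP /matrixP /(_ i i); rewrite !mxE eqxx.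
move=> /(congr1 Re).
have ReS : Re (\sum_k (U : 'M[C]_2) i k * (U^t*) k i) =
    \sum_k ((Re (U i k)) ^+ 2 + (Im (U i k)) ^+ 2).
  rewrite (big_morph Re ReD (erefl _)); apply: eq_bigr => k _.
  by rewrite !mxE ReM ReJ ImJ mulrN opprK !expr2.
rewrite ReS (bigD1 j) //= => e.
have e1 : (Re (U i j)) ^+ 2 + (Im (U i j)) ^+ 2 <= 1.
  by rewrite -e lerDl sumr_ge0 // => k _; rewrite addr_ge0 ?sqr_ge0.
have sq1 (x : R) : x ^+ 2 <= 1 -> `|x| <= 1.
  by move=> x1; rewrite -(@expr_le1 _ 2) // real_normK ?num_real.
by split; apply: sq1; apply: le_trans e1; rewrite ?lerDl ?lerDr sqr_ge0.
Qed.

Lemma mulU2 (V U : 'M[C]_2) :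
  V \is unitarymx -> U \is unitarymx -> V *m U \is unitarymx.
Proof. exact: (@mul_unitarymx C 2 2 2). Qed.

Lemma ctU2 (V : 'M[C]_2) : V \is unitarymx -> V^t* \is unitarymx.
Proof. by rewrite trmxC_unitary. Qed.

Variable mu : probability B2 R.
Hypothesis haar : is_haar_U2 mu.

Let mU2 : measurable (@U2 R) := U2_measurable.

Lemma muU2 : mu (@U2 R) = 1%E. Proof. by case: haar. Qed.

Lemma good_integrable (f : B2 -> R) : measurable_fun [set: B2] f ->
  (exists M, forall U, @U2 R U -> `|f U| <= M) ->
  mu.-integrable (@U2 R) (EFin \o f).
Proof.
move=> mf [M hM]; have fin : (mu (@U2 R) < +oo)%E by rewrite muU2 ltry.
apply: measurable_bounded_integrable => //.
- exact: measurable_funTS.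
- exists M; split; first exact: num_real.
  by move=> x Mx U u /=; apply: le_trans (ltW Mx); exact: hM.
Qed.

Definition cint (f : B2 -> C) : C :=
  Complex (Rintegral mu (@U2 R) (fun U => Re (f U)))
          (Rintegral mu (@U2 R) (fun U => Im (f U))).

Lemma cgood_Re f : cgood f -> mu.-integrable (@U2 R) (EFin \o (fun U => Re (f U))).
Proof.
move=> [[m _] [M hM]]; apply: good_integrable => //.
by exists M => U /hM[].
Qed.

Lemma cgood_Im f : cgood f -> mu.-integrable (@U2 R) (EFin \o (fun U => Im (f U))).
Proof.
move=> [[_ m] [M hM]]; apply: good_integrable => //.
by exists M => U /hM[].
Qed.

Lemma eq_cint f g : (forall U, @U2 R U -> f U = g U) -> cint f = cint g.
Proof.
move=> fg; apply: complex_ext; apply: eq_Rintegral => U; rewrite inE => u;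
by rewrite fg.
Qed.

Lemma cint_cst c : cint (fun=> c) = c.
Proof.
by apply: complex_ext; rewrite /= Rintegral_cst // [X in fine X]muU2 mulr1.
Qed.

Lemma cintD f g : cgood f -> cgood g -> cint (fun U => f U + g U) = cint f + cint g.
Proof.
move=> gf gg; apply: complex_ext; rewrite /= ?ReD ?ImD.
  under eq_Rintegral do rewrite ReD.
  by rewrite RintegralD //; exact: cgood_Re.
under eq_Rintegral do rewrite ImD.
by rewrite RintegralD //; exact: cgood_Im.
Qed.

Lemma cintZ c f : cgood f -> cint (fun U => c * f U) = c * cint f.
Proof.
move=> gf; have iR := cgood_Re gf; have iI := cgood_Im gf.
have iZ (g : B2 -> R) r : mu.-integrable (@U2 R) (EFin \o g) ->
    mu.-integrable (@U2 R) (EFin \o (fun U => r * g U)).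
  move=> ig; have := integrableZl mU2 r ig; exact: eq_integrable.
apply: complex_ext; rewrite ?ReM ?ImM /=.
  under eq_Rintegral do rewrite ReM.
  by rewrite RintegralB ?RintegralZl //; exact: iZ.
under eq_Rintegral do rewrite ImM.
by rewrite RintegralD ?RintegralZl //; exact: iZ.
Qed.

Lemma cint_sum (I : Type) (r : seq I) (F : I -> B2 -> C) :
  (forall i, cgood (F i)) ->
  cint (fun U => \sum_(i <- r) F i U) = \sum_(i <- r) cint (F i).
Proof.
move=> gF; elim: r => [|i r IH].
  by under eq_fun do rewrite big_nil; rewrite cint_cst big_nil.
under eq_fun do rewrite big_cons.
by rewrite cintD ?IH ?big_cons //; exact: cgood_sum.
Qed.

Lemma cgood_comp (V : 'M[C]_2) f : V \is unitarymx -> cgood f ->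
  cgood (fun U : B2 => f (V *m (U : 'M[C]_2))).
Proof.
move=> uV [[m1 m2] [M hM]]; split.
  split.
    exact: (measurableT_comp m1 (mul_measurable V)).
  exact: (measurableT_comp m2 (mul_measurable V)).
by exists M => U u; exact: hM (mulU2 uV u).
Qed.

(** Invariance says that [mu] is its own image under U -> V U, which maps U(2) onto itself; the rest
    is a change of variables. *)
Lemma Rint_inv (V : 'M[C]_2) (f : B2 -> R) : V \is unitarymx ->
  measurable_fun [set: B2] f -> mu.-integrable (@U2 R) (EFin \o f) ->
  mu.-integrable (@U2 R) (EFin \o (fun U : B2 => f (V *m (U : 'M[C]_2)))) ->
  Rintegral mu (@U2 R) (fun U : B2 => f (V *m (U : 'M[C]_2))) =
  Rintegral mu (@U2 R) f.
Proof.
move=> uV mf intf intfV; congr fine.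
pose phi := fun U : B2 => V *m (U : 'M[C]_2) : B2.
have phiU2 : phi @^-1` (@U2 R) = @U2 R.
  apply/seteqP; split=> U; last exact: mulU2 uV.
  move=> /(mulU2 (ctU2 uV)).
  by rewrite /phi mulmxA (mulmx1C (elimT unitarymxP uV)) mul1mx.
have -> : (\int[mu]_(x in @U2 R) (f x)%:E = \int[pushforward mu phi]_(x in @U2 R) (f x)%:E)%E.
  apply: eq_measure_integral; first exact: mul_measurable.
  move=> pA A mA _; have [_ inv] := haar.
  exact: esym (inv V A uV mA).
rewrite (integral_pushforward (mul_measurable V)) ?phiU2 //.
exact/measurable_EFinP.
Qed.

Lemma cint_inv (V : 'M[C]_2) f : V \is unitarymx -> cgood f ->
  cint (fun U : B2 => f (V *m (U : 'M[C]_2))) = cint f.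
Proof.
move=> uV gf; have gV := cgood_comp uV gf.
have [[m1 m2] _] := gf.
apply: complex_ext => /=.
  by apply: (Rint_inv uV m1); [exact: cgood_Re|exact: cgood_Re gV].
by apply: (Rint_inv uV m2); [exact: cgood_Im|exact: cgood_Im gV].
Qed.

End ComplexIntegral.

(** * The Haar twirl *)

Section HaarTwirl.
Variable R : realType.
Local Notation C := R[i].
Local Notation B2 := (borelM2 R).
Local Notation P := (P R).
Local Notation one := (1%:M : 'M[C]_(2 * 2)).
Local Notation M16 := 'M[C]_(2 * 2 * (2 * 2)).
Variable mu : probability B2 R.
Hypothesis haar : is_haar_U2 mu.

Lemma mx_integralE m n (F : 'M[C]_2 -> 'M[C]_(m, n)) i j :
  mx_integral mu F i j = cint mu (fun U => F U i j).
Proof. by rewrite mxE. Qed.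

Lemma mx_integral_lin (Phi : M16 -> M16) (F : 'M[C]_2 -> M16) : linear Phi ->
  (forall i j, cgood (fun U : B2 => F U i j)) ->
  Phi (mx_integral mu F) = mx_integral mu (fun U => Phi (F U)).
Proof.
move=> lPhi gF; apply/matrixP => i j; rewrite mx_integralE (lin_mxE lPhi).
have -> : (fun U : B2 => Phi (F U) i j) = (fun U : B2 =>
    \sum_x \sum_y Phi (delta_mx x y) i j * F U x y).
  apply/funext => U; rewrite (lin_mxE lPhi); apply: eq_bigr => x _.
  by apply: eq_bigr => y _; rewrite mulrC.
have gxy x y : cgood (fun U : B2 => Phi (delta_mx x y) i j * F U x y).
  by apply: cgoodM; [exact: cgood_cst|exact: gF].
rewrite (cint_sum haar); last by move=> x; exact: cgood_sum.
apply: eq_bigr => x _; rewrite (cint_sum haar) //; apply: eq_bigr => y _.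
by rewrite (cintZ haar) // mulrC mx_integralE.
Qed.

Lemma eq_mx_integral (F G : 'M[C]_2 -> M16) :
  (forall U, U \is unitarymx -> F U = G U) -> mx_integral mu F = mx_integral mu G.
Proof.
move=> FG; apply/matrixP => i j; rewrite !mx_integralE; apply: eq_cint => U u.
by rewrite FG.
Qed.

Lemma mx_integral_cst (X : M16) : mx_integral mu (fun=> X) = X.
Proof. by apply/matrixP => i j; rewrite mx_integralE (cint_cst haar). Qed.

Lemma mx_integral_inv (V : 'M[C]_2) (F : 'M[C]_2 -> M16) : V \is unitarymx ->
  (forall i j, cgood (fun U : B2 => F U i j)) ->
  mx_integral mu (fun U => F (V *m U)) = mx_integral mu F.
Proof.
move=> uV gF; apply/matrixP => i j; rewrite !mx_integralE.
exact: (cint_inv haar uV (gF i j)).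
Qed.

Lemma cgood_uub i j : cgood (fun U : B2 => uub U i j).
Proof.
case: (mxtens_indexP i) => a c; case: (mxtens_indexP j) => b d.
under eq_fun do rewrite tensmxE.
apply: cgoodM; first exact: cgood_entry.
by under eq_fun do rewrite mxE; apply: cgoodJ; exact: cgood_entry.
Qed.

Lemma uubM (U V : 'M[C]_2) : uub (U *m V) = uub U *m uub V.
Proof. by rewrite /uub map_mxM tensmx_mul. Qed.

(** [kf y] depends only on the traces of y and of P y, and P commutes with [uub U]. *)
Lemma kf_conj (U : 'M[C]_2) y : U \is unitarymx -> kf (conj_by (uub U) y) = kf y.
Proof.
move=> uU; have uW := uub_unitary uU.
have h : \tr (P *m conj_by (uub U) y) = \tr (P *m y).
  have e : P *m uub U = uub U *m P.
    have /unitarymxP WW := uW.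
    by rewrite -{1}(conj_P uU) /conj_by -!mulmxA (mulmx1C WW) mulmx1.
  rewrite /conj_by !mulmxA e mxtrace_mulC !mulmxA.
  by have /unitarymxP WW := uW; rewrite (mulmx1C WW) mul1mx.
have h2 z : \tr ((one - P) *m z) = \tr z - \tr (P *m z).
  by rewrite mulmxBl mul1mx linearB.
by rewrite /kf !h2 h tr_conj.
Qed.

Section Generic.
Variables (W : 'M[C]_2 -> M16) (lift : ('M[C]_(2 * 2) -> 'M[C]_(2 * 2)) -> M16 -> M16).
Hypothesis Wgood : forall i j, cgood (fun U : B2 => W U i j).
Hypothesis WM : forall U V, W (U *m V) = W U *m W V.
Hypothesis liftkf_lin : linear (lift (@kf R)).
Hypothesis liftkf_conj : forall U X, U \is unitarymx ->
  lift (@kf R) (conj_by (W U) X) = lift (@kf R) X.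
Hypothesis liftkf_inv : forall X, (forall U, U \is unitarymx -> conj_by (W U) X = X) ->
  lift (@kf R) X = X.

Lemma conj_good (X : M16) i j : cgood (fun U : B2 => conj_by (W U) X i j).
Proof.
under eq_fun do rewrite conj_byE.
apply: cgood_sum => x; apply: cgood_sum => y; apply: cgoodM.
  by apply: cgoodM; [exact: Wgood|exact: cgood_cst].
by apply: cgoodJ; exact: Wgood.
Qed.

(** Apply [lift kf] to the Haar average T. T is fixed by every conjugation, hence by the finite
    average. By linearity [lift kf] also passes under the integral, where it is constant in U. *)
Lemma haar_average X : mx_integral mu (fun U => conj_by (W U) X) = lift (@kf R) X.
Proof.
set T := mx_integral _ _.
have Tinv U : U \is unitarymx -> conj_by (W U) T = T.
  move=> uU; rewrite /T (mx_integral_lin (@conj_by_lin _ _ _) (conj_good X)).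
  rewrite -[RHS](mx_integral_inv uU (conj_good X)); congr mx_integral.
  by apply/funext => V; rewrite conj_byM WM.
rewrite -(liftkf_inv Tinv) /T (mx_integral_lin liftkf_lin (conj_good X)).
rewrite (@eq_mx_integral _ (fun=> lift (@kf R) X)); first exact: mx_integral_cst.
by move=> U uU; exact: liftkf_conj.
Qed.

End Generic.

Lemma liftA_lin f : linear f -> linear (@liftA R f).
Proof. by move=> lf a X Y; rewrite /liftA ro_mx_lin map_tens_lin ro_mx_lin. Qed.

Lemma liftB_lin f : linear f -> linear (@liftB R f).
Proof. by move=> lf a X Y; rewrite /liftB ro_mx_lin map_tens_lin ro_mx_lin. Qed.

Lemma avg_inv N (Y : M16) (Z : 'I_N -> M16) : (0 < N)%N -> (forall i, Z i = Y) ->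
  N%:R^-1 *: \sum_i Z i = Y.
Proof.
move=> N0 ZY; under eq_bigr do rewrite ZY.
rewrite sumr_const card_ord -[Y *+ N]scaler_nat scalerA mulVf ?scale1r //.
by rewrite pnatr_eq0 -lt0n.
Qed.

Lemma twirl_AC1E X : twirl_AC1 mu X = liftA (@kf R) X.
Proof.
rewrite /twirl_AC1 (_ : (fun U => _) = fun U => conj_by (ro (uub U) one) X); last first.
  by apply/funext => U; rewrite WAE.
apply: (@haar_average (fun U => ro (uub U) one) (@liftA R)).
- move=> i j; case: (mxtens_indexP i) => u v; case: (mxtens_indexP j) => u' v'.
  case: (mxtens_indexP u) => a b; case: (mxtens_indexP v) => c d.
  case: (mxtens_indexP u') => a' b'; case: (mxtens_indexP v') => c' d'.
  under eq_fun do rewrite roE.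
  by apply: cgoodM; [exact: cgood_uub|exact: cgood_cst].
- by move=> U V; rewrite ro_mul mulmx1 uubM.
- exact/liftA_lin/kf_lin.
- move=> U Y uU; rewrite -liftA_conj (liftA_comp Y (@kf_lin R) (@conj_by_lin _ _ _)).
  by congr (liftA _ Y); apply/funext => y; exact: kf_conj.
- move=> Y inv; rewrite liftA_kf.
  have h us : (0 < size us)%N -> (forall i, (i < size us)%N -> nth 0 us i \is unitarymx) ->
      liftA (avg us) Y = Y.
    by move=> us0 uus; rewrite liftA_avg; apply: avg_inv => // i; apply: inv; exact: uus.
  by rewrite /k1 /k2 /k3 (h (k1l R) isT (@k1l_unitary R)) (h (k2l R) isT (@k2l_unitary R))
    (h (k3l R) isT (@k3l_unitary R)).
Qed.

Lemma twirl_BC2E X : twirl_BC2 mu X = liftB (@kf R) X.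
Proof.
rewrite /twirl_BC2 (_ : (fun U => _) = fun U => conj_by (ro one (uub U)) X); last first.
  by apply/funext => U; rewrite WBE.
apply: (@haar_average (fun U => ro one (uub U)) (@liftB R)).
- move=> i j; case: (mxtens_indexP i) => u v; case: (mxtens_indexP j) => u' v'.
  case: (mxtens_indexP u) => a b; case: (mxtens_indexP v) => c d.
  case: (mxtens_indexP u') => a' b'; case: (mxtens_indexP v') => c' d'.
  under eq_fun do rewrite roE.
  by apply: cgoodM; [exact: cgood_cst|exact: cgood_uub].
- by move=> U V; rewrite ro_mul mulmx1 uubM.
- exact/liftB_lin/kf_lin.
- move=> U Y uU; rewrite -liftB_conj (liftB_comp Y (@kf_lin R) (@conj_by_lin _ _ _)).
  by congr (liftB _ Y); apply/funext => y; exact: kf_conj.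
- move=> Y inv; rewrite liftB_kf.
  have h us : (0 < size us)%N -> (forall i, (i < size us)%N -> nth 0 us i \is unitarymx) ->
      liftB (avg us) Y = Y.
    by move=> us0 uus; rewrite liftB_avg; apply: avg_inv => // i; apply: inv; exact: uus.
  by rewrite /k1 /k2 /k3 (h (k1l R) isT (@k1l_unitary R)) (h (k2l R) isT (@k2l_unitary R))
    (h (k3l R) isT (@k3l_unitary R)).
Qed.

Lemma twirlE X : twirl mu X = liftA (@kf R) (liftB (@kf R) X).
Proof. by rewrite /twirl twirl_BC2E twirl_AC1E. Qed.

Definition Pi (s : bool) : 'M[C]_(2 * 2) := if s then P else one - P.
(** The reciprocal ranks of the projections [Pi]. *)
Definition Pd (s : bool) : C := if s then 1 else 3^-1.

Lemma kf_sum y : kf y = \sum_s (Pd s * \tr (Pi s *m y)) *: Pi s.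
Proof. by rewrite big_bool /= mul1r. Qed.

Lemma tr_ro_mx (X : M16) : \tr (ro_mx X) = \tr X.
Proof.
rewrite /mxtrace [RHS](reindex_inj (inv_inj ro_indexK)).
by apply: eq_bigr => i _; rewrite mxE.
Qed.

Lemma tr_ro_mul A B (X : M16) : \tr (ro A B *m X) = \sum_x \sum_y A x y *
  \tr (B *m \matrix_(k, l) ro_mx X (mi y k) (mi x l)).
Proof.
rewrite -tr_ro_mx ro_mx_mul [ro_mx (ro A B)]ro_mxK /mxtrace sum_mi.
apply: eq_bigr => x _.
transitivity (\sum_k \sum_y \sum_l A x y * (B k l * ro_mx X (mi y l) (mi x k))).
  apply: eq_bigr => k _; rewrite mxE sum_mi; apply: eq_bigr => y _.
  by apply: eq_bigr => l _; rewrite tensmxE mulrA.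
rewrite exchange_big; apply: eq_bigr => y _; rewrite mulr_sumr.
apply: eq_bigr => k _; rewrite mxE mulr_sumr; apply: eq_bigr => l _.
by rewrite [in RHS]mxE.
Qed.

Lemma kf_entry y i j : kf y i j = \sum_s Pd s * \tr (Pi s *m y) * Pi s i j.
Proof. by rewrite kf_sum summxE; apply: eq_bigr => s _; rewrite scalemxE. Qed.

Lemma twirl_sum X : twirl mu X =
  \sum_s \sum_t (Pd s * Pd t * \tr (ro (Pi s) (Pi t) *m X)) *: ro (Pi s) (Pi t).
Proof.
rewrite twirlE; apply: mxtens4P => a b c d a' b' c' d'.
rewrite /liftA /liftB ro_mxK mxE !ro_indexE map_tens_idrE; last exact: kf_lin.
rewrite kf_entry summxE; apply: eq_bigr => s _; rewrite summxE.
set Y := ro_mx X.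
have -> : \tr (Pi s *m (\matrix_(i, j) map_tens id (@kf R) Y
      (mi i (mi b d)) (mi j (mi b' d')))) =
    \sum_t \sum_x \sum_y Pi s x y * (Pd t *
    \tr (Pi t *m \matrix_(k, l) Y (mi y k) (mi x l)) * Pi t (mi b d) (mi b' d')).
  rewrite /mxtrace exchange_big; apply: eq_bigr => x _ /=.
  rewrite mxE exchange_big; apply: eq_bigr => y _ /=.
  by rewrite mxE map_tens_idlE ?kf_entry ?mulr_sumr //; exact: kf_lin.
rewrite mulr_sumr mulr_suml; apply: eq_bigr => t _.
rewrite scalemxE roE tr_ro_mul -/Y !mulr_sumr !mulr_suml.
apply: eq_bigr => x _; rewrite !mulr_sumr !mulr_suml; apply: eq_bigr => y _.
by ring.
Qed.

End HaarTwirl.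

(** * Memories beside the box *)

Section Memories.
Variable R : realType.
Local Notation C := R[i].

Lemma psd_ptrace_r m n (X : 'M[C]_(m * n)) : psdmx X -> psdmx (ptrace_r X).
Proof.
move=> pX; have -> : ptrace_r X = \sum_k mxsub (fun i => mi i k) (fun i => mi i k) X.
  by apply/matrixP => i j; rewrite mxE summxE; apply: eq_bigr => k _; rewrite mxE.
by apply: psd_sum => k _; exact: psd_mxsub.
Qed.

Lemma conj_by_cp n (W : 'M[C]_n) : completely_positive (conj_by W).
Proof.
split; first exact: conj_by_lin.
by move=> k X pX; rewrite map_tens_conj_l; exact: psd_conj.
Qed.

(** Positivity in the form needed beside a memory. It is stable under sums and nonnegative
    multiples, so for the output states it reduces to pure states. *)
Definition tpos m (Lam : 'M[C]_m) :=
  forall n (Z : 'M[C]_n), psdmx Z -> psdmx (Z *t Lam).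

Lemma tpos_pure m (v : 'cV[C]_m) : tpos (pure v).
Proof.
move=> n Z pZ; pose W : 'M[C]_(n * m, n) := \matrix_(x, j)
  ((j == (mxtens_unindex x).1)%:R * v (mxtens_unindex x).2 0).
have WE i k j : W (mi i k) j = (j == i)%:R * v k 0 by rewrite mxE mxtens_indexK.
have := psd_conj W pZ; congr psdmx; apply: mxtensP => i k j l.
rewrite tensmxE [in RHS]mxE big_ord1 !mxE (bigD1 j) //= [X in _ + X]big1 => [|x xj].
  rewrite addr0 mxE (bigD1 i) //= [X in _ + X]big1 => [|x xi].
    by rewrite addr0 !mxE !mxtens_indexK /= !eqxx !mul1r; ring.
  by rewrite WE (negbTE xi) !mul0r.
by rewrite !mxE !mxtens_indexK /= (negbTE xj) mul0r conjC0 mulr0.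
Qed.

Lemma tposD m (A B : 'M[C]_m) : tpos A -> tpos B -> tpos (A + B).
Proof.
move=> pA pB n Z pZ; have -> : Z *t (A + B) = Z *t A + Z *t B.
  by apply: mxtensP => *; rewrite [RHS]mxE !tensmxE mxE mulrDr.
by apply: psdD; [exact: pA|exact: pB].
Qed.

Lemma tposZ m (a : C) (A : 'M[C]_m) : 0 <= a -> tpos A -> tpos (a *: A).
Proof.
move=> a0 pA n Z pZ; have -> : Z *t (a *: A) = a *: (Z *t A).
  by apply: mxtensP => *; rewrite [RHS]mxE !tensmxE mxE mulrCA.
by apply: psdZ => //; exact: pA.
Qed.

Lemma tpos0 m : tpos (0 : 'M[C]_m).
Proof. by move=> n Z _; rewrite tensmx0; exact: psd0. Qed.

Lemma tpos_diag m (d : 'rV[C]_m) : (forall i, 0 <= d 0 i) -> tpos (diag_mx d).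
Proof.
move=> d0; have -> : diag_mx d = \sum_i d 0 i *: pure (delta_mx i 0 : 'cV[C]_m).
  have pE k i j : pure (delta_mx k 0 : 'cV[C]_m) i j = (i == k)%:R * (j == k)%:R.
    by rewrite mxE big_ord1 !mxE !andbT conjC_nat.
  apply/matrixP => i j; rewrite summxE (bigD1 i) //= big1 => [|k ki].
    by rewrite addr0 scalemxE pE eqxx mul1r mxE eq_sym mulr_natr.
  by rewrite scalemxE pE eq_sym (negbTE ki) mul0r mulr0.
apply: (big_ind (fun A => tpos A)); [exact: tpos0|exact: tposD|].
by move=> i _; apply: tposZ => //; exact: tpos_pure.
Qed.

Lemma tr_tens m n (A : 'M[C]_m) (B : 'M[C]_n) : \tr (A *t B) = \tr A * \tr B.
Proof.
rewrite /mxtrace sum_mi mulr_suml; apply: eq_bigr => i _.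
by rewrite mulr_sumr; apply: eq_bigr => k _; rewrite tensmxE.
Qed.

(** Diagonalising A turns the trace into the sum of its eigenvalues times diagonal entries of a
    conjugate of D. *)
Lemma psd_mul_tr n (D A : 'M[C]_n) : psdmx D -> psdmx A -> 0 <= \tr (D *m A).
Proof.
move=> pD pA.
have hA : A^t* = A.
  apply/matrixP => i j; rewrite mxE mxE -[A j i]quad_delta -[RHS]quad_delta.
  by rewrite -(psd_herm pA).
have nA : A \is normalmx by apply/normalmxP; rewrite hA.
have /orthomx_spectralP e := nA; set S := spectralmx A in e.
have uS : S \is unitarymx by exact: spectral_unitarymx.
have iS : invmx S = S^t* by exact: invmx_unitary.
have SS : S *m S^t* = 1%:M by exact/unitarymxP.
set sp := spectral_diag A in e.
have spE i : sp 0 i = (S *m A *m S^t*) i i.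
  rewrite e iS !mulmxA SS mul1mx -mulmxA SS mulmx1 mxE eqxx mulr1n //.
rewrite e iS !mulmxA mxtrace_mulC !mulmxA /mxtrace.
apply: sumr_ge0 => i _; rewrite mul_mx_diag mxE mulr_ge0 //.
  exact/psd_diag/psd_conj.
by rewrite spE; exact/psd_diag/psd_conj.
Qed.

Lemma cast_regroup d x y e (i : 'I_d) (j : 'I_x) (k : 'I_y) (l : 'I_e) :
  cast_ord (regroup_eq d x y e) (mi (mi i j) (mi k l)) = mi (mi i (mi j k)) l.
Proof. by apply/val_inj => /=; ring. Qed.

Lemma regroupE d x y e (X : 'M[C]_(d * x * (y * e))) i j k l i' j' k' l' :
  regroup X (mi (mi i (mi j k)) l) (mi (mi i' (mi j' k')) l') =
  X (mi (mi i j) (mi k l)) (mi (mi i' j') (mi k' l')).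
Proof. by rewrite /regroup castmxE -!cast_regroup !cast_ordK. Qed.

Lemma ungroupE d x y e (X : 'M[C]_(d * (x * y) * e)) i j k l i' j' k' l' :
  ungroup X (mi (mi i j) (mi k l)) (mi (mi i' j') (mi k' l')) =
  X (mi (mi i (mi j k)) l) (mi (mi i' (mi j' k')) l').
Proof.
rewrite /ungroup castmxE -!cast_regroup.
by congr (X _ _); apply/val_inj.
Qed.

(** The operator on the box inputs A B C1 C2 found at fixed indices of the two memories. *)
Definition block d e (X : 'M[C]_(d * (2 * 2) * (2 * 2 * e))) (i j : 'I_d) (k l : 'I_e) :
    'M[C]_(2 * 2 * (2 * 2)) := \matrix_(x, y)
  let u := mxtens_unindex x in let v := mxtens_unindex y in
  X (mi (mi i u.1) (mi u.2 k)) (mi (mi j v.1) (mi v.2 l)).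

Lemma use_boxE (L : qbox R) d e (X : 'M[C]_(d * (2 * 2) * (2 * 2 * e)))
    i u c k j u' c' l : linear L ->
  use_box L X (mi (mi i u) (mi c k)) (mi (mi j u') (mi c' l)) =
  L (block X i j k l) (mi u c) (mi u' c').
Proof.
move=> linL; rewrite /use_box ungroupE map_tens_idrE; last exact: map_tens_lin.
rewrite map_tens_idlE //; congr (L _ _ _); apply: mxtensP => a b a' b'.
by rewrite !mxE !mxtens_indexK /= regroupE.
Qed.

Definition pick_idx d e (x : 'I_(d * e * (2 * 2 * (2 * 2)))) :
    'I_(d * (2 * 2) * (2 * 2 * e)) :=
  let p := mxtens_unindex x in let de := mxtens_unindex p.1 in
  let uv := mxtens_unindex p.2 in mi (mi de.1 uv.1) (mi uv.2 de.2).

(** The unnormalised state of the two memories when a measurement of the box inputs has given the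
    outcome with operator V V^dagger. *)
Definition select (V : 'M[C]_(2 * 2 * (2 * 2))) d e
    (X : 'M[C]_(d * (2 * 2) * (2 * 2 * e))) : 'M[C]_(d * e) :=
  ptrace_r (map_tens id (conj_by (V^t*)) (mxsub (@pick_idx d e) (@pick_idx d e) X)).

Lemma psd_select V d e (X : 'M[C]_(d * (2 * 2) * (2 * 2 * e))) :
  psdmx X -> psdmx (select V X).
Proof.
move=> pX; apply/psd_ptrace_r/psd_idl; first exact: conj_by_cp.
exact: psd_mxsub.
Qed.

Lemma selectE V d e (X : 'M[C]_(d * (2 * 2) * (2 * 2 * e))) i k j l :
  select V X (mi i k) (mi j l) = \tr (V *m V^t* *m block X i j k l).
Proof.
set X' := mxsub (@pick_idx d e) (@pick_idx d e) X.
transitivity (\tr (conj_by (V^t*) (\matrix_(k', l') X' (mi (mi i k) k') (mi (mi j l) l')))).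
  by rewrite mxE; apply: eq_bigr => z _; rewrite map_tens_idlE //; exact: conj_by_lin.
rewrite /conj_by ctmxK mxtrace_mulC mulmxA; congr (\tr (_ *m _)).
apply: mxtensP => a b a' b'; by rewrite !mxE /pick_idx !mxtens_indexK /= ?mxtens_indexK.
Qed.

End Memories.

(** * The converse bound *)

Section Converse.
Variable R : realType.
Local Notation C := R[i].
Local Notation Re := (@complex.Re R).
Local Notation rc := (real_complex R).

(** The box is treated abstractly: it measures x in [I], draws y in [J] with probability [w x y] and
    prepares [Lam x y], whose part on A and B depends on y alone. [qd] is a reference law of y, and
    [c] bounds the divergences from it in nats. *)
Variables (I J : finType).
Variable V : I -> 'M[C]_(2 * 2 * (2 * 2)).
Variable Lam : I -> J -> 'M[C]_(2 * 2 * 2).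
Variable tau : J -> 'M[C]_(2 * 2).
Variables (w : I -> J -> R) (qd : J -> R) (c : R) (L : qbox R).

Hypothesis V1 : \sum_x V x *m (V x)^t* = 1%:M.
Hypothesis Lam_pos : forall x y, tpos (Lam x y).
Hypothesis Lam_tau : forall x y, ptrace_r (Lam x y) = tau y.
Hypothesis tau1 : forall y, \tr (tau y) = 1.
Hypothesis w_ge0 : forall x y, 0 <= w x y.
Hypothesis w1 : forall x, \sum_y w x y = 1.
Hypothesis qd_gt0 : forall y, 0 < qd y.
Hypothesis qd1 : \sum_y qd y = 1.
Hypothesis w_div : forall x, \sum_y w x y * ln (w x y / qd y) <= c.
Hypothesis L_E : forall X, L X =
  \sum_x \sum_y (rc (w x y) * \tr (V x *m (V x)^t* *m X)) *: Lam x y.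

(** The unnormalised state after a use with outcome x and output y. The factor [w x y] is kept out,
    so that [qd y] can be put in its place. *)
Definition emit x y d e (X : 'M[C]_(d * (2 * 2) * (2 * 2 * e))) :
    'M[C]_(d * (2 * 2) * (2 * e)) :=
  \matrix_(i, j)
    let ui := mxtens_unindex i in let uj := mxtens_unindex j in
    let ai := mxtens_unindex ui.1 in let aj := mxtens_unindex uj.1 in
    let ci := mxtens_unindex ui.2 in let cj := mxtens_unindex uj.2 in
    select (V x) X (mi ai.1 ci.2) (mi aj.1 cj.2) *
      Lam x y (mi ai.2 ci.1) (mi aj.2 cj.1).

Lemma emitE x y d e (X : 'M[C]_(d * (2 * 2) * (2 * 2 * e))) i u k z j u' k' z' :
  emit x y X (mi (mi i u) (mi k z)) (mi (mi j u') (mi k' z')) =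
  select (V x) X (mi i z) (mi j z') * Lam x y (mi u k) (mi u' k').
Proof. by rewrite mxE; cbv zeta; rewrite !mxtens_indexK /= ?mxtens_indexK. Qed.

Lemma mxtens22P (T : Type) a b a' b' (X Y : 'M[T]_(a * b * (a' * b'))) :
  (forall i u k z j u' k' z', X (mi (mi i u) (mi k z)) (mi (mi j u') (mi k' z')) =
    Y (mi (mi i u) (mi k z)) (mi (mi j u') (mi k' z'))) -> X = Y.
Proof.
move=> XY; apply: mxtensP => p s r t.
case: (mxtens_indexP p) => i u; case: (mxtens_indexP s) => k z.
by case: (mxtens_indexP r) => j u'; case: (mxtens_indexP t) => k' z'.
Qed.

Lemma L_lin : linear L.
Proof.
move=> a X Y; rewrite !L_E scaler_sumr -big_split; apply: eq_bigr => x _ /=.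
rewrite scaler_sumr -big_split; apply: eq_bigr => y _ /=.
by rewrite mulmxDr -scalemxAr linearD linearZ /= mulrDr scalerDl scalerA mulrCA.
Qed.

Lemma use_box_emit d e (X : 'M[C]_(d * (2 * 2) * (2 * 2 * e))) :
  use_box L X = \sum_x \sum_y rc (w x y) *: emit x y X.
Proof.
apply: mxtens22P => *; rewrite use_boxE; last exact: L_lin.
rewrite L_E !summxE; apply: eq_bigr => x _; rewrite !summxE; apply: eq_bigr => y _.
by rewrite !scalemxE emitE selectE mulrA.
Qed.

Lemma psd_emit x y d e (X : 'M[C]_(d * (2 * 2) * (2 * 2 * e))) :
  psdmx X -> psdmx (emit x y X).
Proof.
move=> /(psd_select (V x)) /(@Lam_pos x y).
pose h (i : 'I_(d * (2 * 2) * (2 * e))) : 'I_(d * e * (2 * 2 * 2)) :=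
  let ui := mxtens_unindex i in let ai := mxtens_unindex ui.1 in
  let ci := mxtens_unindex ui.2 in mi (mi ai.1 ci.2) (mi ai.2 ci.1).
have hE i u k z : h (mi (mi i u) (mi k z)) = mi (mi i z) (mi u k).
  by rewrite /h !mxtens_indexK /= ?mxtens_indexK.
move=> /(psd_mxsub h); congr psdmx; apply: mxtens22P => *.
by rewrite emitE mxE !hE tensmxE.
Qed.

Lemma ptrace_emit x y d e (X : 'M[C]_(d * (2 * 2) * (2 * 2 * e))) :
  ptrace_r (emit x y X) = ptrace_r (select (V x) X) *t tau y.
Proof.
apply: mxtensP => i u j u'; rewrite tensmxE -(Lam_tau x y) !mxE sum_mi mulr_sumr.
apply: eq_bigr => k _; rewrite mulr_suml; apply: eq_bigr => z _.
by rewrite emitE.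
Qed.

Lemma emit_lin x y d e : linear (@emit x y d e).
Proof.
move=> a X Y; apply: mxtens22P => *; rewrite addmxE scalemxE !emitE !selectE.
rewrite mulrA -mulrDl; congr (_ * _).
rewrite -linearZ -linearD /= scalemxAr -mulmxDr; congr (\tr (_ *m _)).
apply: mxtensP => p r p' r'; rewrite addmxE scalemxE !mxE /=; cbv zeta.
by rewrite addmxE scalemxE.
Qed.

(** Charlie's input can steer the law of x, but once x is summed over nothing of it remains in Alice
    and Bob's memory. *)
Lemma select_sum d e (X : 'M[C]_(d * (2 * 2) * (2 * 2 * e))) :
  \sum_x ptrace_r (select (V x) X) = ptrace_r (ptrace_r X).
Proof.
apply/matrixP => i j; rewrite summxE; under eq_bigr do rewrite mxE.
rewrite exchange_big /=.
transitivity (\sum_k \tr (block X i j k k)).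
  apply: eq_bigr => k _; under eq_bigr do rewrite selectE.
  by rewrite -linear_sum -mulmx_suml V1 mul1mx.
transitivity (\sum_k \sum_u \sum_z X (mi (mi i u) (mi z k)) (mi (mi j u) (mi z k))).
  apply: eq_bigr => k _; rewrite /mxtrace sum_mi; apply: eq_bigr => u _.
  by apply: eq_bigr => z _; rewrite mxE !mxtens_indexK.
rewrite exchange_big mxE; apply: eq_bigr => u _ /=.
by rewrite exchange_big [RHS]mxE [RHS]sum_mi.
Qed.

Lemma tr_emit x y d e (X : 'M[C]_(d * (2 * 2) * (2 * 2 * e))) :
  \tr (emit x y X) = \tr (select (V x) X).
Proof. by rewrite -tr_ptrace_r ptrace_emit tr_tens tau1 mulr1 tr_ptrace_r. Qed.

Lemma channel_lin m n (F : 'M[C]_m -> 'M[C]_n) : channel F -> linear F.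
Proof. by case=> -[]. Qed.

Lemma psd_channels m n m' n' (F : 'M[C]_m -> 'M[C]_m') (G : 'M[C]_n -> 'M[C]_n') X :
  channel F -> channel G -> psdmx X -> psdmx (map_tens F G X).
Proof.
move=> [cF tF] [cG tG] pX; have [lF pF] := cF; have [lG _] := cG.
by rewrite map_tens_comp //; apply: psd_idl => //; exact: pF.
Qed.

(** The state is split over the histories k of outcomes and outputs; [wk] and [qk] are the products
    of the [w] and of the [qd] along k. With weights [wk] the pieces sum to the true state. With
    weights [qk] they leave Alice and Bob in [Rm], the same for all messages. The last clause bounds
    the mean of ln (wk / qk) under the true law of k. *)
Definition traj M n d e (sigma : 'I_M -> 'M[C]_(d * e)) := exists (K : finType)
    (s : 'I_M -> K -> 'M[C]_(d * e)) (wk qk : K -> R) (Rm : 'M[C]_d),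
  [/\ [/\ forall m k, psdmx (s m k),
      forall m, sigma m = \sum_k rc (wk k) *: s m k,
      forall m, \sum_k rc (qk k) *: ptrace_r (s m k) = Rm & \tr Rm = 1],
      forall k, 0 <= wk k, forall k, 0 < qk k,
      forall m, \sum_k wk k * Re (\tr (s m k)) = 1 &
      forall m, \sum_k wk k * ln (wk k / qk k) * Re (\tr (s m k)) <= n%:R * c].

Lemma rcM (x y : R) : rc (x * y) = rc x * rc y. Proof. exact: rmorphM. Qed.

Lemma Re_rcM (x : R) (z : C) : Re (rc x * z) = x * Re z.
Proof. by case: z => a b /=; rewrite mul0r subr0. Qed.

Lemma Re_add (x y : C) : Re (x + y) = Re x + Re y. Proof. by case: x; case: y. Qed.

Lemma Re_sum (T : Type) (r : seq T) (P : pred T) (F : T -> C) :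
  Re (\sum_(i <- r | P i) F i) = \sum_(i <- r | P i) Re (F i).
Proof. exact: (big_morph Re Re_add (erefl _)). Qed.

Lemma Re_ge0 (z : C) : 0 <= z -> 0 <= Re z.
Proof. by case: z => a b; rewrite lecE /= => /andP[]. Qed.

(** Additivity of the log-likelihood ratio. Zero weights do occur, in the row (1, 0); there both
    sides vanish whatever value [ln] takes at 0. *)
Lemma wln (a b x y : R) : 0 <= a -> 0 <= b -> 0 < x -> 0 < y ->
  a * b * ln (a * b / (x * y)) = b * (a * ln (a / x)) + a * (b * ln (b / y)).
Proof.
rewrite le_eqVlt => /predU1P[<-|a0]; first by rewrite !mul0r mulr0 addr0.
rewrite le_eqVlt => /predU1P[<-|b0]; first by rewrite !(mul0r, mulr0) addr0.
move=> x0 y0; have -> : a * b / (x * y) = a / x * (b / y) by rewrite invfM mulrACA.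
rewrite lnM ?posrE ?divr_gt0 //.
by set la := ln (a / x); set lb := ln (b / y); ring.
Qed.

Lemma encodes_traj M n d e (sigma : 'I_M -> 'M[C]_(d * e)) :
  encodes L n sigma -> traj n sigma.
Proof.
elim=> {n d e sigma} [d e rho [prho trho]|n d e d1 e1 sigma F G _ IH cF cG].
  exists unit, (fun _ _ => rho), (fun=> 1), (fun=> 1), (ptrace_r rho).
  have s1 (T : nmodType) (f : unit -> T) : \sum_k f k = f tt.
    by rewrite (bigD1 tt) //= big1 ?addr0 // => -[].
  split=> //; first split=> //.
  - by move=> m; rewrite s1 rmorph1 scale1r.
  - by move=> m; rewrite s1 rmorph1 scale1r.
  - by rewrite tr_ptrace_r.
  - by move=> m; rewrite s1 trho mul1r.
  - by move=> m; rewrite s1 divr1 ln1 mulr0 !mul0r.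
have [K [s [wk [qk [Rm [[ps sE RmE Rm1] wk0 qk0 wk1 wkc]]]]]] := IH.
pose Y m k := map_tens F (G m) (s m k).
have pY m k : psdmx (Y m k) by exact: psd_channels.
have trY m k : \tr (Y m k) = \tr (s m k).
  rewrite -tr_ptrace_r ptrace_r_map_tens; [|exact: channel_lin|exact: channel_lin|by case: (cG m)].
  by case: cF => _ ->; rewrite tr_ptrace_r.
have sumK (T : nmodType) (f : K * I * J -> T) :
    \sum_k f k = \sum_k \sum_x \sum_y f (k, x, y).
  rewrite pair_big pair_big /=; apply: eq_bigr => -[[k x] y] _ //.
have sel m k : \sum_x \tr (select (V x) (Y m k)) = \tr (s m k).
  rewrite -trY -[RHS]tr_ptrace_r -tr_ptrace_r -select_sum raddf_sum.
  by apply: eq_bigr => x _; rewrite /= tr_ptrace_r.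
exists (K * I * J)%type, (fun m k => emit k.1.2 k.2 (Y m k.1.1)),
  (fun k => wk k.1.1 * w k.1.2 k.2), (fun k => qk k.1.1 * qd k.2),
  (ptrace_r (F Rm) *t \sum_y rc (qd y) *: tau y).
split.
- split.
  + by move=> m k; exact: psd_emit.
  + move=> m; rewrite use_box_emit sumK sE (lin_sum (@map_tens_lin _ _ _ _ _ _ _)).
    rewrite [RHS]exchange_big; apply: eq_bigr => x _ /=.
    rewrite [RHS]exchange_big; apply: eq_bigr => y _ /=.
    rewrite (lin_sum (@emit_lin _ _ _ _)) scaler_sumr; apply: eq_bigr => k _.
    rewrite (linZ (@map_tens_lin _ _ _ _ _ _ _)) (linZ (@emit_lin _ _ _ _)) scalerA.
    by rewrite -rcM mulrC.
  (* Under [qk] the output is independent of x, so summing over x removes Charlie's influence and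
     the new outputs split off as the factor [\sum_y rc (qd y) *: tau y]. *)
  + move=> m; rewrite sumK /=.
    have lF := channel_lin cF; have lG := channel_lin (cG m).
    have -> : ptrace_r (F Rm) =
        \sum_k rc (qk k) *: \sum_x ptrace_r (select (V x) (Y m k)).
      rewrite -(RmE m) (lin_sum lF) (lin_sum (@ptrace_r_lin _ _ _)).
      apply: eq_bigr => k _; rewrite (linZ lF) (linZ (@ptrace_r_lin _ _ _)) select_sum.
      by rewrite /Y ptrace_r_map_tens //; case: (cG m).
    apply: mxtensP => i u j u'; rewrite tensmxE !summxE mulr_suml.
    apply: eq_bigr => k _; rewrite summxE scalemxE summxE -mulrA mulr_suml mulr_sumr.
    apply: eq_bigr => x _; rewrite summxE !mulr_sumr; apply: eq_bigr => y _.
    rewrite !scalemxE ptrace_emit tensmxE rcM; ring.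
  + rewrite tr_tens tr_ptrace_r; case: (cF) => _ ->; rewrite Rm1 mul1r linear_sum.
    under eq_bigr do rewrite linearZ /= tau1 mulr1.
    by rewrite -rmorph_sum qd1.
- by move=> k; rewrite mulr_ge0.
- by move=> k; rewrite mulr_gt0.
- move=> m; rewrite sumK /= -[RHS](wk1 m); apply: eq_bigr => k _.
  rewrite -sel Re_sum mulr_sumr; apply: eq_bigr => x _.
  under eq_bigr do rewrite tr_emit.
  by rewrite -mulr_suml -mulr_sumr w1 mulr1.
- move=> m; rewrite sumK /=.
  have sp x k : 0 <= Re (\tr (select (V x) (Y m k))).
    by apply/Re_ge0/psd_tr_ge0/psd_select.
  (* Chain rule: each history keeps its old ratio, and the new use adds a divergence of at most [c]
     times the probability of the history. *)
  apply: (@le_trans _ _ (\sum_k (wk k * ln (wk k / qk k) * Re (\tr (s m k)) +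
     c * (wk k * Re (\tr (s m k)))))).
    apply: ler_sum => k _; rewrite -sel Re_sum !mulr_sumr -big_split.
    apply: ler_sum => x _ /=.
    under eq_bigr do rewrite tr_emit wln //.
    rewrite -mulr_suml big_split /= -mulr_suml w1 mul1r mulrDl lerD2l mulrA.
    rewrite ler_wpM2r // -mulr_sumr mulrC ler_wpM2r //.
  by rewrite big_split /= -mulr_sumr wk1 mulr1 -[n.+1]addn1 natrD mulrDl mul1r lerD2r.
Qed.

Lemma tr_sum n (T : Type) (r : seq T) (Q : pred T) (f : T -> 'M[C]_n) :
  \tr (\sum_(i <- r | Q i) f i) = \sum_(i <- r | Q i) \tr (f i).
Proof. exact: raddf_sum. Qed.

(** With u = ln (a / b): if u >= T then a <= a u / T, and otherwise a <= e^T b. The added [b] makes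
    the numerator nonnegative even for u < 0, because u + e^(-u) >= 1. *)
Lemma wbound (a b T : R) : 0 <= a -> 0 < b -> 0 < T ->
  0 <= a * ln (a / b) + b /\ a <= (a * ln (a / b) + b) / T + expR T * b.
Proof.
move=> a0 b0 T0; move: a0; rewrite le_eqVlt => /predU1P[<-|a0].
  rewrite !mul0r add0r ltW //; split => //.
  by rewrite addr_ge0 // ?divr_ge0 ?mulr_ge0 ?expR_ge0 // ltW.
have ab0 : 0 < a / b by exact: divr_gt0.
set u := ln (a / b).
have bE : b = a * expR (- u).
  by rewrite expRN /u lnK ?posrE // invf_div mulrCA mulfV ?mulr1 // gt_eqF.
have ge1 : 1 <= u + expR (- u).
  by have := expR_ge1Dx (- u); lra.
have e : a * u + b = a * (u + expR (- u)) by rewrite {1}bE mulrDr.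
have ge0 : a <= a * u + b by rewrite e ler_peMr // ltW.
split; first exact: le_trans (ltW a0) ge0.
have [Tu|uT] := leP T u.
  apply: (@le_trans _ _ ((a * u + b) / T)).
    rewrite ler_pdivlMr //; apply: (@le_trans _ _ (a * u)); last by rewrite lerDl ltW.
    by rewrite ler_wpM2l // ltW.
  by rewrite lerDl mulr_ge0 ?expR_ge0 // ltW.
apply: (@le_trans _ _ (expR T * b)); last by rewrite lerDr divr_ge0 ?ltW // (lt_le_trans a0).
rewrite {1}bE mulrCA -expRD; apply: ler_peMr; first exact: ltW.
by rewrite -expR0 ler_expR subr_ge0 ltW.
Qed.

Lemma Re_tr_D M n (D : 'I_M -> 'M[C]_n) (A : 'M[C]_n) m : povm D -> psdmx A ->
  0 <= Re (\tr (D m *m A)) <= Re (\tr A).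
Proof.
move=> [pD D1] pA; apply/andP; split; first exact/Re_ge0/psd_mul_tr.
have : 0 <= \tr ((1%:M - D m) *m A).
  apply: psd_mul_tr => //; rewrite -D1 (bigD1 m) //= addrAC subrr add0r.
  by apply: psd_sum => i _; exact: pD.
rewrite mulmxBl mul1mx linearB /= => /Re_ge0.
by rewrite Re_add (_ : Re (- _) = - Re (\tr (D m *m A))) ?subr_ge0 //; case: (\tr _).
Qed.

(** By [wbound], true success is at most the mean of (log-ratio + 1) / T plus e^T times the success
    under [qk]. The latter is a guess from a state independent of the message, hence 1 / M on
    average. *)
Lemma error_bound n M eps T : 0 < T -> (0 < M)%N -> error_le L n M eps ->
  1 - eps <= (n%:R * c + 1) / T + expR T / M%:R.
Proof.
move=> T0 M0 [d [e [sigma [D [enc pD err]]]]].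
have [K [s [wk [qk [Rm [[ps sE RmE Rm1] wk0 qk0 wk1 wkc]]]]]] := encodes_traj enc.
pose p m k := Re (\tr (s m k)).
pose t m k := Re (\tr (D m *m ptrace_r (s m k))).
have tp m k : 0 <= t m k <= p m k.
  rewrite /p -tr_ptrace_r; apply: Re_tr_D => //; exact: psd_ptrace_r.
have sumD m (a : K -> R) (F : K -> 'M[C]_d) :
    Re (\tr (D m *m \sum_k rc (a k) *: F k)) = \sum_k a k * Re (\tr (D m *m F k)).
  rewrite mulmx_sumr tr_sum Re_sum; apply: eq_bigr => k _.
  by rewrite -scalemxAr linearZ /= Re_rcM.
pose g m := Re (\tr (D m *m Rm)).
have sumg : \sum_m g m = 1.
  rewrite /g -Re_sum -tr_sum -mulmx_suml; case: pD => _ ->.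
  by rewrite mul1mx Rm1.
have gE m : g m = \sum_k qk k * t m k by rewrite /g -(RmE m) sumD.
have qp m : \sum_k qk k * p m k = 1.
  transitivity (Re (\tr (\sum_k rc (qk k) *: ptrace_r (s m k)))); last by rewrite RmE Rm1.
  rewrite tr_sum Re_sum; apply: eq_bigr => k _.
  by rewrite linearZ /= tr_ptrace_r Re_rcM.
have succ m : 1 - eps <= (n%:R * c + 1) / T + expR T * g m.
  have := err m; rewrite sE (lin_sum (@ptrace_r_lin _ _ _)).
  under eq_bigr do rewrite (linZ (@ptrace_r_lin _ _ _)).
  rewrite sumD => err'.
  apply: (@le_trans _ _ (\sum_k wk k * t m k)); first by rewrite lerBlDr addrC -lerBlDr.
  apply: (@le_trans _ _ (\sum_k ((wk k * ln (wk k / qk k) * p m k + qk k * p m k) / T +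
      expR T * (qk k * t m k)))).
    apply: ler_sum => k _; have /andP[t0 tpk] := tp m k.
    have [h0 h1] := wbound (wk0 k) (qk0 k) T0.
    (* In the first term the success weight [t] is raised to the full weight [p] of the history; its
       coefficient is nonnegative by [wbound]. *)
    apply: (le_trans (ler_wpM2r t0 h1)); rewrite mulrDl -[expR T * qk k * t m k]mulrA lerD2r.
    by rewrite -mulrDl mulrAC; apply: ler_wpM2r; [rewrite invr_ge0 ltW|exact: ler_wpM2l].
  rewrite big_split /= -mulr_suml -mulr_sumr -gE big_split /= qp lerD2r.
  by rewrite ler_wpM2r ?invr_ge0 ?(ltW T0) // lerD2r wkc.
set A := (n%:R * c + 1) / T in succ *.
have M0' : 0 < M%:R :> R by rewrite ltr0n.
have h : M%:R * (1 - eps) <= M%:R * A + expR T.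
  have e1 : \sum_(m < M) (1 - eps) = M%:R * (1 - eps).
    by rewrite sumr_const card_ord mulr_natl.
  have e2 : \sum_(m < M) (A + expR T * g m) = M%:R * A + expR T.
    by rewrite big_split /= sumr_const card_ord mulr_natl -mulr_sumr sumg mulr1.
  by rewrite -e1 -e2; apply: ler_sum => m _; exact: succ.
rewrite -(ler_pM2l M0') [X in _ <= X]mulrDr [M%:R * (expR T / _)]mulrC divfK //.
by rewrite gt_eqF.
Qed.

Lemma invr_le_quarter (x g del : R) : 0 < x -> 0 < g -> 0 < del ->
  4 / (g * del) < x -> (x * g)^-1 <= del / 4.
Proof.
move=> x0 g0 del0; rewrite ltr_pdivrMr ?mulr_gt0 // => h.
rewrite -[_^-1]mul1r ler_pdivrMr ?mulr_gt0 //.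
have -> : del / 4 * (x * g) = x * (g * del) / 4 by field.
by lra.
Qed.

(** Suppose r ln 2 > c and take the threshold n T with T strictly between. The first term of
    [error_bound] tends to c / T < 1, and the second to 0 since M >= e^(n r ln 2); so the success
    probability cannot tend to 1. *)
Lemma achievable_le r : 0 <= c -> achievable_rate L r -> r * ln 2 <= c.
Proof.
move=> c0 ach; rewrite leNgt; apply/negP => cr.
pose rho := r * ln 2; pose T := (c + rho) / 2.
have T0 : 0 < T by rewrite /T /rho; lra.
have cT : c < T by rewrite /T /rho; lra.
have Tr : T < rho by rewrite /T /rho; lra.
pose del := 1 - c / T.
have del0 : 0 < del by rewrite /del subr_gt0 ltr_pdivrMr // mul1r.
have [n0 hn0] := ach (del / 4) (divr_gt0 del0 (ltr0n _ 4)).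
(* For n > b both 1 / (n T) and 1 / (n (rho - T)) are at most del / 4; the second bounds e^(- n (rho
   - T)) because e^x >= x. *)
pose b := 4 / (T * del) + 4 / ((rho - T) * del).
have g0 : 0 < rho - T by rewrite subr_gt0.
have b1 : 0 < 4 / (T * del) by rewrite divr_gt0 // mulr_gt0.
have b2 : 0 < 4 / ((rho - T) * del) by rewrite divr_gt0 // mulr_gt0.
pose n := (n0 + (Num.truncn b).+1)%N.
have nb : b < n%:R.
  apply: (lt_le_trans (truncnS_gt b)); by rewrite ler_nat leq_addl.
have n0' : 0 < n%:R :> R by apply: lt_trans nb; rewrite addr_gt0.
have [M [hM err]] := hn0 n (leq_addr _ _).
have M0 : 0 < M%:R :> R by apply: lt_le_trans hM; exact: powR_gt0.
have nT0 : 0 < n%:R * T by exact: mulr_gt0.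
have M0n : (0 < M)%N by rewrite -(ltr0n R).
have main := error_bound nT0 M0n err.
have e1 : (n%:R * c + 1) / (n%:R * T) = c / T + (n%:R * T)^-1.
  by rewrite mulrDl mul1r -mulf_div divff ?mul1r // gt_eqF.
have e2 : (n%:R * T)^-1 <= del / 4.
  by apply: invr_le_quarter => //; apply: lt_trans nb; rewrite ltrDl.
have e3 : expR (n%:R * T) / M%:R <= del / 4.
  apply: (@le_trans _ _ (expR (n%:R * T) / expR (n%:R * rho))).
    rewrite ler_wpM2l ?expR_ge0 // lef_pV2 ?posrE ?expR_gt0 //.
    by apply: le_trans hM; rewrite /powR pnatr_eq0 /= /rho mulrA.
  rewrite -expRN -expRD -mulrN -mulrDr -[T - rho]opprB mulrN expRN.
  have x0 : 0 < n%:R * (rho - T) by exact: mulr_gt0.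
  apply: (@le_trans _ _ (n%:R * (rho - T))^-1); last first.
    by apply: invr_le_quarter => //; apply: lt_trans nb; rewrite ltrDr.
  rewrite lef_pV2 ?posrE ?expR_gt0 //.
  by apply: le_trans (expR_ge1Dx _); rewrite lerDr.
rewrite e1 in main; have cTd : c / T = 1 - del by rewrite /del opprB addrC subrK.
rewrite cTd in main.
have fin (X Y z : R) : 1 - z / 4 <= 1 - z + X + Y -> X <= z / 4 -> Y <= z / 4 ->
  0 < z -> False by lra.
exact: fin main e2 e3 del0.
Qed.

End Converse.

(** * Numerical bounds *)

Section PowerBound.
Variable R : realType.

(* Locked, so that conversion never expands N.to_nat on a 60-bit numeral. *)
Fact rN_key : unit. Proof. exact: tt. Qed.
Definition rN : N -> R := locked_with rN_key (fun x => (N.to_nat x)%:R).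

Lemma rNE x : rN x = (N.to_nat x)%:R. Proof. by rewrite /rN unlock. Qed.

Lemma rNM x y : rN (N.mul x y) = rN x * rN y.
Proof. by rewrite !rNE Nnat.N2Nat.inj_mul multE natrM. Qed.

Lemma rN_le x y : N.le x y -> rN x <= rN y.
Proof. by move=> xy; rewrite !rNE ler_nat; apply/ssrnat.leP; lia. Qed.

Lemma rN_ge0 x : 0 <= rN x. Proof. by rewrite rNE ler0n. Qed.

Lemma rN_gt0 x : N.lt 0 x -> 0 < rN x.
Proof. by move=> x0; rewrite rNE ltr0n; apply/ssrnat.ltP; lia. Qed.

Lemma rN_pow2 e : rN (N.pow 2 e) = 2 ^+ N.to_nat e.
Proof.
rewrite rNE Nnat.N2Nat.inj_pow.
elim: (N.to_nat e) => [|n IH]; first by rewrite expr0.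
by rewrite PeanoNat.Nat.pow_succ_r' multE natrM IH exprS.
Qed.

(* A pair (m, e) stands for the real m / 2 ^ 60 * 2 ^ e. *)
Definition fone : N := N.pow 2 60.

Definition fval (z : N * N) : R := rN z.1 / rN fone * 2 ^+ N.to_nat z.2.

(** Keeps mantissas near 60 bits. Halving rounds up, so every operation can only increase the value,
    the safe direction for upper bounds. *)
Definition fnorm (z : N * N) : N * N :=
  if N.ltb z.1 (2 * fone) then z else (N.succ (N.div z.1 2), N.succ z.2).

Definition fmul (z t : N * N) : N * N :=
  fnorm (N.succ (N.div (z.1 * t.1) fone), N.add z.2 t.2).

Fixpoint fpow (y : N) (k : positive) : N * N :=
  match k with
  | xH => (y, 0%num)
  | xO p => let z := fpow y p in fmul z z
  | xI p => let z := fpow y p in fmul (fmul z z) (y, 0%num)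
  end.

Lemma fone_gt0 : 0 < rN fone. Proof. exact: rN_gt0. Qed.

Lemma div_up a b : b <> 0%num -> rN a <= rN b * rN (N.succ (N.div a b)).
Proof.
move=> b0; rewrite -rNM; apply: rN_le.
by apply: N.lt_le_incl; apply: N.mul_succ_div_gt.
Qed.

Lemma fnorm_le z : fval z <= fval (fnorm z).
Proof.
rewrite /fnorm; case: ifP => // _; rewrite /fval /=.
rewrite Nnat.N2Nat.inj_succ exprS mulrA ler_wpM2r ?exprn_ge0 //.
rewrite mulrAC ler_wpM2r ?invr_ge0 ?rN_ge0 // mulrC.
have := @div_up z.1 2; rewrite (_ : rN 2 = 2) ?rNE //; exact.
Qed.

Lemma fmul_le z t : fval z * fval t <= fval (fmul z t).
Proof.
apply: le_trans (fnorm_le _); rewrite /fval /=.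
rewrite Nnat.N2Nat.inj_add plusE exprD mulrACA ler_wpM2r ?mulr_ge0 ?exprn_ge0 //.
rewrite mulrACA -rNM mulrA ler_wpM2r ?invr_ge0 ?rN_ge0 //.
by rewrite ler_pdivrMr ?fone_gt0 // mulrC; apply: div_up.
Qed.

Lemma fpow_le y k : (rN y / rN fone) ^+ Pos.to_nat k <= fval (fpow y k).
Proof.
have y0 : 0 <= rN y / rN fone by rewrite divr_ge0 ?rN_ge0.
have y1 : rN y / rN fone = fval (y, 0%num) by rewrite /fval /= expr0 mulr1.
elim: k => [p IH|p IH|].
- rewrite Pos2Nat.inj_xI multE exprS exprM exprAC expr2 mulrC /=.
  apply: le_trans (fmul_le _ _); rewrite -y1 ler_wpM2r //.
  by apply: le_trans (fmul_le _ _); apply: ler_pM; rewrite ?exprn_ge0.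
- rewrite Pos2Nat.inj_xO multE exprM exprAC expr2 /=.
  by apply: le_trans (fmul_le _ _); apply: ler_pM; rewrite ?exprn_ge0.
by rewrite expr1 /= y1.
Qed.

(** x^k is bounded by repeated squaring with upward rounding; comparing it with 2^a is then a
    computation on binary integers. *)
Lemma ln_le_frac (x : R) (y : N) (k : positive) (a : N) : 0 < x ->
  x <= rN y / rN fone ->
  N.leb ((fpow y k).1 * N.pow 2 (fpow y k).2) (fone * N.pow 2 a) ->
  (Pos.to_nat k)%:R * ln x <= (N.to_nat a)%:R * ln 2.
Proof.
move=> x0 xy h; rewrite !mulr_natl -!lnXn // ?ltr0n //.
rewrite ler_ln ?posrE ?exprn_gt0 ?ltr0n //.
apply: (@le_trans _ _ ((rN y / rN fone) ^+ Pos.to_nat k)).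
  by apply: lerXn2r => //; rewrite nnegrE ?(ltW x0) // divr_ge0 ?rN_ge0.
apply: (le_trans (fpow_le y k)); rewrite /fval mulrAC ler_pdivrMr ?fone_gt0 //.
rewrite -!rN_pow2 -!rNM [N.mul (N.pow 2 a) _]N.mul_comm; apply: rN_le.
by apply/N.leb_le.
Qed.

(** [q0] is 1 / (1 + 2 / (3 sqrt 3)) to ten digits: the output law from which the rows (1, 0) and
    (1/3, 2/3) have equal divergence, the capacity. *)
Definition qN : N := 7220737024.
Definition tN : N := 10000000000.

Definition q0 : R := rN qN / rN tN.
Definition q1 : R := rN (tN - qN) / rN tN.

(** Scaled by 2^60 and rounded up: 1 / q0, and below it 4 / (27 q0 q1^2), whose logarithm is three
    times the divergence of the row (1/3, 2/3). *)
Definition y1 : N := N.succ (N.div (tN * fone) qN).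
Definition y2 : N := N.succ (N.div (4 * tN * tN * tN * fone) (27 * qN * (tN - qN) * (tN - qN))).

(** 4353 / 9266 lies between the capacity, about 0.469781994, and 0.469782. The gap is below 10^-8,
    hence the large exponent and the precision. *)
Lemma check1 : N.leb ((fpow y1 9266).1 * N.pow 2 (fpow y1 9266).2) (fone * N.pow 2 4353).
Proof. by vm_compute. Qed.

Lemma check2 : N.leb ((fpow y2 9266).1 * N.pow 2 (fpow y2 9266).2) (fone * N.pow 2 13059).
Proof. by vm_compute. Qed.

Lemma rND x y : rN (N.add x y) = rN x + rN y.
Proof. by rewrite !rNE Nnat.N2Nat.inj_add plusE natrD. Qed.

Lemma qN_gt0 : 0 < rN qN. Proof. exact: rN_gt0. Qed.
Lemma tN_gt0 : 0 < rN tN. Proof. exact: rN_gt0. Qed.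
Lemma tqN_gt0 : 0 < rN (tN - qN). Proof. exact: rN_gt0. Qed.

Lemma q0_gt0 : 0 < q0. Proof. by rewrite divr_gt0 ?qN_gt0 ?tN_gt0. Qed.
Lemma q1_gt0 : 0 < q1. Proof. by rewrite divr_gt0 ?tqN_gt0 ?tN_gt0. Qed.

Lemma q01 : q0 + q1 = 1.
Proof. by rewrite /q0 /q1 -mulrDl -rND divff // gt_eqF ?tN_gt0. Qed.

Lemma rate_ge : 4353%:R / 9266%:R <= 469782%:R / 1000000%:R :> R.
Proof. by lra. Qed.

Definition rate : R := 469782%:R / 1000000%:R.

Lemma ln2_gt0 : 0 < ln 2 :> R.
Proof. by apply: ln_gt0; rewrite ltr1n. Qed.

Lemma ln_le_sub1 (x : R) : 0 < x -> ln x <= x - 1.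
Proof. by move=> x0; have := expR_ge1Dx (ln x); rewrite lnK ?posrE //; lra. Qed.

Lemma ln2_ge : 2^-1 <= ln 2 :> R.
Proof.
have h0 : 0 < 2^-1 :> R by rewrite invr_gt0 ltr0n.
have := ln_le_sub1 h0; rewrite lnV ?posrE ?ltr0n //; lra.
Qed.

Lemma k9266 : (Pos.to_nat 9266)%:R = 9266%:R :> R.
Proof. by congr _%:R; vm_compute. Qed.

Lemma k4353 : (N.to_nat 4353)%:R = 4353%:R :> R.
Proof. by congr _%:R; vm_compute. Qed.

Lemma k13059 : (N.to_nat 13059)%:R = 3 * 4353%:R :> R.
Proof. by rewrite -natrM; congr _%:R; vm_compute. Qed.

Lemma rate_ln2 : 4353%:R / 9266%:R * ln 2 <= rate * ln 2.
Proof. by apply: ler_wpM2r; [exact/ltW/ln2_gt0|exact: rate_ge]. Qed.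

Lemma div_row1 : ln (1 / q0) <= rate * ln 2.
Proof.
have h : (Pos.to_nat 9266)%:R * ln (1 / q0) <= (N.to_nat 4353)%:R * ln 2.
  apply: (@ln_le_frac _ y1 9266 4353 _ _ check1); first by rewrite divr_gt0 ?q0_gt0.
  rewrite /q0 div1r invf_div ler_pdivrMr ?qN_gt0 // mulrAC ler_pdivlMr ?fone_gt0 //.
  by rewrite -rNM [rN y1 * _]mulrC; apply: div_up.
have -> : ln (1 / q0) = ((Pos.to_nat 9266)%:R * ln (1 / q0)) / 9266%:R.
  by rewrite k9266 [RHS]mulrAC divff ?mul1r // pnatr_eq0.
apply: le_trans rate_ln2; rewrite [X in _ <= X]mulrAC -k4353.
by apply: ler_wpM2r; [rewrite invr_ge0 ler0n|exact: h].
Qed.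

Lemma div_row2 : 3^-1 * ln (3^-1 / q0) + 2 / 3 * ln (2 / 3 / q1) <= rate * ln 2.
Proof.
have p0 := q0_gt0; have p1 := q1_gt0.
(* Three times the divergence is the logarithm of (1 / (3 q0)) (2 / (3 q1))^2. *)
pose x := 4 / (27 * q0 * q1 * q1).
have x0 : 0 < x.
  rewrite /x; apply: divr_gt0; first by rewrite ltr0n.
  by apply: mulr_gt0 => //; apply: mulr_gt0 => //; apply: mulr_gt0.
have -> : 3^-1 * ln (3^-1 / q0) + 2 / 3 * ln (2 / 3 / q1) = 3^-1 * ln x.
  have -> : x = (3^-1 / q0) * ((2 / 3 / q1) * (2 / 3 / q1)).
    by rewrite /x; field; rewrite !gt_eqF.
  have h1 : 0 < 3^-1 / q0 by apply: divr_gt0 => //; rewrite invr_gt0 ltr0n.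
  have h2 : 0 < 2 / 3 / q1.
    by apply: divr_gt0 => //; apply: divr_gt0; rewrite ltr0n.
  have L2 (u v : R) : 0 < u -> 0 < v -> ln (u * v) = ln u + ln v.
    by move=> u0 v0; rewrite lnM ?posrE.
  rewrite (L2 _ _ h1 (mulr_gt0 h2 h2)) (L2 _ _ h2 h2).
  by set l1 := ln (3^-1 / q0); set l2 := ln (2 / 3 / q1); field.
have h : (Pos.to_nat 9266)%:R * ln x <= (N.to_nat 13059)%:R * ln 2.
  apply: (@ln_le_frac _ y2 9266 13059 x0 _ check2).
  have -> : x = rN (4 * tN * tN * tN) / rN (27 * qN * (tN - qN) * (tN - qN)).
    have r4 : rN 4 = 4 by rewrite rNE.
    have r27 : rN 27 = 27 by rewrite rNE.
    rewrite /x /q0 /q1 !rNM r4 r27.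
    have ht := tN_gt0; have hq := qN_gt0; have htq := tqN_gt0.
    move: (rN qN) (rN tN) (rN (tN - qN)) hq ht htq => a b d a0 b0 d0.
    by field; rewrite !gt_eqF.
  have hd : 0 < rN (27 * qN * (tN - qN) * (tN - qN)) by exact: rN_gt0.
  rewrite ler_pdivrMr // mulrAC ler_pdivlMr ?fone_gt0 //.
  by rewrite -rNM [rN y2 * _]mulrC; apply: div_up.
have -> : 3^-1 * ln x = ((Pos.to_nat 9266)%:R * ln x) / 9266%:R / 3.
  by rewrite k9266 [X in X / 3]mulrAC divff ?pnatr_eq0 // mul1r mulrC.
apply: le_trans rate_ln2.
have -> : 4353%:R / 9266%:R * ln 2 = (N.to_nat 13059)%:R * ln 2 / 9266%:R / 3 :> R.
  by rewrite k13059; move: (4353%:R : R) (9266%:R^-1 : R) (ln 2 : R) => a b l; field.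
apply: ler_wpM2r; first by rewrite invr_ge0 ler0n.
by apply: ler_wpM2r; [rewrite invr_ge0 ler0n|exact: h].
Qed.

(** A mixture of the other two rows has clear slack, so ln x <= x - 1 and the crude bounds 7/10 <=
    q0, 27/100 <= q1 suffice. *)
Lemma div_row3 : 5 / 9 * ln (5 / 9 / q0) + 4 / 9 * ln (4 / 9 / q1) <= rate * ln 2.
Proof.
have p0 := q0_gt0; have p1 := q1_gt0.
have b0 : 7 / 10 <= q0.
  rewrite /q0 ler_pdivlMr ?tN_gt0 // mulrAC ler_pdivrMr ?ltr0n //.
  by rewrite (_ : 7 = rN 7) ?[RHS]rNE // (_ : 10 = rN 10) ?[RHS]rNE // -!rNM; apply: rN_le.
have b1 : 27 / 100 <= q1.
  rewrite /q1 ler_pdivlMr ?tN_gt0 // mulrAC ler_pdivrMr ?ltr0n //.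
  by rewrite (_ : 27 = rN 27) ?[RHS]rNE // (_ : 100 = rN 100) ?[RHS]rNE // -!rNM; apply: rN_le.
have h0 : ln (5 / 9 / q0) <= 50 / 63 - 1.
  apply: le_trans (ln_le_sub1 (divr_gt0 _ p0)) _; first by lra.
  by rewrite lerD2r ler_pdivrMr //; lra.
have h1 : ln (4 / 9 / q1) <= 400 / 243 - 1.
  apply: le_trans (ln_le_sub1 (divr_gt0 _ p1)) _; first by lra.
  by rewrite lerD2r ler_pdivrMr //; lra.
apply: (@le_trans _ _ (rate * 2^-1)).
  by rewrite /rate; move: h0 h1; set l0 := ln _; set l1 := ln _; lra.
by apply: ler_wpM2l; [rewrite /rate; lra|exact: ln2_ge].
Qed.

End PowerBound.

(** * The twirled box *)

Lemma oppmxE (R : realType) m n (A : 'M[R[i]]_(m, n)) i j : (- A) i j = - A i j.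
Proof. by rewrite mxE. Qed.

Section TwirledBox.
Variable R : realType.
Local Notation C := R[i].
Local Notation q := 'I_2.
Local Notation P := (P R).
Local Notation one := (1%:M : 'M[C]_(2 * 2)).
Local Notation rc := (real_complex R).

Lemma P_ct : P^t* = P.
Proof.
apply: mxtensP => a b a' b'; rewrite mxE mxE !PE !rmorphM /= fmorphV /= !conjC_nat.
by rewrite [X in _ * X]mulrC.
Qed.

Lemma PP : P *m P = P.
Proof.
apply: mxtensP => a b a' b'; rewrite mxE sum22 !PE /=.
by case: (a == b); case: (a' == b'); rewrite /=; field.
Qed.

Lemma Pi_idem s : Pi R s *m (Pi R s)^t* = Pi R s.
Proof.
have ct : (Pi R s)^t* = Pi R s.
  case: s; rewrite /= ?P_ct //.
  by rewrite linearB /= map_mxB trmx1 map_mx1 P_ct.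
rewrite ct; case: s {ct}; rewrite /= ?PP //.
by rewrite mulmxBl mul1mx mulmxBr mulmx1 PP subrr subr0.
Qed.

Lemma sum_st (T : nmodType) (f : bool * bool -> T) :
  \sum_x f x = \sum_s \sum_t f (s, t).
Proof. by rewrite pair_big; apply: eq_bigr => -[]. Qed.

Definition Vst (x : bool * bool) := ro (Pi R x.1) (Pi R x.2).

Lemma Vst_gram x : Vst x *m (Vst x)^t* = Vst x.
Proof. by rewrite /Vst ro_ct ro_mul !Pi_idem. Qed.

Lemma Vst_sum : \sum_x Vst x *m (Vst x)^t* = 1%:M.
Proof.
under eq_bigr do rewrite Vst_gram.
rewrite sum_st !big_bool /Vst /= -!roDr -!roDl.
by rewrite addrC subrK ro1.
Qed.

(** The phase-flipped GHZ state (|000> - |111>) / sqrt 2. *)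
Definition ghzm : 'cV[C]_(2 * 2 * 2) := (sqrtC 2)^-1 *:
  \col_x f3 (fun a b c : q => [&& a == b & b == c]%:R * (if a == ord0 then 1 else -1)) x.

Lemma pure_ghzm : pure ghzm =
  D3 (fun a b c : q => [&& a == b & b == c]%:R) - ghzmx R.
Proof.
have gE a b c k : ghzm (mi (mi a b) c) k = (sqrtC 2)^-1 *
    ([&& a == b & b == c]%:R * (if a == ord0 then 1 else -1)) by rewrite !mxE f3E.
apply: mxtens3P => a b c a' b' c'.
rewrite addmxE [(- ghzmx R) _ _]mxE M3E D3E mxE big_ord1 gE mxE mxE gE rmorphM /=.
rewrite mulrACA sqrt2V2 rmorphM /= conjC_nat.
have cs : Num.conj (if a' == ord0 then 1 else -1 : C) = if a' == ord0 then 1 else -1.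
  by case: ifP; rewrite ?rmorphN /= conjC1.
rewrite cs; case: a b c a' b' c' {cs} => -[|[|//]] ? [[|[|//]] ?] [[|[|//]] ?]
  [[|[|//]] ?] [[|[|//]] ?] [[|[|//]] ?]; by rewrite /=; field.
Qed.

(** The normalised parts with a = b and with a != b of the values of the box on Pi s (x) Pi t. The
    outcome (true, true), false has probability zero; it is filled in with a state reducing to
    [tau false], so that [Lam_tau] holds throughout. *)
Definition Lam (x : bool * bool) (y : bool) : 'M[C]_(2 * 2 * 2) :=
  match x, y with
  | (true, true), true => ghzmx R
  | (false, true), true | (true, false), true => pure ghzm
  | (false, false), true =>
      5^-1 *: (ghzmx R + D3 (fun a b c : q => 2 * ((a == b) && (b != c))%:R))
  | (true, true), false | (false, true), false =>
      D3 (fun a b c : q => 2^-1 * ((a != b) && (b == c))%:R)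
  | (true, false), false => D3 (fun a b c : q => 2^-1 * ((a != b) && (a == c))%:R)
  | (false, false), false => D3 (fun a b c : q => 4^-1 * (a != b)%:R)
  end.

(* The box leaves A and B in a classical mixture of the equal (y = true) and of
   the different (y = false) computational basis states. *)
Definition tau (y : bool) : 'M[C]_(2 * 2) := \matrix_(i, j)
  let u := mxtens_unindex i in ((i == j) && ((u.1 == u.2) == y))%:R / 2.

Lemma tauE y a b a' b' : tau y (mi a b) (mi a' b') =
  [&& a == a', b == b' & (a == b) == y]%:R / 2.
Proof. by rewrite mxE mi_eq !mxtens_indexK /= andbA. Qed.

Definition wt (x : bool * bool) (y : bool) : R :=
  match x, y with
  | (true, true), true => 1
  | (true, true), false => 0
  | (false, false), true => 5 / 9
  | (false, false), false => 4 / 9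
  | _, true => 3^-1
  | _, false => 2 / 3
  end.

Definition qy (y : bool) : R := if y then q0 R else q1 R.

Lemma tpos_ghz : tpos (ghzmx R).
Proof. by rewrite -pure_ghz; exact: tpos_pure. Qed.

Lemma tpos_D3 d : (forall a b c : q, 0 <= d a b c :> C) -> tpos (D3 d).
Proof. by move=> d0; apply: tpos_diag; elim/ind3 => a b c; rewrite mxE f3E. Qed.

Lemma Lam_pos x y : tpos (Lam x y).
Proof.
have n0 n (b : bool) : 0 <= n%:R^-1 * b%:R :> C by rewrite mulr_ge0 ?invr_ge0 ?ler0n.
case: x y => -[] [] [].
- exact: tpos_ghz.
- by apply: tpos_D3 => a b c; exact: (n0 2).
- exact: tpos_pure.
- by apply: tpos_D3 => a b c; exact: (n0 2).
- exact: tpos_pure.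
- by apply: tpos_D3 => a b c; exact: (n0 2).
- apply: tposZ; first by rewrite invr_ge0 ler0n.
  apply: tposD; first exact: tpos_ghz.
  by apply: tpos_D3 => a b c; rewrite mulr_ge0 ?ler0n.
- by apply: tpos_D3 => a b c; exact: (n0 4).
Qed.

Lemma Lam_tau x y : ptrace_r (Lam x y) = tau y.
Proof.
apply: mxtensP => a b a' b'; rewrite mxE sum2 tauE.
by case: x y => -[] [] []; rewrite /Lam ?pure_ghzm ?scalemxE ?addmxE ?[(- ghzmx R) _ _]mxE
  ?M3E ?D3E; case: a b a' b' => -[|[|//]] ? [[|[|//]] ?] [[|[|//]] ?] [[|[|//]] ?];
  rewrite /=; field.
Qed.

Lemma tr_tau y : \tr (tau y) = 1.
Proof. by rewrite /mxtrace sum22 !tauE; case: y; rewrite /=; field. Qed.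

Lemma wt_ge0 x y : 0 <= wt x y.
Proof. by case: x y => -[] [] []; rewrite /= ?divr_ge0 ?invr_ge0 ?ler0n. Qed.

Lemma wt1 x : \sum_y wt x y = 1.
Proof. by rewrite big_bool; case: x => -[] []; rewrite /=; field. Qed.

Lemma wt_div x : \sum_y wt x y * ln (wt x y / qy y) <= rate R * ln 2.
Proof.
rewrite big_bool; case: x => -[] [] /=.
- by rewrite mul1r mul0r addr0; exact: div_row1.
- exact: div_row2.
- exact: div_row2.
- exact: div_row3.
Qed.

Variable mu : probability (borelM2 R) R.
Hypothesis haar : is_haar_U2 mu.
Variable L : qbox R.
Hypothesis locL : locc L.
Hypothesis LPP : L (ro P P) = ghzmx R.

Lemma twirled_sum X : L (twirl mu X) =
  \sum_x \sum_y (rc (wt x y) * \tr (Vst x *m (Vst x)^t* *m X)) *: Lam x y.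
Proof.
have lL := locc_lin locL.
have LB := box_BC2 locL LPP; have LA := box_AC1 locL LPP; have LI := box_id locL LPP.
rewrite (twirl_sum haar) sum_st (lin_sum lL); apply: eq_bigr => s _.
rewrite (lin_sum lL); apply: eq_bigr => t _; rewrite Vst_gram (linZ lL).
rewrite [Vst _]/(ro (Pi R s) (Pi R t)); set z := \tr _.
(* [(Pd s * Pd t)^-1] is the trace of Pi s (x) Pi t, namely 1, 3, 3 or 9. Dividing the value of [L]
   by it leaves a state. *)
suff -> : L (ro (Pi R s) (Pi R t)) = (Pd R s * Pd R t)^-1 *:
    \sum_y rc (wt (s, t) y) *: Lam (s, t) y.
  rewrite scalerA mulrAC divff ?mul1r ?scaler_sumr; last first.
    by case: s t {z} => -[]; rewrite /= ?mulf_neq0 ?oner_eq0 ?invr_eq0 ?pnatr_eq0.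
  by apply: eq_bigr => y _; rewrite scalerA mulrC.
have rcq (x y : nat) : rc (x%:R / y%:R) = x%:R / y%:R by rewrite fmorph_div !rmorph_nat.
have rcV (y : nat) : rc (y%:R^-1) = y%:R^-1 by rewrite fmorphV rmorph_nat.
rewrite big_bool; case: s t {z} => -[]; rewrite /Pi /wt /Lam ?rcq ?rcV ?rmorph1 ?rmorph0
  ?pure_ghzm ?(roDl, roDr, roNl, roNr) ?ro1 ?opprK ?(linD lL, linN lL, linB lL)
  ?LPP ?LA ?LB ?LI /=.
all: apply: mxtens3P => a b c a' b' c'.
all: rewrite !(addmxE, scalemxE) ?oppmxE ?M3E ?D3E.
all: case: a b c a' b' c' => -[|[|//]] ? [[|[|//]] ?] [[|[|//]] ?]
      [[|[|//]] ?] [[|[|//]] ?] [[|[|//]] ?].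
all: by rewrite /=; field.
Qed.

End TwirledBox.

(** * The twirled box: membership, signalling and communication value *)

Section Conclusion.
Variable R : realType.
Local Notation C := R[i].
Local Notation P := (P R).
Variable mu : probability (borelM2 R) R.
Hypothesis haar : is_haar_U2 mu.
Variable L : qbox R.
Hypothesis boxL : two_epr_ghz_box L.

Let locL : locc L. Proof. by case: boxL. Qed.

Let LPP : L (ro P P) = ghzmx R.
Proof. by rewrite -pure_two_epr -pure_ghz; case: boxL. Qed.

Lemma twirl_two_epr : twirl mu (ro P P) = ro P P.
Proof.
rewrite (twirl_sum haar) big_bool !big_bool /= !ro_mul PP mulmxBl mul1mx PP subrr.
have z X : \tr (@ro R 0 X) = 0 by rewrite tr_ro mxtrace0 mul0r.
have z' X : \tr (@ro R X 0) = 0 by rewrite tr_ro mxtrace0 mulr0.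
by rewrite !z !z' tr_ro tr_P !mulr0 !scale0r !addr0 !mulr1 scale1r.
Qed.

Lemma twirled_box : two_epr_ghz_box (L \o twirl mu).
Proof.
split; last by rewrite pure_two_epr pure_ghz /= twirl_two_epr.
have := locc_kf locL; congr locc; apply/funext => X /=.
by rewrite (twirlE haar).
Qed.

Lemma ptrace_twirled X : ptrace_r (L (twirl mu X)) =
  \sum_x \sum_y (real_complex R (wt R x y) * \tr (Vst R x *m (Vst R x)^t* *m X)) *: tau R y.
Proof.
rewrite (twirled_sum haar locL LPP) (lin_sum (@ptrace_r_lin _ _ _)).
apply: eq_bigr => x _; rewrite (lin_sum (@ptrace_r_lin _ _ _)).
by apply: eq_bigr => y _; rewrite (linZ (@ptrace_r_lin _ _ _)) Lam_tau.
Qed.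

(** Both [tau y] have the same reduction D, so the reduced output is D scaled by the trace of the
    input, which Charlie's channels preserve. *)
Lemma no_signalling (f : 'M[C]_(2 * 2) -> 'M[C]_2) (D : 'M[C]_2) :
  linear f -> (forall y, f (tau R y) = D) ->
  ~ signalling_to (fun X => f (ptrace_r X)) (L \o twirl mu).
Proof.
move=> lf fD [rho [G0 [G1 [_ cG0 cG1]]]]; apply.
suff fE X : f (ptrace_r (L (twirl mu X))) = \tr X *: D.
  have trG G : channel G -> \tr (apply_C G rho) = \tr rho.
    by move=> [[lG _] tG]; rewrite /apply_C tr_C // tG tr_ptrace_l.
  have e G : channel G ->
      f (ptrace_r ((L \o twirl mu) (apply_C G rho))) = \tr rho *: D.
    by move=> cG; rewrite -(trG G cG); exact: fE.
  exact: etrans (e _ cG0) (esym (e _ cG1)).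
rewrite ptrace_twirled (lin_sum lf).
transitivity (\sum_x \tr (Vst R x *m (Vst R x)^t* *m X) *: D).
  apply: eq_bigr => x _; rewrite (lin_sum lf).
  under eq_bigr do rewrite (linZ lf) fD -scalerA.
  by rewrite -scaler_suml -rmorph_sum wt1 rmorph1 scale1r.
by rewrite -scaler_suml -raddf_sum -mulmx_suml Vst_sum mul1mx.
Qed.

Lemma ptrace_r_tau y : ptrace_r (tau R y) = 2^-1 *: 1%:M.
Proof.
apply/matrixP => a a'; rewrite mxE sum2 !tauE scalemxE oneE.
by case: a a' y => -[|[|//]] ? [[|[|//]] ?] []; rewrite /=; field.
Qed.

Lemma ptrace_l_tau y : ptrace_l (tau R y) = 2^-1 *: 1%:M.
Proof.
apply/matrixP => a a'; rewrite mxE sum2 !tauE scalemxE oneE.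
by case: a a' y => -[|[|//]] ? [[|[|//]] ?] []; rewrite /=; field.
Qed.

Lemma qy_gt0 y : 0 < qy R y.
Proof. by case: y; [exact: q0_gt0|exact: q1_gt0]. Qed.

Lemma qy1 : \sum_y qy R y = 1.
Proof. by rewrite big_bool; exact: q01. Qed.

Lemma CV_twirled : (CV (L \o twirl mu) <= (rate R)%:E)%E.
Proof.
have l2 := ln2_gt0 R.
(* The converse is in nats and the communication value in bits, hence the factor ln 2. *)
apply: ge_ereal_sup => _ [r ach <-]; rewrite lee_fin -(ler_pM2r l2).
have c0 : 0 <= rate R * ln 2.
  by apply: mulr_ge0; [rewrite /rate; lra|exact: ltW].
exact: (achievable_le (Vst_sum R) (@Lam_pos R) (@Lam_tau R) (@tr_tau R) (@wt_ge0 R)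
  (@wt1 R) qy_gt0 qy1 (@wt_div R) (twirled_sum haar locL LPP) c0 ach).
Qed.

End Conclusion.

Theorem theorem6 (R : realType) (mu : probability (borelM2 R) R)
    (L : qbox R) :
  is_haar_U2 mu -> two_epr_ghz_box L ->
  let Lt : qbox R := L \o twirl mu in
  [/\ two_epr_ghz_box Lt,
      (CV Lt < 1)%E,
      ~ signalling_CA Lt,
      ~ signalling_CB Lt &
      (CV Lt <= (469782%:R / 1000000%:R)%:E)%E].
Proof.
move=> haar boxL Lt; have cv := CV_twirled haar boxL.
split.
- exact: twirled_box.
- apply: (le_lt_trans cv); rewrite lte_fin /rate; lra.
- exact: (no_signalling haar boxL (@ptrace_r_lin R 2 2) (@ptrace_r_tau R)).
- exact: (no_signalling haar boxL (@ptrace_l_lin R 2 2) (@ptrace_l_tau R)).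
- exact: cv.
Qed.
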